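(* Let $E$ be a finite directed graph with vertex matrix $A\in M_{E^0}(\mathbb{N})$, $A(v,w)=|vE^1w|$. Let $\gamma:\mathbb{T}\to\operatorname{Aut}\mathcal{T}C^*(E)$ be the gauge action and define $\alpha:\mathbb{R}\to\operatorname{Aut}\mathcal{T}C^*(E)$ by $\alpha_t=\gamma_{e^{it}}$. Let $\beta\in\mathbb{R}$ and assume that $\beta>\ln\rho(A)$. (a) For each $v\in E^0$, the series $\sum_{\mu\in E^*v}e^{-\beta|\mu|}$ either converges or is finite, with sum $y_v\geq 1$. Set $y:=(y_v)\in[1,\infty)^{E^0}$, and consider $\epsilon\in[0,\infty)^{E^0}$. Then $m:=(I-e^{-\beta}A)^{-1}\epsilon$ is a probability measure on $E^0$ if and only if $\epsilon\cdot y=1$. (b) Suppose $\epsilon\in[0,\infty)^{E^0}$ satisfies $\epsilon\cdot y=1$, and set $m:=(I-e^{-\beta}A)^{-1}\epsilon$. Then there is a KMS$_\beta$ state $\phi_\epsilon$ of $(\mathcal{T}C^*(E),\alpha)$ satisfying $$\phi_\epsilon(s_\mu s_\nu^* )=\delta_{\mu,\nu}e^{-\beta|\mu|}m_{s(\mu)}\quad\text{for all }\mu,\nu\in E^*.$$ (c) The map $\epsilon\mapsto\phi_\epsilon$ is an affine isomorphism of $$\Sigma_\beta:=\{\epsilon\in[0,\infty)^{E^0}:\epsilon\cdot y=1\}$$ onto the simplex of KMS$_\beta$ states of $(\mathcal{T}C^*(E),\alpha)$. The inverse of this isomorphism takes a KMS$_\beta$ state $\phi$ to $(I-e^{-\beta}A)m^\phi$,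 where $m^\phi=(m^\phi_v)_{v\in E^0}$ is given by $m^\phi_v=\phi(p_v)$.
   Context: Graphs. A directed graph $E=(E^0,E^1,r,s)$ has a (nonempty) vertex set $E^0$, edge set $E^1$, and range and source maps $r,s:E^1\to E^0$; it is finite if $E^0$ and $E^1$ are finite. A path of length $n\ge 1$ is $\mu=\mu_1\cdots\mu_n$ with $\mu_i\in E^1$ and $s(\mu_i)=r(\mu_{i+1})$; $r(\mu)=r(\mu_1)$, $s(\mu)=s(\mu_n)$, $|\mu|=n$. Vertices are paths of length $0$ with $r(v)=s(v)=v$. $E^n$ is the set of paths of length $n$, $E^*=\bigcup_{n\ge0}E^n$; $E^*v=\{\mu\in E^*:s(\mu)=v\}$, $vE^1w=\{e\in E^1:r(e)=v,\ s(e)=w\}$, $vE^1=\{e\in E^1:r(e)=v\}$. $\mathbb{N}$ contains $0$. Toeplitz algebra. A Toeplitz-Cuntz-Krieger $E$-family consists of mutually orthogonal projections $\{P_v:v\in E^0\}$ and partial isometries $\{S_e:e\in E^1\}$ with $S_e^*S_e=P_{s(e)}$ and $P_v\ge\sum_{e\in F}S_eS_e^*$ for every $v\in E^0$ and every finite $F\subset vE^1$. $\mathcal{T}C^*(E)$ is the $C^*$-algebra generated by a universal such family $(p,s)$. For $\mu=\mu_1\cdots\mu_n$, $s_\mu=s_{\mu_1}\cdots s_{\mu_n}$, and $s_v=p_v$ for $v\in E^0$; $\mathcal{T}C^*(E)$ is the closed span of the elements $s_\mu s_\nu^*$. The gauge action satisfies $\gamma_z(s_\mu s_\nu^* )=z^{|\mu|-|\nu|}s_\mu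 s_\nu^*$ $(z\in\mathbb{T})$; so $\alpha_z(s_\mu s_\nu^* )=e^{iz(|\mu|-|\nu|)}s_\mu s_\nu^*$ is defined for all $z\in\mathbb{C}$. KMS states. For $\beta\in\mathbb{R}\setminus\{0\}$, a state $\phi$ is a KMS$_\beta$ state if $\phi(ab)=\phi(b\,\alpha_{i\beta}(a))$ for all $\alpha$-analytic $a,b$ (equivalently for all $a,b\in\{s_\mu s_\nu^*:\mu,\nu\in E^*\}$). KMS$_0$ states are the $\alpha$-invariant tracial states. Other conventions. $\rho(A)$ is the spectral radius of $A$, and $\ln 0=-\infty$. A probability measure on $E^0$ is identified with a vector in $[0,\infty)^{E^0}$ whose entries sum to $1$; $\epsilon\cdot y=\sum_v\epsilon_vy_v$. An affine isomorphism is an affine bijection between convex sets. *)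

(* Defs.v *)
From HB Require Import structures.
From mathcomp Require Import all_boot all_order all_algebra complex.
From mathcomp Require Import all_classical all_reals all_analysis.

Set Implicit Arguments.
Unset Strict Implicit.
Unset Printing Implicit Defensive.

Import Order.TTheory GRing.Theory Num.Theory.
Import numFieldNormedType.Exports.

Local Open Scope classical_set_scope.
Local Open Scope ring_scope.
Local Open Scope complex_scope.

(* Complex C*-algebras, not assumed to be unital.  The norm of a normed module
   over R[i] takes its values in R[i], and 0 <= z in R[i] means that z is real
   and nonnegative. *)
HB.mixin Record CompleteNormedModule_isCStarAlgebra (R : realType) (T : Type)
    of CompleteNormedModule R[i] T := {
  cmul : T -> T -> T;
  adj : T -> T;
  cmulA : forall a b c, cmul a (cmul b c) = cmul (cmul a b) c;
  cmulDl : forall a b c, cmul (a + b) c = cmul a c + cmul b c;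
  cmulDr : forall a b c, cmul a (b + c) = cmul a b + cmul a c;
  cmulZl : forall (k : R[i]) a b, cmul (k *: a) b = k *: cmul a b;
  cmulZr : forall (k : R[i]) a b, cmul a (k *: b) = k *: cmul a b;
  adjK : forall a, adj (adj a) = a;
  adjD : forall a b, adj (a + b) = adj a + adj b;
  adjZ : forall (k : R[i]) a, adj (k *: a) = k^* *: adj a;
  adjM : forall a b, adj (cmul a b) = cmul (adj b) (adj a);
  ler_normcM : forall a b, `|cmul a b| <= `|a| * `|b|;
  cstar_norm : forall a, `|cmul (adj a) a| = `|a| ^+ 2
}.

#[short(type="cstarAlgType")]
HB.structure Definition CStarAlgebra (R : realType) :=
  { T of CompleteNormedModule_isCStarAlgebra R T & CompleteNormedModule R[i] T }.

Notation "a ** b" := (cmul a b) (at level 40, left associativity) : ring_scope.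

(* The positive elements of a C*-algebra are those of the form c^* c. *)
Definition cstar_le (R : realType) (T : cstarAlgType R) (a b : T) : Prop :=
  exists c : T, b - a = adj c ** c.

Definition star_hom (R : realType) (S T : cstarAlgType R) (f : S -> T) : Prop :=
  [/\ forall (k : R[i]) a b, f (k *: a + b) = k *: f a + f b,
      forall a b, f (a ** b) = f a ** f b
    & forall a, f (adj a) = adj (f a)].

Definition cstar_subalg (R : realType) (T : cstarAlgType R) (B : set T) : Prop :=
  [/\ closed B, B 0, forall (k : R[i]) a b, B a -> B b -> B (k *: a + b),
      forall a b, B a -> B b -> B (a ** b) & forall a, B a -> B (adj a)].

Definition state (R : realType) (T : cstarAlgType R) (phi : T -> R[i]) : Prop :=
  [/\ forall (k : R[i]) a b, phi (k *: a + b) = k * phi a + phi b,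
      forall a, 0 <= phi (adj a ** a)
    & ereal_sup [set (complex.Re `|phi a|)%:E | a in [set a : T | `|a| <= 1]]
        = 1%:E].

Record fin_digraph := FinDigraph {
  vertex : finType;
  edge : finType;
  rng : edge -> vertex;
  src : edge -> vertex;
  vertex_gt0 : (0 < #|vertex|)%N
}.

(* A path is encoded as its range r(mu) together with the list of its edges;
   the list is empty exactly for the paths of length 0. *)
Fixpoint is_path (E : fin_digraph) (v : vertex E) (l : seq (edge E)) : bool :=
  if l is e :: l' then (rng e == v) && is_path (src e) l' else true.

Definition gpath (E : fin_digraph) : Type :=
  {x : vertex E * seq (edge E) | is_path x.1 x.2}.

HB.instance Definition _ (E : fin_digraph) := Choice.on (gpath E).

Definition path_rng (E : fin_digraph) (mu : gpath E) : vertex E := (val mu).1.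

Definition path_src (E : fin_digraph) (mu : gpath E) : vertex E :=
  last (val mu).1 [seq src e | e <- (val mu).2].

Definition path_len (E : fin_digraph) (mu : gpath E) : nat := size (val mu).2.

Definition adjacency (R : realType) (E : fin_digraph) : 'M[R]_#|vertex E| :=
  \matrix_(i, j)
    #|[set e : edge E | (rng e == enum_val i) && (src e == enum_val j)]|%:R.

Definition coef (R : realType) (E : fin_digraph) (x : 'cV[R]_#|vertex E|)
  (v : vertex E) : R := x (enum_rank v) 0.

Definition spectral_radius (R : realType) (n : nat) (A : 'M[R]_n) : R :=
  sup [set complex.Re `|z| |
        z in [set z : R[i] | eigenvalue (map_mx (real_complex R) A) z]].

Definition path_series (R : realType) (E : fin_digraph) (beta : R)
  (v : vertex E) : \bar R :=
  (\esum_(mu in [set mu : gpath E | path_src mu = v])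
     (expR (- beta * (path_len mu)%:R))%:E)%E.

Definition path_sum (R : realType) (E : fin_digraph) (beta : R)
  (v : vertex E) : R := fine (path_series beta v).

Definition kms_mx (R : realType) (E : fin_digraph) (beta : R) :
  'M[R]_#|vertex E| := 1%:M - expR (- beta) *: adjacency R E.

Definition prob_measure (R : realType) (E : fin_digraph)
  (m : 'cV[R]_#|vertex E|) : Prop :=
  (forall v, 0 <= coef m v) /\ \sum_(v : vertex E) coef m v = 1.

(* The condition on the sum is epsilon . y = 1, where y_v = path_sum beta v. *)
Definition Sigma (R : realType) (E : fin_digraph) (beta : R) :
  set 'cV[R]_#|vertex E| :=
  [set eps | (forall v, 0 <= coef eps v) /\
             \sum_(v : vertex E) coef eps v * path_sum beta v = 1].

Section ToeplitzAlgebra.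
Variables (R : realType) (E : fin_digraph).

Definition tck_family (T : cstarAlgType R)
  (P : vertex E -> T) (S : edge E -> T) : Prop :=
  [/\ forall v, adj (P v) = P v /\ P v ** P v = P v,
      forall v w, v != w -> P v ** P w = 0,
      forall e, S e ** adj (S e) ** S e = S e,
      forall e, adj (S e) ** S e = P (src e)
    & forall v (F : {set edge E}), (forall e, e \in F -> rng e = v) ->
        cstar_le (\sum_(e in F) S e ** adj (S e)) (P v)].

(* TC^*(E), generated by (p, s), up to isomorphism: p and s generate T as a
   C*-algebra, and (p, s) is universal among Toeplitz-Cuntz-Krieger families. *)
Definition toeplitz_algebra (T : cstarAlgType R)
  (p : vertex E -> T) (s : edge E -> T) : Prop :=
  [/\ tck_family p s,
      forall B : set T, cstar_subalg B ->
        (forall v, B (p v)) -> (forall e, B (s e)) -> B = setT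
    & forall (B : cstarAlgType R) (P : vertex E -> B) (S : edge E -> B),
        tck_family P S ->
        exists f : T -> B, [/\ star_hom f, forall v, f (p v) = P v
                             & forall e, f (s e) = S e]].

Variables (T : cstarAlgType R) (p : vertex E -> T) (s : edge E -> T).

Definition path_elt (mu : gpath E) : T :=
  if (val mu).2 is e :: l then foldl (fun a f => a ** s f) (s e) l
  else p (val mu).1.

(* Only the values of gamma on the unit circle matter. *)
Definition gauge_action (gamma : R[i] -> T -> T) : Prop :=
  [/\ forall z, `|z| = 1 -> star_hom (gamma z) /\ bijective (gamma z),
      forall z w, `|z| = 1 -> `|w| = 1 ->
        forall a, gamma (z * w) a = gamma z (gamma w a)
    & forall z, `|z| = 1 -> forall mu nu : gpath E,
        gamma z (path_elt mu ** adj (path_elt nu)) =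
        z ^ ((path_len mu)%:Z - (path_len nu)%:Z)
          *: (path_elt mu ** adj (path_elt nu))].

End ToeplitzAlgebra.

Section KMS.
Variables (R : realType) (T : cstarAlgType R).

(* Analyticity on the whole complex plane: F is the sum of a norm-convergent
   power series around every point. *)
Definition entire (F : R[i] -> T) : Prop :=
  forall z0 : R[i], exists (c : nat -> T) (rad : R[i]), 0 < rad /\
    forall h : R[i], `|h| < rad ->
      (fun n => \sum_(0 <= k < n) h ^+ k *: c k) @ \oo --> F (z0 + h).

Variable alpha : R -> T -> T.

(* By the identity theorem there is at most one such F for a given a; it is
   z |-> alpha_z(a). *)
Definition analytic_ext (a : T) (F : R[i] -> T) : Prop :=
  entire F /\ forall t : R, F t%:C = alpha t a.

Definition kms_state (beta : R) (phi : T -> R[i]) : Prop :=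
  state phi /\
  if beta == 0 then
    (forall t a, phi (alpha t a) = phi a) /\
    (forall a b, phi (a ** b) = phi (b ** a))
  else
    forall (a b : T) (F G : R[i] -> T),
      analytic_ext a F -> analytic_ext b G ->
      phi (a ** b) = phi (b ** F (0 +i* beta)).

End KMS.

Definition gauge_dynamics (R : realType) (T : Type) (gamma : R[i] -> T -> T)
  (t : R) : T -> T := gamma (cos t +i* sin t).

(* The convex hull of finitely many, and at least one, affinely independent
   points of the real affine space X -> R[i]. *)
Definition simplex (R : realType) (X : Type) (K : set (X -> R[i])) : Prop :=
  exists (n : nat) (x : 'I_n.+1 -> X -> R[i]),
    (forall t : 'I_n.+1 -> R, \sum_i t i = 0 ->
       (forall a, \sum_i (t i)%:C * x i a = 0) -> forall i, t i = 0) /\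
    K = [set phi | exists t : 'I_n.+1 -> R,
           [/\ forall i, 0 <= t i, \sum_i t i = 1
             & phi = (fun a => \sum_i (t i)%:C * x i a)]].

Definition affine_on (R : realType) (V : lmodType R) (X : Type)
  (A : set V) (f : V -> X -> R[i]) : Prop :=
  forall x y (t : R), A x -> A y -> 0 <= t <= 1 ->
    f (t *: x + (1 - t) *: y) =
    (fun a => t%:C * f x a + (1 - t)%:C * f y a).

(* Main.v *)
Require Import Defs.
From HB Require Import structures.
From mathcomp Require Import all_boot all_order all_algebra complex.
From mathcomp Require Import all_classical all_reals all_analysis.
From mathcomp Require Import ring lra zify.

Set Implicit Arguments.
Unset Strict Implicit.
Unset Printing Implicit Defensive.

Import Order.TTheory GRing.Theory Num.Theory.
Import numFieldNormedType.Exports.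

Local Open Scope classical_set_scope.
Local Open Scope ring_scope.
Local Open Scope complex_scope.

(** Put [x := e^-beta].  All eigenvalues of [x A] have modulus less than [1], so
    by the Cayley-Hamilton theorem the powers of [x A] are summable; this gives
    the invertibility of [I - x A] and the positivity of its inverse, and
    splitting off the last edge of a path gives [y^T = 1^T + x y^T A], whence
    [sum_v m_v = eps . y].

    For the existence of [phi_eps], let [e] act on the Hilbert space with basis
    [h_(la,ka)], for [la] and [ka] in [E^*], by [h_(la,ka) |-> h_(e la,ka)].  The
    universal property gives a representation [Q], and [phi_eps a] is
    [<Q a xi, xi>] with [xi := sum_la (x^|la| eps_(s(la)))^(1/2) h_(la,la)].
    The matrix coefficients of [Q (F z)] are entire functions, so the identity
    theorem shows that passing from [a] to [alpha_(i beta)(a)] multiplies the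
    coefficient at [(la,ka)] by [x^(|la| - |ka|)], and the KMS condition becomes
    the invariance of a double sum under exchanging [la] and [ka].  Moreover
    [phi_eps (p_v - sum_(r(e)=v) s_e s_e^* ) = eps_v], that is,
    [(I - x A) m = eps].

    Conversely, the KMS condition forces the formula of (b) on any KMS state, its
    value on [p_v - sum_(r(e)=v) s_e s_e^*] is [((I - x A) m)_v], and this element
    is of the form [c^* c].  States are determined by their values on the
    [s_mu s_nu^*].

    Working with elements of the form [c^* c] without functional calculus, one
    does not get [p_(r(e)) s_e = s_e] and [s_e^* s_f = 0] directly; these
    relations are only used up to the elements killed by all positive functionals,
    which form an ideal. *)

(** * Unconditional sums *)

(** Representations come only from the universal property, which quantifies over C*-algebras in the
    formal sense; the bounded operators on l2(I) are therefore built as a complete C*-algebra. The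
    homomorphisms obtained are purely algebraic. Their contractivity is proved by hand, because
    arguments from generators need closed solution sets.

    The functional of (b) is the trace of [Q a] against a diagonal density with entries x^|la|
    eps_(s(la)), of total mass eps . y = 1. The second coordinate of the basis makes this trace a
    vector functional: [xi] is the square root of the density, read as a Hilbert-Schmidt operator,
    so no theory of trace-class operators is needed. Operators on the second coordinate commute with
    every [Q a], which gives [Q a] a matrix indexed by pairs of paths.

    The span of the s_mu s_nu^* is shown to be stable under the generators only modulo null
    elements. Density is therefore used in dual form: a bounded functional vanishing on null
    elements and on all s_mu s_nu^* is zero. *)

Section RealSums.
Variables (R : realType) (I : choiceType).
Implicit Types f g h : I -> R.

Definition nnsum f : \bar R := (\esum_(i in [set: I]) (f i)%:E)%E.

Definition abs_summable f : Prop := (nnsum (fun i => `|f i|%R) < +oo)%E.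

(** Meaningful for absolutely summable [f]: [fine] sends an infinite sum to 0. *)
Definition rsum f : R :=
  fine (nnsum (fun i => Num.max (f i) 0)) -
  fine (nnsum (fun i => Num.max (- f i) 0)).

Lemma nnsum_ge0 f : (forall i, 0 <= f i) -> (0 <= nnsum f)%E.
Proof. by move=> f0; apply: esum_ge0 => i _; rewrite lee_fin. Qed.

Lemma le_nnsum f g : (forall i, f i <= g i) -> (nnsum f <= nnsum g)%E.
Proof. by move=> fg; apply: le_esum => i _; rewrite lee_fin. Qed.

Lemma nnsumD f g : (forall i, 0 <= f i) -> (forall i, 0 <= g i) ->
  nnsum (fun i => f i + g i) = (nnsum f + nnsum g)%E.
Proof.
move=> f0 g0; rewrite /nnsum -esumD; [|by move=> *; rewrite lee_fin..].
by apply: eq_esum => i _; rewrite EFinD.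
Qed.

Lemma nnsum_fin f : (forall i, 0 <= f i) -> (nnsum f < +oo)%E ->
  nnsum f \is a fin_num.
Proof. by move=> f0 foo; rewrite ge0_fin_numE// nnsum_ge0. Qed.

Lemma nnsum_finS f g : (forall i, 0 <= f i <= g i) -> (nnsum g < +oo)%E ->
  (nnsum f < +oo)%E.
Proof. by move=> fg; apply: le_lt_trans; apply: le_nnsum => i; case/andP: (fg i). Qed.

Lemma fine_nnsumD f g : (forall i, 0 <= f i) -> (forall i, 0 <= g i) ->
  (nnsum f < +oo)%E -> (nnsum g < +oo)%E ->
  fine (nnsum (fun i => f i + g i)) = fine (nnsum f) + fine (nnsum g).
Proof. by move=> f0 g0 fo go; rewrite nnsumD// fineD// nnsum_fin. Qed.

Lemma nnsum0 : nnsum (fun=> 0) = 0%E.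
Proof. by rewrite /nnsum esum1. Qed.

Lemma nnsum_ge f (s : seq I) : uniq s -> (forall i, 0 <= f i) ->
  ((\sum_(i <- s) f i)%:E <= nnsum f)%E.
Proof.
move=> us f0; apply: ereal_sup_ubound; exists [set` s].
  by split => //; exact: finite_seq.
by rewrite -sumEFin -fsbig_seq.
Qed.

Lemma nnsumZ (k : R) f : 0 <= k -> (forall i, 0 <= f i) ->
  nnsum (fun i => k * f i) = (k%:E * nnsum f)%E.
Proof.
move=> kge f0; apply/eqP; rewrite eq_le; apply/andP; split.
  apply: ge_ereal_sup => _ [X [fX _] <-].
  under eq_fsbigr do rewrite EFinM.
  rewrite -ge0_mule_fsumr; last by move=> i; rewrite lee_fin.
  rewrite lee_wpmul2l// ?lee_fin//.
  by apply: ereal_sup_ubound; exists X.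
have [<-|k0] := eqVneq 0 k.
  by rewrite mul0e nnsum_ge0// => i; rewrite mul0r.
have {}k0 : 0 < k by rewrite lt_def eq_sym k0 kge.
rewrite -lee_pdivlMl//.
apply: ge_ereal_sup => _ [X [fX _] <-].
rewrite lee_pdivlMl// fsbig_finite//= sumEFin -EFinM mulr_sumr.
by apply: nnsum_ge => // i; rewrite mulr_ge0.
Qed.

Lemma nnsum_le f (M : R) :
  (forall s : seq I, uniq s -> \sum_(i <- s) f i <= M) -> (nnsum f <= M%:E)%E.
Proof.
move=> fM; apply: ge_ereal_sup => _ [X [fX _] <-].
by rewrite fsbig_finite//= sumEFin lee_fin fM.
Qed.

Lemma nnsum_ge1 f i : (forall i, 0 <= f i) -> ((f i)%:E <= nnsum f)%E.
Proof. by move=> f0; have := @nnsum_ge f [:: i] isT f0; rewrite big_seq1. Qed.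

Lemma abs_summableP f : abs_summable f <->
  exists g h, [/\ forall i, 0 <= g i, forall i, 0 <= h i,
    (nnsum g < +oo)%E, (nnsum h < +oo)%E & forall i, f i = g i - h i].
Proof.
split=> [fs|[g [h [g0 h0 gs hs fE]]]].
  exists (fun i => Num.max (f i) 0), (fun i => Num.max (- f i) 0); split => //.
  - by move=> i; rewrite le_max lexx orbT.
  - by move=> i; rewrite le_max lexx orbT.
  - apply: nnsum_finS fs => i; rewrite le_max lexx orbT/= ge_max normr_ge0 andbT.
    exact: ler_norm.
  - apply: nnsum_finS fs => i; rewrite le_max lexx orbT/= ge_max normr_ge0 andbT.
    by rewrite -normrN ler_norm.
  - move=> i; rewrite !maxEle; case: (leP (f i) 0) => a; case: (leP (- f i) 0) => b; lra.
rewrite /abs_summable; apply: (@nnsum_finS _ (fun i => g i + h i)).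
  move=> i; rewrite normr_ge0 fE/= (le_trans (ler_normB _ _))//.
  by rewrite !ger0_norm.
by rewrite nnsumD// lte_add_pinfty.
Qed.

(** With [p] and [n] the positive and negative parts, [p + h = g + n] pointwise. All terms are
    nonnegative, so additivity of [nnsum] finishes the proof. *)
Lemma rsumE f g h : (forall i, 0 <= g i) -> (forall i, 0 <= h i) ->
    (nnsum g < +oo)%E -> (nnsum h < +oo)%E -> (forall i, f i = g i - h i) ->
  rsum f = fine (nnsum g) - fine (nnsum h).
Proof.
move=> g0 h0 gs hs fE; have : abs_summable f by apply/abs_summableP; exists g, h.
move=> fs; rewrite /rsum; set p := (fun i => Num.max (f i) 0).
set n := (fun i => Num.max (- f i) 0).
have p0 i : 0 <= p i by rewrite le_max lexx orbT.
have n0 i : 0 <= n i by rewrite le_max lexx orbT.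
have ps : (nnsum p < +oo)%E.
  apply: nnsum_finS fs => i; rewrite p0/= ge_max normr_ge0 andbT.
  exact: ler_norm.
have ns : (nnsum n < +oo)%E.
  apply: nnsum_finS fs => i; rewrite n0/= ge_max normr_ge0 andbT.
  by rewrite -normrN ler_norm.
suff : fine (nnsum p) + fine (nnsum h) = fine (nnsum g) + fine (nnsum n).
  by move: (fine _) (fine _) (fine _) (fine _) => u v u' v' E; lra.
rewrite -!fine_nnsumD//; congr fine; apply: eq_esum => i _; congr EFin.
rewrite /p /n fE !maxEle.
by case: (leP (g i - h i) 0) => a; case: (leP (- (g i - h i)) 0) => b; lra.
Qed.

Lemma abs_summableD f g : abs_summable f -> abs_summable g ->
  abs_summable (fun i => f i + g i).
Proof.
move=> fs gs; apply: (@nnsum_finS _ (fun i => `|f i| + `|g i|)).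
  by move=> i; rewrite normr_ge0 ler_normD.
by rewrite nnsumD// lte_add_pinfty.
Qed.

Lemma abs_summableZ (k : R) f : abs_summable f -> abs_summable (fun i => k * f i).
Proof.
move=> fs; rewrite /abs_summable; under [X in nnsum X]funext do rewrite normrM.
by rewrite nnsumZ// lte_mul_pinfty.
Qed.

Lemma rsumD f g : abs_summable f -> abs_summable g ->
  rsum (fun i => f i + g i) = rsum f + rsum g.
Proof.
move=> /abs_summableP[a [b [a0 b0 as_ bs fE]]] /abs_summableP[c [d [c0 d0 cs ds gE]]].
rewrite (@rsumE (fun i => f i + g i) (fun i => a i + c i) (fun i => b i + d i)).
- by rewrite (rsumE a0 b0 as_ bs fE) (rsumE c0 d0 cs ds gE) (fine_nnsumD a0 c0 as_ cs)
    (fine_nnsumD b0 d0 bs ds) opprD addrACA.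
- by move=> i; rewrite addr_ge0.
- by move=> i; rewrite addr_ge0.
- by rewrite nnsumD// lte_add_pinfty.
- by rewrite nnsumD// lte_add_pinfty.
- by move=> i; rewrite fE gE opprD addrACA.
Qed.

Lemma fine_nnsumZ (k : R) f : 0 <= k -> (forall i, 0 <= f i) ->
  (nnsum f < +oo)%E -> fine (nnsum (fun i => k * f i)) = k * fine (nnsum f).
Proof. by move=> k0 f0 fs; rewrite nnsumZ// fineM// nnsum_fin. Qed.

Lemma rsumZ (k : R) f : abs_summable f -> rsum (fun i => k * f i) = k * rsum f.
Proof.
move=> /abs_summableP[a [b [a0 b0 as_ bs fE]]].
have [k0|k0] := leP 0 k.
  rewrite (@rsumE _ (fun i => k * a i) (fun i => k * b i)).
  - by rewrite (fine_nnsumZ k0 a0 as_) (fine_nnsumZ k0 b0 bs) (rsumE a0 b0 as_ bs fE) mulrBr.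
  - by move=> i; rewrite mulr_ge0.
  - by move=> i; rewrite mulr_ge0.
  - by rewrite nnsumZ// lte_mul_pinfty.
  - by rewrite nnsumZ// lte_mul_pinfty.
  - by move=> i; rewrite fE mulrBr.
have k1 : 0 <= - k by lra.
rewrite (@rsumE _ (fun i => - k * b i) (fun i => - k * a i)).
- by rewrite (fine_nnsumZ k1 b0 bs) (fine_nnsumZ k1 a0 as_) (rsumE a0 b0 as_ bs fE) !mulNr
    opprK mulrBr addrC.
- by move=> i; rewrite mulr_ge0.
- by move=> i; rewrite mulr_ge0.
- by rewrite nnsumZ// lte_mul_pinfty.
- by rewrite nnsumZ// lte_mul_pinfty.
- by move=> i; rewrite fE; lra.
Qed.

Lemma rsum_nn f : (forall i, 0 <= f i) -> (nnsum f < +oo)%E -> rsum f = fine (nnsum f).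
Proof.
move=> f0 fs; rewrite (@rsumE _ f (fun=> 0))//; first by rewrite nnsum0 subr0.
- by rewrite nnsum0.
- by move=> i; rewrite subr0.
Qed.

Lemma rsum0 : rsum (fun=> 0) = 0.
Proof. by rewrite rsum_nn// nnsum0. Qed.

(* [j] is a partial bijection with inverse [k]. *)
Lemma nnsum_reindex (j k : I -> option I) f g :
  (forall a b, j a = Some b <-> k b = Some a) ->
  (forall a, j a = None -> f a = 0) -> (forall b, k b = None -> g b = 0) ->
  (forall a b, j a = Some b -> f a = g b) ->
  nnsum f = nnsum g.
Proof.
move=> jk fj gk fg.
(* Both sums are restricted to the domains of [j] and [k], between which [e] below is an honest
   bijection. *)
have suppE (u : I -> R) (l : I -> option I) :
    (forall a, l a = None -> u a = 0) ->
    nnsum u = (\esum_(i in [set i | l i <> None]) (u i)%:E)%E.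
  move=> ul; rewrite [RHS]esum_mkcond; apply: eq_esum => i _.
  case: ifPn => //; rewrite notin_setE/= => /contrapT li.
  by rewrite ul.
rewrite (suppE _ _ fj) (suppE _ _ gk).
pose e i := odflt i (j i).
rewrite (@reindex_esum _ _ _ [set i | j i <> None] [set i | k i <> None] e).
- apply: eq_esum => i /=; rewrite /e; case E : (j i) => [b|//] _ /=.
  by rewrite (fg _ _ E).
- split.
  + move=> i /=; rewrite /e; case E : (j i) => [b|//] _ /=.
    by rewrite (proj1 (jk _ _) E).
  + move=> a b; rewrite !inE /= /e.
    case Ea : (j a) => [c|//]; case Eb : (j b) => [d|//] _ _ /= cd.
    move: Ea Eb => /jk Ea /jk; rewrite -cd Ea => -[].
  + by [].
  + move=> b /=; case E : (k b) => [a|//] _; exists a; rewrite /= /e.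
      by rewrite (proj2 (jk _ _) E).
    by rewrite (proj2 (jk _ _) E).
Qed.

Lemma rsum_reindex (j k : I -> option I) f g :
  (forall a b, j a = Some b <-> k b = Some a) ->
  (forall a, j a = None -> f a = 0) -> (forall b, k b = None -> g b = 0) ->
  (forall a b, j a = Some b -> f a = g b) ->
  rsum f = rsum g.
Proof.
move=> jk fj gk fg; rewrite /rsum.
rewrite (nnsum_reindex (f := fun i => Num.max (f i) 0) (g := fun i => Num.max (g i) 0) jk).
- rewrite (nnsum_reindex (f := fun i => Num.max (- f i) 0)
    (g := fun i => Num.max (- g i) 0) jk)//.
  + by move=> a /fj ->; rewrite oppr0 maxxx.
  + by move=> a /gk ->; rewrite oppr0 maxxx.
  + by move=> a b /fg ->.
- by move=> a /fj ->; rewrite maxxx.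
- by move=> a /gk ->; rewrite maxxx.
- by move=> a b /fg ->.
Qed.

End RealSums.

Section ComplexModulus.
Variable R : realType.
Implicit Types z w : R[i].

Definition nc2 z : R := complex.Re z ^+ 2 + complex.Im z ^+ 2.

Lemma nc2_ge0 z : 0 <= nc2 z.
Proof. by rewrite addr_ge0 ?sqr_ge0. Qed.

Lemma nc2E z : (nc2 z)%:C = z * conjc z.
Proof. by rewrite -sqr_normc -add_Re2_Im2. Qed.

Lemma nc2M z w : nc2 (z * w) = nc2 z * nc2 w.
Proof. by case: z w => a b [c d]; rewrite /nc2 /=; ring. Qed.

Lemma nc2J z : nc2 (conjc z) = nc2 z.
Proof. by case: z => a b; rewrite /nc2 /= sqrrN. Qed.

Lemma nc2R (x : R) : nc2 x%:C = x ^+ 2.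
Proof. by rewrite /nc2/= expr0n/= addr0. Qed.

Lemma nc20 : nc2 (0 : R[i]) = 0.
Proof. by rewrite /nc2/= expr0n/= addr0. Qed.

Lemma nc2_eq0 z : nc2 z = 0 -> z = 0.
Proof.
case: z => a b /eqP; rewrite /nc2/= paddr_eq0 ?sqr_ge0// !sqrf_eq0.
by move=> /andP[/eqP-> /eqP->].
Qed.

Lemma normc_nc2 z : `|z| = (Num.sqrt (nc2 z))%:C.
Proof. by rewrite normc_def. Qed.

(** The parallelogram identity. It replaces the triangle inequality wherever square roots are to be
    avoided. *)
Lemma nc2D_le z w : nc2 (z + w) <= 2 * nc2 z + 2 * nc2 w.
Proof.
rewrite -subr_ge0; have -> : 2 * nc2 z + 2 * nc2 w - nc2 (z + w) = nc2 (z - w).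
  by case: z w => a b [c d]; rewrite /nc2 /=; ring.
exact: nc2_ge0.
Qed.

Lemma Re_mul_conj z w : complex.Re (z * conjc w) =
  complex.Re z * complex.Re w + complex.Im z * complex.Im w.
Proof. by case: z w => a b [c d]/=; ring. Qed.

Lemma Im_mul_conj z w : complex.Im (z * conjc w) =
  complex.Im z * complex.Re w - complex.Re z * complex.Im w.
Proof. by case: z w => a b [c d]/=; ring. Qed.

Lemma lec0P z : 0 <= z <-> z = (complex.Re z)%:C /\ 0 <= complex.Re z.
Proof.
split=> [z0|[-> ]]; last by rewrite ler0c.
split; first by rewrite RRe_real// ger0_real.
by move: z0; rewrite lecE => /andP[].
Qed.

End ComplexModulus.

Section Sesquilinear.
Variables (R : realType) (V : lmodType R[i]) (B : V -> V -> R[i]).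
Hypothesis Bl : forall (k : R[i]) x y z, B (k *: x + y) z = k * B x z + B y z.
Hypothesis Br : forall (k : R[i]) x y z, B z (k *: x + y) = conjc k * B z x + B z y.
Hypothesis B_ge0 : forall x, 0 <= B x x.

Lemma sesqui_expand (t : R[i]) x y : B (t *: y + x) (t *: y + x) =
  t * conjc t * B y y + t * B y x + conjc t * B x y + B x x.
Proof. by rewrite Bl !Br; ring. Qed.

(** Polarization: the form is real on the diagonal, and the vanishing imaginary parts at [y + x] and
    [i y + x] give two real equations. *)
Lemma sesqui_conj x y : B y x = conjc (B x y).
Proof.
have im1 := (lec0P _).1 (B_ge0 (1 *: y + x)).
have imi := (lec0P _).1 (B_ge0 ('i%C *: y + x)).
have [hx _] := (lec0P _).1 (B_ge0 x).
have [hy _] := (lec0P _).1 (B_ge0 y).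
move: im1 imi; rewrite !sesqui_expand hx hy.
case: (B x y) => a b; case: (B y x) => c d [/(congr1 (@complex.Im _))/= E1 _].
move=> [/(congr1 (@complex.Im _))/= E2 _].
by apply/eqP; rewrite eq_complex/=; apply/andP; split; apply/eqP; lra.
Qed.

Lemma sesqui_CauchySchwarz x y :
  nc2 (B x y) <= complex.Re (B x x) * complex.Re (B y y).
Proof.
have Bxx := (lec0P _).1 (B_ge0 x).
have Byy := (lec0P _).1 (B_ge0 y).
set a := complex.Re (B x x) in Bxx *.
set b := complex.Re (B y y) in Byy *.
(* Positivity at the vector x - s B(x, y) y, for real [s]. *)
have H (s : R) : 0 <= a - 2 * s * nc2 (B x y) + s ^+ 2 * nc2 (B x y) * b.
  have := B_ge0 ((- s%:C * B x y) *: y + x).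
  rewrite sesqui_expand (sesqui_conj x y) Bxx.1 Byy.1.
  have -> : conjc (- s%:C * B x y) = - s%:C * conjc (B x y).
    rewrite rmorphM; congr (_ * _).
    by apply/eqP; rewrite eq_complex/= !oppr0 !eqxx.
  set t := _ + _; suff -> : t =
    (a - 2 * s * nc2 (B x y) + s ^+ 2 * nc2 (B x y) * b)%:C by rewrite ler0c.
  by rewrite /t; ring: (nc2E (B x y)).
have [b0|b0] := eqVneq b 0.
  rewrite b0 mulr0; have [c0|c0] := eqVneq (nc2 (B x y)) 0; first by rewrite c0.
  (* For [b = 0] the bound is affine in [s]; this value of [s] turns it into 0 <= -1. *)
  have := H ((a + 1) / (2 * nc2 (B x y))).
  rewrite b0 mulr0 addr0 => {}H; exfalso.
  suff : 0 <= a - (a + 1) by lra.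
  rewrite [X in 0 <= a - X](_ : _ = 2 * ((a + 1) / (2 * nc2 (B x y))) * nc2 (B x y))//.
  by field.
have {}b0 : 0 < b by rewrite lt_def b0 Byy.2.
(* The minimizing value of [s]. *)
have := H b^-1; set c := nc2 _.
have -> : a - 2 * b^-1 * c + b^-1 ^+ 2 * c * b = (a * b - c) / b.
  by field; rewrite gt_eqF.
by rewrite pmulr_lge0 ?invr_gt0// subr_ge0.
Qed.

End Sesquilinear.

Section ComplexSums.
Variables (R : realType) (I : choiceType).
Implicit Types f g : I -> R[i].

Definition c_summable f := abs_summable (fun i => complex.Re (f i)) /\
  abs_summable (fun i => complex.Im (f i)).

Definition csum f : R[i] :=
  rsum (fun i => complex.Re (f i)) +i* rsum (fun i => complex.Im (f i)).

Lemma csumD f g : c_summable f -> c_summable g ->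
  csum (fun i => f i + g i) = csum f + csum g.
Proof.
move=> [f1 f2] [g1 g2]; rewrite /csum.
have -> : (fun i => complex.Re (f i + g i)) = (fun i => complex.Re (f i) + complex.Re (g i)).
  by apply/funext => i; rewrite raddfD.
have -> : (fun i => complex.Im (f i + g i)) = (fun i => complex.Im (f i) + complex.Im (g i)).
  by apply/funext => i; rewrite raddfD.
by rewrite !rsumD.
Qed.

Lemma c_summableZ (k : R[i]) f : c_summable f -> c_summable (fun i => k * f i).
Proof.
case: k => a b [f1 f2]; split.
- have -> : (fun i => complex.Re ((a +i* b) * f i)) =
      (fun i => a * complex.Re (f i) + (- b) * complex.Im (f i)).
    by apply/funext => i; case: (f i) => c d /=; ring.
  by apply: abs_summableD; apply: abs_summableZ.
- have -> : (fun i => complex.Im ((a +i* b) * f i)) =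
      (fun i => a * complex.Im (f i) + b * complex.Re (f i)).
    by apply/funext => i; case: (f i) => c d /=; ring.
  by apply: abs_summableD; apply: abs_summableZ.
Qed.

Lemma csumZ (k : R[i]) f : c_summable f -> csum (fun i => k * f i) = k * csum f.
Proof.
case: k => a b [f1 f2]; rewrite /csum.
have -> : (fun i => complex.Re ((a +i* b) * f i)) =
    (fun i => a * complex.Re (f i) + (- b) * complex.Im (f i)).
  by apply/funext => i; case: (f i) => c d /=; ring.
have -> : (fun i => complex.Im ((a +i* b) * f i)) =
    (fun i => a * complex.Im (f i) + b * complex.Re (f i)).
  by apply/funext => i; case: (f i) => c d /=; ring.
rewrite !rsumD ?rsumZ//; try exact: abs_summableZ.
by apply/eqP; rewrite eq_complex/=; apply/andP; split; apply/eqP; ring.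
Qed.

Lemma csumJ f : c_summable f -> csum (fun i => conjc (f i)) = conjc (csum f).
Proof.
move=> [_ f2]; rewrite /csum /=; congr (_ +i* _).
  by congr rsum; apply/funext => i; case: (f i).
rewrite -mulN1r -rsumZ//; congr rsum; apply/funext => i.
by case: (f i) => c d /=; rewrite mulN1r.
Qed.

Lemma csum_reindex (j k : I -> option I) f g :
  (forall a b, j a = Some b <-> k b = Some a) ->
  (forall a, j a = None -> f a = 0) -> (forall b, k b = None -> g b = 0) ->
  (forall a b, j a = Some b -> f a = g b) ->
  csum f = csum g.
Proof.
move=> jk fj gk fg; rewrite /csum.
congr (_ +i* _); apply: (rsum_reindex jk).
all: by [move=> a /fj-> | move=> a /gk-> | move=> a b /fg->].
Qed.

Lemma csum_nn (u : I -> R) : (forall i, 0 <= u i) -> (nnsum u < +oo)%E ->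
  csum (fun i => (u i)%:C) = (fine (nnsum u))%:C.
Proof. by move=> u0 us; rewrite /csum /= rsum0 rsum_nn. Qed.

End ComplexSums.

(** * The Hilbert space l2(I) and its bounded operators *)

Section L2.
Variables (R : realType) (I : choiceType).

Definition sq_summable (f : I -> R[i]) : Prop :=
  (nnsum (fun i => nc2 (f i)) < +oo)%E.

Record l2 := L2 { l2_val :> I -> R[i];
                  l2P : sq_summable l2_val }.

HB.instance Definition _ := gen_eqMixin l2.
HB.instance Definition _ := gen_choiceMixin l2.

Lemma l2_ext (f g : l2) : (forall i, f i = g i) -> f = g.
Proof.
case: f g => f fP [g gP] /= /funext fg; rewrite fg in fP *.
by congr L2; exact: Prop_irrelevance.
Qed.

Fact l2D_subproof (f g : l2) : sq_summable (fun i => f i + g i).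
Proof.
apply: (@nnsum_finS _ _ _ (fun i => 2 * nc2 (f i) + 2 * nc2 (g i))).
  by move=> i; rewrite nc2_ge0 nc2D_le.
rewrite nnsumD ?nnsumZ//; try by move=> i; rewrite ?mulr_ge0 ?nc2_ge0.
by rewrite lte_add_pinfty// lte_mul_pinfty// ?l2P// lee_fin.
Qed.
Definition l2D f g := L2 (l2D_subproof f g).

Fact l2Z_subproof (k : R[i]) (f : l2) : sq_summable (fun i => k * f i).
Proof.
rewrite /sq_summable; under [X in nnsum X]funext do rewrite nc2M.
rewrite nnsumZ ?nc2_ge0//; last by move=> i; rewrite nc2_ge0.
by rewrite lte_mul_pinfty// ?l2P// ?lee_fin ?nc2_ge0.
Qed.
Definition l2Z k f := L2 (l2Z_subproof k f).

Fact l20_subproof : sq_summable (fun=> 0).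
Proof. by rewrite /sq_summable nc20 nnsum0. Qed.
Definition l20 := L2 l20_subproof.

Fact l2_addA : associative l2D.
Proof. by move=> f g h; apply: l2_ext => i /=; rewrite addrA. Qed.
Fact l2_addC : commutative l2D.
Proof. by move=> f g; apply: l2_ext => i /=; rewrite addrC. Qed.
Fact l2_add0 : left_id l20 l2D.
Proof. by move=> f; apply: l2_ext => i /=; rewrite add0r. Qed.
Fact l2_addN : left_inverse l20 (l2Z (- 1)) l2D.
Proof. by move=> f; apply: l2_ext => i /=; rewrite mulN1r addNr. Qed.
HB.instance Definition _ :=
  GRing.isZmodule.Build l2 l2_addA l2_addC l2_add0 l2_addN.

Fact l2_scaleA (a b : R[i]) (f : l2) : l2Z a (l2Z b f) = l2Z (a * b) f.
Proof. by apply: l2_ext => i /=; rewrite mulrA. Qed.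
Fact l2_scale1 : left_id 1 l2Z.
Proof. by move=> f; apply: l2_ext => i /=; rewrite mul1r. Qed.
Fact l2_scaleDr : right_distributive l2Z +%R.
Proof. by move=> k f g; apply: l2_ext => i /=; rewrite mulrDr. Qed.
Fact l2_scaleDl (f : l2) : {morph l2Z^~ f : a b / a + b}.
Proof. by move=> a b; apply: l2_ext => i /=; rewrite mulrDl. Qed.
HB.instance Definition _ :=
  GRing.Zmodule_isLmodule.Build R[i] l2 l2_scaleA l2_scale1 l2_scaleDr l2_scaleDl.

Lemma l2_addE (f g : l2) i : (f + g) i = f i + g i. Proof. by []. Qed.
Lemma l2_scaleE k (f : l2) i : (k *: f) i = k * f i. Proof. by []. Qed.
Lemma l2_oppE (f : l2) i : (- f) i = - f i.
Proof. by rewrite -mulN1r. Qed.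
Lemma l2_0E i : (0 : l2) i = 0. Proof. by []. Qed.
Lemma l2_subE (f g : l2) i : (f - g) i = f i - g i.
Proof. by rewrite l2_addE l2_oppE. Qed.

Lemma l2_summable (f g : l2) : c_summable (fun i => f i * conjc (g i)).
Proof.
have H (h : I -> R) : (forall i, `|h i| <= nc2 (f i) + nc2 (g i)) -> abs_summable h.
  move=> hfg; apply: (@nnsum_finS _ _ _ (fun i => nc2 (f i) + nc2 (g i))).
    by move=> i; rewrite normr_ge0 hfg.
  rewrite nnsumD; try by move=> i; rewrite nc2_ge0.
  by rewrite lte_add_pinfty// l2P.
have A (a b c d : R) : `|a * c + b * d| <= a ^+ 2 + b ^+ 2 + (c ^+ 2 + d ^+ 2).
  rewrite ler_norml; apply/andP; split.
    have := sqr_ge0 (a + c); have := sqr_ge0 (b + d).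
    have := sqr_ge0 (a - c); have := sqr_ge0 (b - d); nra.
  have := sqr_ge0 (a + c); have := sqr_ge0 (b + d).
  have := sqr_ge0 (a - c); have := sqr_ge0 (b - d); nra.
split; apply: H => i; rewrite ?Re_mul_conj ?Im_mul_conj /nc2; first exact: A.
rewrite [X in _ <= X + _]addrC.
by have := A (complex.Im (f i)) (- complex.Re (f i)) (complex.Re (g i)) (complex.Im (g i));
  rewrite mulNr sqrrN.
Qed.

Definition ip (f g : l2) : R[i] := csum (fun i => f i * conjc (g i)).

Lemma ipDl k (f g h : l2) : ip (k *: f + g) h = k * ip f h + ip g h.
Proof.
rewrite /ip -csumZ; last exact: l2_summable.
rewrite -csumD; [|exact/c_summableZ/l2_summable|exact: l2_summable].
by congr csum; apply/funext => i; rewrite l2_addE l2_scaleE mulrDl mulrA.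
Qed.

Lemma ipC (f g : l2) : ip g f = conjc (ip f g).
Proof.
rewrite /ip -csumJ; last exact: l2_summable.
by congr csum; apply/funext => i; rewrite rmorphM/= conjcK mulrC.
Qed.

Lemma ipDr k (f g h : l2) : ip h (k *: f + g) = conjc k * ip h f + ip h g.
Proof. by rewrite ipC ipDl (ipC f h) (ipC g h) rmorphD rmorphM. Qed.

Definition l2n2 (f : l2) : R := fine (nnsum (fun i => nc2 (f i))).

Lemma ipE (f : l2) : ip f f = (l2n2 f)%:C.
Proof.
rewrite /ip -csum_nn ?l2P//; last by move=> i; exact: nc2_ge0.
by congr csum; apply/funext => i; rewrite nc2E.
Qed.

Lemma l2n2_ge0 f : 0 <= l2n2 f.
Proof. by rewrite fine_ge0// nnsum_ge0// => i; exact: nc2_ge0. Qed.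

Lemma ip_ge0 f : 0 <= ip f f.
Proof. by rewrite ipE ler0c l2n2_ge0. Qed.

Lemma ip_CauchySchwarz f g : nc2 (ip f g) <= l2n2 f * l2n2 g.
Proof.
by have := sesqui_CauchySchwarz (B := ip) ipDl (fun k x y z => ipDr k x y z) ip_ge0 f g;
  rewrite !ipE.
Qed.

Lemma nc2_le_l2n2 (f : l2) i : nc2 (f i) <= l2n2 f.
Proof.
have p0 j : 0 <= nc2 (f j) by exact: nc2_ge0.
by rewrite -lee_fin /l2n2 fineK ?nnsum_fin ?l2P// (nnsum_ge1 i).
Qed.

Lemma l2n2_eq0 (f : l2) : l2n2 f = 0 -> f = 0.
Proof.
move=> f0; apply: l2_ext => i; rewrite l2_0E; apply: nc2_eq0.
by apply/eqP; rewrite eq_le nc2_ge0 andbT -f0 nc2_le_l2n2.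
Qed.

Definition l2n f := Num.sqrt (l2n2 f).

Lemma l2n_ge0 f : 0 <= l2n f. Proof. exact: sqrtr_ge0. Qed.

Lemma sqr_l2n f : l2n f ^+ 2 = l2n2 f.
Proof. by rewrite sqr_sqrtr// l2n2_ge0. Qed.

Lemma l2n2Z k f : l2n2 (k *: f) = nc2 k * l2n2 f.
Proof.
apply: complexI; rewrite -ipE -[k *: f]addr0 ipDl ipDr ![ip _ 0]ipC.
have ip0 (h : l2) : ip 0 h = 0.
  have := ipDl 1 0 0 h; rewrite scaler0 add0r mul1r => /eqP.
  by rewrite -subr_eq0 opprD addNKr oppr_eq0 => /eqP.
by rewrite !ip0 conjc0 !addr0 ipE mulrA -nc2E rmorphM.
Qed.

Lemma l2nZ k f : l2n (k *: f) = Num.sqrt (nc2 k) * l2n f.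
Proof. by rewrite /l2n l2n2Z sqrtrM ?nc2_ge0. Qed.

Lemma l2nD f g : l2n (f + g) <= l2n f + l2n g.
Proof.
rewrite -(ler_pXn2r (n := 2))// ?nnegrE ?addr_ge0 ?l2n_ge0//.
have : complex.Re (ip f g) <= l2n f * l2n g.
  apply: (le_trans (ler_norm _)); rewrite -(ler_pXn2r (n := 2))// ?nnegrE ?mulr_ge0 ?l2n_ge0//.
  rewrite exprMn !sqr_l2n (le_trans _ (ip_CauchySchwarz f g))//.
  by rewrite real_normK ?num_real// lerDl sqr_ge0.
move=> H; rewrite sqrrD !sqr_l2n.
have -> : l2n2 (f + g) = l2n2 f + l2n2 g + 2 * complex.Re (ip f g).
  apply: complexI; rewrite -ipE -[f]scale1r ipDl !ipDr scale1r !ipE (ipC f g).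
  rewrite conjc1 !mul1r; case: (ip f g) => a b.
  by apply/eqP; rewrite eq_complex/=; apply/andP; split; apply/eqP; ring.
by rewrite -mulr_natl; lra.
Qed.

End L2.

(** * Completeness of l2 along filters *)

Section Completeness.
Variables (R : realType) (X : Type) (F : set_system X).
Context {FF : ProperFilter F}.

(** Convergence is studied along an arbitrary proper filter, because completeness of the operators
    concerns Cauchy filters on operators, evaluated at a fixed vector. *)
Lemma real_cauchy_cvg (u : X -> R) :
  (forall e : R, 0 < e -> exists2 A, F A &
     forall a b, A a -> A b -> `|u a - u b| <= e) ->
  exists l, forall e : R, 0 < e -> F [set a | `|u a - l| <= e].
Proof.
move=> uC; have /cvg_ex[l ul] : cvg (u @ F).
  apply: R_complete; apply/cauchy_ballP => e e0.
  have [|A FA uA] := uC (e / 2); first by rewrite divr_gt0.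
  exists (u @` A, u @` A).
    by split; apply: (@filterS _ F _ A) => // x Ax; exists x.
  move=> [x y]/= [[a Aa <-] [b Ab <-]]; rewrite /ball/=.
  by rewrite (le_lt_trans (uA _ _ Aa Ab))// ltr_pdivrMr// ltr_pMr// ltr1n.
exists l => e e0; move/cvgrPdist_le : ul => /(_ _ e0).
by apply: filterS => a; rewrite distrC.
Qed.

Lemma complex_cauchy_cvg (u : X -> R[i]) :
  (forall e : R, 0 < e -> exists2 A, F A &
     forall a b, A a -> A b -> nc2 (u a - u b) <= e) ->
  exists l, forall e : R, 0 < e -> F [set a | nc2 (u a - l) <= e].
Proof.
move=> uC.
have [|x xP] := @real_cauchy_cvg (fun a => complex.Re (u a)).
  move=> e e0; have [|A FA uA] := uC (e ^+ 2); first by rewrite exprn_gt0.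
  exists A => // a b Aa Ab; rewrite -(ler_pXn2r (n := 2))// ?nnegrE ?(ltW e0)//.
  apply: le_trans (uA _ _ Aa Ab); rewrite /nc2 !raddfB/=.
  by rewrite real_normK ?num_real// lerDl sqr_ge0.
have [|y yP] := @real_cauchy_cvg (fun a => complex.Im (u a)).
  move=> e e0; have [|A FA uA] := uC (e ^+ 2); first by rewrite exprn_gt0.
  exists A => // a b Aa Ab; rewrite -(ler_pXn2r (n := 2))// ?nnegrE ?(ltW e0)//.
  apply: le_trans (uA _ _ Aa Ab); rewrite /nc2 !raddfB/=.
  by rewrite real_normK ?num_real// lerDr sqr_ge0.
exists (x +i* y) => e e0.
have d0 : 0 < Num.sqrt (e / 2) by rewrite sqrtr_gt0 divr_gt0.
have S (r : R) : `|r| <= Num.sqrt (e / 2) -> r ^+ 2 <= e / 2.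
  move=> h; rewrite -(@sqr_sqrtr _ (e / 2)) ?divr_ge0 ?(ltW e0)//.
  by rewrite -(real_normK (num_real r)) ler_pXn2r// nnegrE ?(ltW d0).
apply: filterS2 (xP _ d0) (yP _ d0) => a /= /S A /S B.
by move: A B; case: (u a) => c d /= A B; rewrite /nc2/=; lra.
Qed.

Lemma filter_all_seq (T : eqType) (s : seq T) (P : T -> set X) :
  (forall t, F (P t)) -> F [set a | forall t, t \in s -> P t a].
Proof.
move=> FP; elim: s => [|t s IH]; first by apply: filterS filterT.
apply: filterS2 (FP t) IH => a Pta IHa t'.
by rewrite inE => /predU1P[->|/IHa].
Qed.

Lemma l2_complete (I : choiceType) (g : X -> l2 R I) :
  (forall e : R, 0 < e -> exists2 A, F A &
     forall a b, A a -> A b -> l2n2 (g a - g b) <= e) ->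
  exists l, forall e : R, 0 < e -> F [set a | l2n2 (g a - l) <= e].
Proof.
move=> gC.
have /choice[L LP] i : exists l, forall e : R, 0 < e -> F [set a | nc2 (g a i - l) <= e].
  apply: complex_cauchy_cvg => e e0; have [A FA gA] := gC _ e0.
  exists A => // a b Aa Ab; apply: le_trans (gA _ _ Aa Ab).
  by rewrite -l2_subE; exact: nc2_le_l2n2.
(* A bound of Fatou type: on a finite set [s] of indices, [L] is replaced by some [g b] that is
   close to it at each of them. The constant is 2 + 2, from [nc2D_le]. *)
have K (e : R) (A : set X) a : 0 < e -> F A ->
    (forall a b, A a -> A b -> l2n2 (g a - g b) <= e) -> A a ->
    (nnsum (fun i => nc2 (g a i - L i)%R) <= (4 * e)%:E)%E.
  move=> e0 FA gA Aa; apply: nnsum_le => s us.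
  pose d : R := e / (size s).+1%:R.
  have d0 : 0 < d by rewrite divr_gt0.
  have : F (A `&` [set b | forall i, i \in s -> nc2 (g b i - L i) <= d]).
    by apply: filterI => //; exact: (filter_all_seq s (fun i => LP i _ d0)).
  move=> /filter_ex[b [Ab bs]].
  have E1 : \sum_(i <- s) nc2 (g a i - g b i) <= e.
    apply: le_trans (gA _ _ Aa Ab).
    rewrite -lee_fin /l2n2 fineK; last first.
      by rewrite nnsum_fin ?l2P// => i; exact: nc2_ge0.
    under eq_bigr do rewrite -l2_subE.
    by apply: nnsum_ge => // i; exact: nc2_ge0.
  have E2 : \sum_(i <- s) nc2 (g b i - L i) <= e.
    apply: (@le_trans _ _ (\sum_(i <- s) d)).
      by rewrite big_seq [leRHS]big_seq; apply: ler_sum => i si; exact: bs.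
    rewrite big_const_seq count_predT iter_addr_0 -mulr_natr /d.
    rewrite -mulrA ler_piMr ?(ltW e0)// mulrC ler_pdivrMr// mul1r ler_nat.
    exact: leqnSn.
  apply: (@le_trans _ _ (\sum_(i <- s) (2 * nc2 (g a i - g b i) + 2 * nc2 (g b i - L i)))).
    apply: ler_sum => i _; apply: le_trans (nc2D_le _ _).
    by rewrite addrA subrK.
  by rewrite big_split/= -!mulr_sumr; lra.
have [A FA gA] := gC 1 ltr01.
have [a Aa] := filter_ex FA.
have Ds : sq_summable (fun i => g a i - L i).
  by apply: le_lt_trans (K _ _ _ ltr01 FA gA Aa) _; rewrite ltry.
(* Only the difference of [g a] and the coordinatewise limit is known to be square summable, so the
   limit is recovered by subtraction. *)
pose l := g a - L2 Ds.
have lE i : l i = L i by rewrite l2_subE/= opprB addrC subrK.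
exists l => e e0.
have e40 : 0 < e / 4 by rewrite divr_gt0.
have [B FB gB] := gC _ e40.
apply: (@filterS _ F _ B) => // b Bb /=.
have := K _ _ _ e40 FB gB Bb; rewrite (_ : 4 * (e / 4) = e); last by field.
rewrite -lee_fin /l2n2 fineK; last first.
  by rewrite nnsum_fin ?l2P// => i; exact: nc2_ge0.
apply: le_trans; apply: le_nnsum => i.
by rewrite l2_subE lE.
Qed.

End Completeness.

(** * The C*-algebra of bounded operators on l2 *)

Section BoundedOperators.
Variables (R : realType) (I : choiceType).
Local Notation H := (l2 R I).
Implicit Types f g h : H.

Lemma ip0l f : ip 0 f = 0.
Proof.
have := ipDl 1 0 0 f; rewrite scaler0 add0r mul1r => /eqP.
by rewrite -subr_eq0 opprD addNKr oppr_eq0 => /eqP.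
Qed.

Lemma ipD f g h : ip (f + g) h = ip f h + ip g h.
Proof. by rewrite -[f]scale1r ipDl mul1r scale1r. Qed.

Lemma ipBl f g h : ip (f - g) h = ip f h - ip g h.
Proof. by rewrite addrC -scaleN1r ipDl mulN1r addrC. Qed.

Lemma ipBr f g h : ip h (f - g) = ip h f - ip h g.
Proof. by rewrite ipC ipBl rmorphB (ipC f h) (ipC g h). Qed.

Lemma ip_injl f g : (forall h, ip f h = ip g h) -> f = g.
Proof.
move=> fg; apply/eqP; rewrite -subr_eq0; apply/eqP/l2n2_eq0/complexI.
by rewrite -ipE ipBl fg subrr.
Qed.

Lemma ip_injr f g : (forall h, ip h f = ip h g) -> f = g.
Proof. by move=> fg; apply: ip_injl => h; rewrite ipC fg -ipC. Qed.

(** The adjoint is carried as data, which avoids the Riesz representation theorem; linearity is then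
    a consequence ([bop_lin]). *)
Record bop := BOp {
  bop_fun :> H -> H;
  bop_adj : H -> H;
  bop_adjP : forall f g, ip (bop_fun f) g = ip f (bop_adj g);
  bop_bounded : exists M : R, 0 <= M /\ forall f, l2n (bop_fun f) <= M * l2n f }.

HB.instance Definition _ := gen_eqMixin bop.
HB.instance Definition _ := gen_choiceMixin bop.

Lemma bop_ext (a b : bop) : (forall f, a f = b f) -> a = b.
Proof.
case: a b => a a' aP aB [b b' bP bB] /= /funext ab; subst b.
suff E : a' = b' by subst b'; congr BOp; exact: Prop_irrelevance.
by apply/funext => f; apply: ip_injr => h; rewrite -aP bP.
Qed.

Lemma bop_lin (a : bop) k f g : a (k *: f + g) = k *: a f + a g.
Proof. by apply: ip_injl => h; rewrite ipDl !bop_adjP ipDl. Qed.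

Lemma l2n0 : l2n (0 : H) = 0.
Proof. by rewrite -(scale0r (0 : H)) l2nZ nc20 sqrtr0 mul0r. Qed.

Lemma bop0 (a : bop) : a 0 = 0.
Proof. by have := bop_lin a (-1) 0 0; rewrite scaler0 addr0 scaleN1r addNr. Qed.

Definition onorm (a : bop) : R :=
  inf [set M : R | 0 <= M /\ forall f, l2n (a f) <= M * l2n f].

Lemma onorm_ge0 a : 0 <= onorm a.
Proof.
have [M MP] := bop_bounded a.
by apply: lb_le_inf; [exists M|move=> x []].
Qed.

Lemma onorm_le (a : bop) (M : R) : 0 <= M -> (forall f, l2n (a f) <= M * l2n f) -> onorm a <= M.
Proof. by move=> M0 aM; apply: ge_inf => //; exists 0 => x []. Qed.

Lemma le_onorm (a : bop) f : l2n (a f) <= onorm a * l2n f.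
Proof.
have [f0|f0] := eqVneq (l2n f) 0.
  by have [M [_ /(_ f)]] := bop_bounded a; rewrite f0 !mulr0.
have {}f0 : 0 < l2n f by rewrite lt_def f0 l2n_ge0.
rewrite -ler_pdivrMr//; have [M MP] := bop_bounded a.
apply: lb_le_inf; first by exists M.
by move=> x [x0 /(_ f)]; rewrite ler_pdivrMr.
Qed.

Lemma Re_ip_le f g : complex.Re (ip f g) <= l2n f * l2n g.
Proof.
apply: (le_trans (ler_norm _)); rewrite -(ler_pXn2r (n := 2))// ?nnegrE ?mulr_ge0 ?l2n_ge0//.
rewrite exprMn !sqr_l2n (le_trans _ (ip_CauchySchwarz f g))//.
by rewrite real_normK ?num_real// lerDl sqr_ge0.
Qed.

Lemma sqr_l2n_ip f : l2n f ^+ 2 = complex.Re (ip f f).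
Proof. by rewrite ipE sqr_l2n. Qed.

(** |a^* f|^2 = <a a^* f, f> <= |a| |a^* f| |f|, and one factor |a^* f| cancels. *)
Lemma bop_adj_le (a : bop) f : l2n (bop_adj a f) <= onorm a * l2n f.
Proof.
have [E|E] := eqVneq (l2n (bop_adj a f)) 0; first by rewrite E mulr_ge0// ?onorm_ge0 ?l2n_ge0.
rewrite -(ler_pM2r (x := l2n (bop_adj a f))) ?lt_def ?E ?l2n_ge0//.
rewrite -expr2 sqr_l2n_ip -bop_adjP (le_trans (Re_ip_le _ _))//.
by rewrite mulrAC ler_wpM2r ?l2n_ge0// le_onorm.
Qed.

Fact bop_star_subproof1 (a : bop) f g : ip (bop_adj a f) g = ip f (a g).
Proof. by rewrite ipC -bop_adjP -ipC. Qed.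
Fact bop_star_subproof2 (a : bop) :
  exists M : R, 0 <= M /\ forall f, l2n (bop_adj a f) <= M * l2n f.
Proof. by exists (onorm a); split; [exact: onorm_ge0|exact: bop_adj_le]. Qed.
Definition bop_star a := BOp (bop_star_subproof1 a) (bop_star_subproof2 a).

Lemma bop_starK a : bop_star (bop_star a) = a.
Proof. exact: bop_ext. Qed.

Lemma ip_bop (a : bop) f g : ip (a f) g = ip f (bop_star a g).
Proof. exact: bop_adjP. Qed.

Fact bop_mul_subproof1 (a b : bop) f g :
  ip (a (b f)) g = ip f (bop_adj b (bop_adj a g)).
Proof. by rewrite !bop_adjP. Qed.
Fact bop_mul_subproof2 (a b : bop) :
  exists M : R, 0 <= M /\ forall f, l2n (a (b f)) <= M * l2n f.
Proof.
exists (onorm a * onorm b); split; first by rewrite mulr_ge0 ?onorm_ge0.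
move=> f; rewrite (le_trans (le_onorm _ _))// -mulrA ler_wpM2l ?onorm_ge0//.
exact: le_onorm.
Qed.
Definition bop_mul a b := BOp (bop_mul_subproof1 a b) (bop_mul_subproof2 a b).

Fact bop_add_subproof1 (a b : bop) f g :
  ip (a f + b f) g = ip f (bop_adj a g + bop_adj b g).
Proof.
rewrite -[a f]scale1r -[bop_adj a g]scale1r ipDl ipDr conjc1 !mul1r.
by rewrite !bop_adjP.
Qed.
Fact bop_add_subproof2 (a b : bop) :
  exists M : R, 0 <= M /\ forall f, l2n (a f + b f) <= M * l2n f.
Proof.
exists (onorm a + onorm b); split; first by rewrite addr_ge0 ?onorm_ge0.
by move=> f; rewrite (le_trans (l2nD _ _))// mulrDl lerD ?le_onorm.
Qed.
Definition bop_add a b := BOp (bop_add_subproof1 a b) (bop_add_subproof2 a b).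

Lemma ipZl k f g : ip (k *: f) g = k * ip f g.
Proof. by rewrite -[k *: f]addr0 ipDl ip0l addr0. Qed.

Lemma ipZr k f g : ip f (k *: g) = conjc k * ip f g.
Proof. by rewrite ipC ipZl rmorphM (ipC g f). Qed.

Fact bop_scale_subproof1 k (a : bop) f g :
  ip (k *: a f) g = ip f (conjc k *: bop_adj a g).
Proof. by rewrite ipZl ipZr conjcK bop_adjP. Qed.
Fact bop_scale_subproof2 k (a : bop) :
  exists M : R, 0 <= M /\ forall f, l2n (k *: a f) <= M * l2n f.
Proof.
exists (Num.sqrt (nc2 k) * onorm a); split; first by rewrite mulr_ge0 ?onorm_ge0 ?sqrtr_ge0.
by move=> f; rewrite l2nZ -mulrA ler_wpM2l ?sqrtr_ge0// le_onorm.
Qed.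
Definition bop_scale k a := BOp (bop_scale_subproof1 k a) (bop_scale_subproof2 k a).

Fact bop_zero_subproof1 f g : ip 0 g = ip f 0.
Proof. by rewrite [RHS]ipC !ip0l conjc0. Qed.
Fact bop_zero_subproof2 :
  exists M : R, 0 <= M /\ forall f, l2n (0 : H) <= M * l2n f.
Proof. by exists 0; split => // f; rewrite l2n0 mul0r. Qed.
Definition bop_zero := BOp bop_zero_subproof1 bop_zero_subproof2.

Fact bop_addA : associative bop_add.
Proof. by move=> a b c; apply: bop_ext => f /=; rewrite addrA. Qed.
Fact bop_addC : commutative bop_add.
Proof. by move=> a b; apply: bop_ext => f /=; rewrite addrC. Qed.
Fact bop_add0 : left_id bop_zero bop_add.
Proof. by move=> a; apply: bop_ext => f /=; rewrite add0r. Qed.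
Fact bop_addN : left_inverse bop_zero (bop_scale (- 1)) bop_add.
Proof. by move=> a; apply: bop_ext => f /=; rewrite scaleN1r addNr. Qed.
HB.instance Definition _ :=
  GRing.isZmodule.Build bop bop_addA bop_addC bop_add0 bop_addN.

Fact bop_scaleA (k l : R[i]) (a : bop) :
  bop_scale k (bop_scale l a) = bop_scale (k * l) a.
Proof. by apply: bop_ext => f /=; rewrite scalerA. Qed.
Fact bop_scale1 : left_id 1 bop_scale.
Proof. by move=> a; apply: bop_ext => f /=; rewrite scale1r. Qed.
Fact bop_scaleDr : right_distributive bop_scale +%R.
Proof. by move=> k a b; apply: bop_ext => f /=; rewrite scalerDr. Qed.
Fact bop_scaleDl (a : bop) : {morph bop_scale^~ a : k l / k + l}.
Proof. by move=> k l; apply: bop_ext => f /=; rewrite scalerDl. Qed.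
HB.instance Definition _ :=
  GRing.Zmodule_isLmodule.Build R[i] bop
    bop_scaleA bop_scale1 bop_scaleDr bop_scaleDl.

Lemma bop_addE (a b : bop) f : (a + b) f = a f + b f. Proof. by []. Qed.
Lemma bop_scaleE k (a : bop) f : (k *: a) f = k *: a f. Proof. by []. Qed.
Lemma bop_oppE (a : bop) f : (- a) f = - a f.
Proof. by rewrite -scaleN1r. Qed.
Lemma bop_subE (a b : bop) f : (a - b) f = a f - b f.
Proof. by rewrite bop_addE bop_oppE. Qed.

Fact onormD (a b : bop) : (onorm (a + b))%:C <= (onorm a)%:C + (onorm b)%:C.
Proof.
rewrite -rmorphD lecR; apply: onorm_le; first by rewrite addr_ge0 ?onorm_ge0.
by move=> f; rewrite (le_trans (l2nD _ _))// mulrDl lerD ?le_onorm.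
Qed.
Fact onormZ_le k (a : bop) : onorm (k *: a) <= Num.sqrt (nc2 k) * onorm a.
Proof.
apply: onorm_le; first by rewrite mulr_ge0 ?onorm_ge0 ?sqrtr_ge0.
by move=> f; rewrite l2nZ -mulrA ler_wpM2l ?sqrtr_ge0// le_onorm.
Qed.
(** The inequality missing from [onormZ_le] is that same lemma for the scalar [k^-1] and the
    operator [k *: a]. *)
Fact onormZ (k : R[i]) (a : bop) : (onorm (k *: a))%:C = `|k| * (onorm a)%:C.
Proof.
rewrite normc_nc2 -rmorphM; congr _%:C; apply/eqP; rewrite eq_le onormZ_le/=.
have [->|k0] := eqVneq k 0; first by rewrite nc20 sqrtr0 mul0r onorm_ge0.
have k2 : 0 < Num.sqrt (nc2 k).
  by rewrite sqrtr_gt0 lt_def nc2_ge0 andbT; apply: contra_neq k0; exact: nc2_eq0.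
rewrite -ler_pdivlMl// -sqrtrV ?nc2_ge0//.
have -> : (nc2 k)^-1 = nc2 k^-1.
  apply: (@mulIf _ (nc2 k)); first by move: k2; rewrite sqrtr_gt0 => /gt_eqF->.
  by rewrite mulVf -?nc2M ?mulVf//; [rewrite nc2R expr1n|move: k2; rewrite sqrtr_gt0 => /gt_eqF->].
apply: le_trans (onormZ_le _ _).
by rewrite scalerA mulVf// scale1r.
Qed.
Fact onorm0_eq0 (a : bop) : (onorm a)%:C = 0 -> a = 0.
Proof.
move=> [a0]; apply: bop_ext => f; apply: l2n2_eq0; rewrite -sqr_l2n.
have := le_onorm a f; rewrite a0 mul0r => H; apply/eqP.
by rewrite sqrf_eq0 eq_le H l2n_ge0.
Qed.
HB.instance Definition _ :=
  Lmodule_isNormed.Build R[i] bop onormD onormZ onorm0_eq0.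

Lemma bop_normE (a : bop) : `|a| = (onorm a)%:C. Proof. by []. Qed.

Fact bop_complete (F : set_system bop) : ProperFilter F -> cauchy F -> cvg F.
Proof.
move=> FF FC.
have {}FC (e : R) : 0 < e -> exists2 A, F A & forall a b, A a -> A b -> onorm (a - b) <= e.
  move=> e0; move/cauchy_ballP : FC => /(_ e%:C).
  rewrite ltcR => /(_ e0)[[A B] [FA FB] AB].
  exists (A `&` B); first exact: filterI.
  move=> a b [Aa _] [_ Bb]; have := AB (a, b) (conj Aa Bb).
  by rewrite -ball_normE/= bop_normE ltcR => /ltW.
have C1 f (e : R) : 0 < e -> exists2 A, F A & forall a b : bop, A a -> A b -> l2n2 (a f - b f) <= e.
  (* The summand 1 keeps the denominator positive when [f] is zero. *)
  move=> e0; pose d := Num.sqrt e / (1 + l2n f).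
  have f1 : 0 < 1 + l2n f by rewrite ltr_pwDl// l2n_ge0.
  have [|A FA AP] := FC d; first by rewrite divr_gt0// sqrtr_gt0.
  exists A => // a b Aa Ab.
  rewrite -sqr_l2n -(@sqr_sqrtr _ e) ?(ltW e0)// ler_pXn2r ?nnegrE ?l2n_ge0 ?sqrtr_ge0//.
  rewrite -bop_subE (le_trans (le_onorm _ _))//.
  apply: (@le_trans _ _ (d * l2n f)); first by rewrite ler_wpM2r ?l2n_ge0// AP.
  rewrite /d -mulrA ler_piMr ?sqrtr_ge0// mulrC ler_pdivrMr// mul1r.
  by rewrite lerDr.
(* The adjoints converge pointwise too, since passing to the adjoint does not increase the norm.
   Their limit is the adjoint that the limit operator has to carry. *)
have C2 f (e : R) : 0 < e -> exists2 A, F A & forall a b : bop, A a -> A b ->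
    l2n2 (bop_star a f - bop_star b f) <= e.
  move=> e0; pose d := Num.sqrt e / (1 + l2n f).
  have f1 : 0 < 1 + l2n f by rewrite ltr_pwDl// l2n_ge0.
  have [|A FA AP] := FC d; first by rewrite divr_gt0// sqrtr_gt0.
  exists A => // a b Aa Ab.
  rewrite -sqr_l2n -(@sqr_sqrtr _ e) ?(ltW e0)// ler_pXn2r ?nnegrE ?l2n_ge0 ?sqrtr_ge0//.
  have -> : bop_star a f - bop_star b f = bop_star (a - b) f.
    by apply: ip_injr => h; rewrite ipBr -!ip_bop bop_subE ipBl.
  rewrite (le_trans (bop_adj_le _ _))//.
  apply: (@le_trans _ _ (d * l2n f)); first by rewrite ler_wpM2r ?l2n_ge0// AP.
  rewrite /d -mulrA ler_piMr ?sqrtr_ge0// mulrC ler_pdivrMr// mul1r.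
  by rewrite lerDr.
have /choice[l lP] : forall f, exists u : H, forall e : R, 0 < e ->
    F [set a : bop | l2n2 (a f - u) <= e] by move=> f; exact: l2_complete (C1 f).
have /choice[l' l'P] : forall f, exists u : H, forall e : R, 0 < e ->
    F [set a : bop | l2n2 (bop_star a f - u) <= e] by move=> f; exact: l2_complete (C2 f).
have ipl f g : ip (l f) g = ip f (l' g).
  apply/eqP; rewrite -subr_eq0; apply/eqP/nc2_eq0/eqP.
  rewrite eq_le nc2_ge0 andbT; apply/ler_addgt0Pr => e e0; rewrite add0r.
  pose d := e / (2 * (1 + l2n2 f + l2n2 g)).
  have s0 : 0 < 1 + l2n2 f + l2n2 g.
    by have := l2n2_ge0 f; have := l2n2_ge0 g; lra.
  have d0 : 0 < d by rewrite divr_gt0// mulr_gt0.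
  have [a [/= A1 A2]] := filter_ex (filterI (lP f _ d0) (l'P g _ d0)).
  have -> : ip (l f) g - ip f (l' g) = ip (l f - a f) g + ip f (bop_star a g - l' g).
    by rewrite ipBl ipBr ip_bop addrA subrK.
  apply: le_trans (nc2D_le _ _) _.
  have B1 : nc2 (ip (l f - a f) g) <= d * l2n2 g.
    apply: (le_trans (ip_CauchySchwarz _ _)); rewrite ler_wpM2r ?l2n2_ge0//.
    by rewrite -opprB -scaleN1r l2n2Z /nc2/= oppr0 expr0n/= addr0 sqrrN expr1n mul1r.
  have B2 : nc2 (ip f (bop_star a g - l' g)) <= d * l2n2 f.
    apply: (le_trans (ip_CauchySchwarz _ _)); rewrite mulrC ler_wpM2r ?l2n2_ge0//.
  apply: (@le_trans _ _ (2 * d * (1 + l2n2 f + l2n2 g))).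
    by move: B1 B2 d0; move: (nc2 _) (nc2 _) (l2n2 f) (l2n2 g) => *; lra.
  by rewrite /d le_eqVlt; apply/orP; left; apply/eqP; field; rewrite gt_eqF.
(* The norm bound passes to the pointwise limit uniformly in the vector: for each [f] separately,
   [b] is chosen in [A] and close to the limit at [f]. *)
have key (A : set bop) (e : R) : F A -> 0 < e -> (forall a b, A a -> A b -> onorm (a - b) <= e) ->
    forall a, A a -> forall f, l2n (a f - l f) <= e * l2n f.
  move=> FA e0 AP a Aa f; apply/ler_addgt0Pr => d d0.
  have [b [/= Ab lb]] := filter_ex (filterI FA (lP f _ (exprn_gt0 2 d0))).
  have -> : a f - l f = (a - b) f + (b f - l f) by rewrite bop_subE addrA subrK.
  rewrite (le_trans (l2nD _ _))// lerD//.
    by rewrite (le_trans (le_onorm _ _))// ler_wpM2r ?l2n_ge0// AP.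
  by rewrite -(ler_pXn2r (n := 2))// ?nnegrE ?l2n_ge0 ?(ltW d0)// sqr_l2n.
have [A FA AP] := FC 1 ltr01.
have [a Aa] := filter_ex FA.
have lB : exists M : R, 0 <= M /\ forall f, l2n (l f) <= M * l2n f.
  exists (onorm a + 1); split; first by rewrite addr_ge0 ?onorm_ge0.
  move=> f; have -> : l f = a f + (-1) *: (a f - l f).
    by rewrite scaleN1r opprB addrC subrK.
  rewrite (le_trans (l2nD _ _))// mulrDl; apply: lerD; first exact: le_onorm.
  rewrite l2nZ /nc2/= oppr0 expr0n/= addr0 sqrrN expr1n sqrtr1 !mul1r.
  by have := key _ _ FA ltr01 AP _ Aa f; rewrite mul1r.
apply/cvg_ex; exists (BOp ipl lB).
apply/cvgrPdist_le => e e0.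
have [eE eR] := (lec0P _).1 (ltW e0).
have e0' : 0 < complex.Re e by rewrite -ltcR -eE.
have [B FB BP] := FC _ e0'.
apply: (@filterS _ F _ B) => // b Bb.
rewrite distrC bop_normE eE lecR; apply: onorm_le => // f.
by rewrite bop_subE; exact: key _ _ FB e0' BP _ Bb _.
Qed.
HB.instance Definition _ := Uniform_isComplete.Build bop bop_complete.

Fact bop_star_le a : onorm (bop_star a) <= onorm a.
Proof. by apply: onorm_le; [exact: onorm_ge0|exact: bop_adj_le]. Qed.

Fact bop_mulA a b c : bop_mul a (bop_mul b c) = bop_mul (bop_mul a b) c.
Proof. exact: bop_ext. Qed.
Fact bop_mulDl (a b c : bop) : bop_mul (a + b) c = bop_mul a c + bop_mul b c.
Proof. exact: bop_ext. Qed.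
Fact bop_mulDr (a b c : bop) : bop_mul a (b + c) = bop_mul a b + bop_mul a c.
Proof.
by apply: bop_ext => f /=; rewrite -[X in a (X + _)]scale1r bop_lin scale1r.
Qed.
Lemma bopZ (a : bop) k f : a (k *: f) = k *: a f.
Proof. by rewrite -[k *: f]addr0 bop_lin bop0 addr0. Qed.
Fact bop_mulZl (k : R[i]) (a b : bop) : bop_mul (k *: a) b = k *: bop_mul a b.
Proof. exact: bop_ext. Qed.
Fact bop_mulZr (k : R[i]) (a b : bop) : bop_mul a (k *: b) = k *: bop_mul a b.
Proof. by apply: bop_ext => f /=; rewrite bopZ. Qed.
Fact bop_starD (a b : bop) : bop_star (a + b) = bop_star a + bop_star b.
Proof. exact: bop_ext. Qed.
Fact bop_starZ (k : R[i]) (a : bop) : bop_star (k *: a) = (k^*)%R *: bop_star a.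
Proof. exact: bop_ext. Qed.
Fact bop_starM a b : bop_star (bop_mul a b) = bop_mul (bop_star b) (bop_star a).
Proof. exact: bop_ext. Qed.
Fact bop_normM (a b : bop) : `|bop_mul a b| <= `|a| * `|b|.
Proof.
rewrite !bop_normE -rmorphM lecR; apply: onorm_le.
  by rewrite mulr_ge0 ?onorm_ge0.
move=> f; apply: (le_trans (le_onorm a (b f))).
by rewrite -mulrA ler_wpM2l ?onorm_ge0// le_onorm.
Qed.
Fact bop_cstar (a : bop) : `|bop_mul (bop_star a) a| = `|a| ^+ 2.
Proof.
rewrite !bop_normE -rmorphXn; congr _%:C; apply/eqP; rewrite eq_le; apply/andP; split.
  have := bop_normM (bop_star a) a; rewrite !bop_normE -rmorphM lecR.
  by move/le_trans; apply; rewrite expr2 ler_wpM2r ?onorm_ge0// bop_star_le.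
(* |a f|^2 = <f, a^* a f> <= |a^* a| |f|^2, so the square root of |a^* a| is a bound for [a]. *)
set b := bop_mul _ _; rewrite -(@sqr_sqrtr _ (onorm b)) ?onorm_ge0//.
rewrite ler_pXn2r ?nnegrE ?onorm_ge0 ?sqrtr_ge0//; apply: onorm_le; first exact: sqrtr_ge0.
move=> f; rewrite -(ler_pXn2r (n := 2))// ?nnegrE ?l2n_ge0 ?mulr_ge0 ?sqrtr_ge0 ?l2n_ge0//.
rewrite exprMn (@sqr_sqrtr _ (onorm b)) ?onorm_ge0// [leLHS]sqr_l2n_ip ip_bop.
apply: (le_trans (Re_ip_le _ _)); rewrite mulrC expr2 mulrA ler_wpM2r ?l2n_ge0//.
exact: (le_onorm b f).
Qed.
HB.instance Definition _ := CompleteNormedModule_isCStarAlgebra.Build R bop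
  bop_mulA bop_mulDl bop_mulDr bop_mulZl bop_mulZr bop_starK bop_starD bop_starZ
  bop_starM bop_normM bop_cstar.

End BoundedOperators.

(** * Representations of C*-algebras are contractive *)

Section RealNorm.
Variables (R : realType) (V : normedModType R[i]).
Implicit Types a b : V.

(** Moduli and norms taken in [R], where the order is total; the norms themselves lie in [R[i]]. *)
Definition cmod (z : R[i]) : R := Num.sqrt (nc2 z).

Definition nrm a : R := complex.Re `|a|.

Lemma nrmE a : `|a| = (nrm a)%:C.
Proof. by rewrite /nrm RRe_real// ger0_real. Qed.

Lemma nrm_ge0 a : 0 <= nrm a.
Proof. by rewrite -ler0c -nrmE. Qed.

Lemma nrmD a b : nrm (a + b) <= nrm a + nrm b.
Proof. by rewrite -lecR rmorphD/= -!nrmE ler_normD. Qed.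

Lemma nrmN a : nrm (- a) = nrm a.
Proof. by rewrite /nrm normrN. Qed.

Lemma nrmBC a b : nrm (a - b) = nrm (b - a).
Proof. by rewrite -nrmN opprB. Qed.

Lemma nrm_sub_trans b a c : nrm (a - c) <= nrm (a - b) + nrm (b - c).
Proof. by apply: le_trans (nrmD _ _); rewrite addrA subrK. Qed.

Lemma nrm0 : nrm 0 = 0.
Proof. by rewrite /nrm normr0. Qed.

Lemma nrm_eq0 a : nrm a = 0 -> a = 0.
Proof. by move=> a0; apply/eqP; rewrite -normr_eq0 nrmE a0. Qed.

Lemma nrm_le0 a : (forall e, 0 < e -> nrm a <= e) -> a = 0.
Proof.
move=> H; apply: nrm_eq0; apply/eqP; rewrite eq_le nrm_ge0 andbT.
by apply/ler_addgt0Pr => e e0; rewrite add0r H.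
Qed.

Lemma nrmZ k a : nrm (k *: a) = cmod k * nrm a.
Proof. by apply: complexI; rewrite -nrmE normrZ normc_nc2 nrmE rmorphM/=. Qed.

Lemma cmod_ge0 z : 0 <= cmod z. Proof. exact: sqrtr_ge0. Qed.

Lemma cmodE (z : R[i]) : `|z| = (cmod z)%:C.
Proof. exact: normc_nc2. Qed.

Lemma cmodM z w : cmod (z * w) = cmod z * cmod w.
Proof. by apply: complexI; rewrite rmorphM/= -!cmodE normrM. Qed.

Lemma cmodD (z w : R[i]) : cmod (z + w) <= cmod z + cmod w.
Proof. by rewrite -lecR rmorphD/= -!cmodE ler_normD. Qed.

Lemma cmodN (z : R[i]) : cmod (- z) = cmod z.
Proof. by apply: complexI; rewrite -!cmodE normrN. Qed.

Lemma cmodR (x : R) : cmod x%:C = `|x|.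
Proof. by rewrite /cmod nc2R sqrtr_sqr. Qed.

Lemma cmod_eq0 z : cmod z = 0 -> z = 0.
Proof. by move=> z0; apply/eqP; rewrite -normr_eq0 cmodE z0. Qed.

Lemma sqr_cmod z : cmod z ^+ 2 = nc2 z.
Proof. by rewrite sqr_sqrtr// nc2_ge0. Qed.

Lemma cmodX z n : cmod (z ^+ n) = cmod z ^+ n.
Proof. by apply: complexI; rewrite rmorphXn/= -!cmodE normrX. Qed.

End RealNorm.

Section CompleteReal.
Variables (R : realType) (V : completeNormedModType R[i]).

Lemma nrm_complete (u : nat -> V) :
  (forall e : R, 0 < e -> exists N, forall m n, (N <= m)%N -> (N <= n)%N ->
     nrm (u m - u n) <= e) ->
  exists l, forall e : R, 0 < e -> exists N, forall n, (N <= n)%N ->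
     nrm (u n - l) <= e.
Proof.
move=> uC; have /cvg_ex[l ul] : cvg (u @ \oo).
  apply: cauchy_cvg; apply/cauchy_ballP => e e0.
  have [eE _] := (lec0P _).1 (ltW e0).
  have e0' : 0 < complex.Re e by rewrite -ltcR -eE.
  have [N NP] := uC (complex.Re e / 2) (divr_gt0 e0' (ltr0n _ 2)).
  exists (u @` [set n | (N <= n)%N], u @` [set n | (N <= n)%N]).
    by split; exists N => // n Nn; exists n.
  move=> [x y]/= [[m Nm <-] [n Nn <-]]; rewrite -ball_normE/= nrmE eE ltcR.
  by rewrite (le_lt_trans (NP _ _ Nm Nn))// ltr_pdivrMr// ltr_pMr// ltr1n.
exists l => e e0; move/cvgrPdist_le : ul => /(_ e%:C).
rewrite ltcR => /(_ e0)[N _ NP]; exists N => n /NP /=.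
by rewrite distrC nrmE lecR.
Qed.

End CompleteReal.

(** * C*-algebra identities and a square root without functional calculus *)

Section CStarBasics.
Variables (R : realType) (T : cstarAlgType R).
Implicit Types a b : T.

Lemma cmul0l a : 0 ** a = 0.
Proof.
have := cmulDl 0 0 a; rewrite addr0 => /eqP.
by rewrite -subr_eq0 opprD addNKr oppr_eq0 => /eqP.
Qed.

Lemma cmul0r a : a ** 0 = 0.
Proof.
have := cmulDr a 0 0; rewrite addr0 => /eqP.
by rewrite -subr_eq0 opprD addNKr oppr_eq0 => /eqP.
Qed.

Lemma cmulNl a b : (- a) ** b = - (a ** b).
Proof. by rewrite -scaleN1r cmulZl scaleN1r. Qed.

Lemma cmulNr a b : a ** (- b) = - (a ** b).
Proof. by rewrite -scaleN1r cmulZr scaleN1r. Qed.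

Lemma cmulBl a b c : (a - b) ** c = a ** c - b ** c.
Proof. by rewrite cmulDl cmulNl. Qed.

Lemma cmulBr a b c : a ** (b - c) = a ** b - a ** c.
Proof. by rewrite cmulDr cmulNr. Qed.

Lemma adjR (x : R) a : adj (x%:C *: a) = x%:C *: adj a.
Proof. by rewrite Defs.adjZ; congr (_ *: _); exact: conjc_real. Qed.

Lemma adjN a : adj (- a) = - adj a.
Proof.
have := adjR (-1) a; rewrite rmorphN rmorph1 !scaleN1r; exact.
Qed.

Lemma adjB a b : adj (a - b) = adj a - adj b.
Proof. by rewrite adjD adjN. Qed.

Lemma adj0 : adj (0 : T) = 0.
Proof. by have := adjB 0 0; rewrite !subrr. Qed.

Lemma nrmM a b : nrm (a ** b) <= nrm a * nrm b.
Proof. by rewrite -lecR rmorphM/= -!nrmE ler_normcM. Qed.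

Lemma nrm_cstar a : nrm (adj a ** a) = nrm a ^+ 2.
Proof. by apply: complexI; rewrite rmorphXn/= -!nrmE cstar_norm. Qed.

Lemma nrm_adj_le a : nrm a <= nrm (adj a).
Proof.
have [->|a0] := eqVneq (nrm a) 0; first exact: nrm_ge0.
rewrite -(ler_pM2r (x := nrm a)) ?lt_def ?a0 ?nrm_ge0//.
by rewrite -expr2 -nrm_cstar nrmM.
Qed.

Lemma nrm_adj a : nrm (adj a) = nrm a.
Proof. by apply/eqP; rewrite eq_le nrm_adj_le -{2}[a]adjK nrm_adj_le. Qed.

Lemma expr_lt_eps (r e : R) : 0 <= r < 1 -> 0 < e -> exists N, r ^+ N <= e.
Proof.
move=> /andP[r0 r1] e0.
have : (fun n => r ^+ n) @ \oo --> (0 : R) by apply: cvg_expr; rewrite ger0_norm.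
move=> /cvgrPdist_le/(_ _ e0)[N _ /(_ N (leqnn _))]/=.
by rewrite sub0r normrN ger0_norm ?exprn_ge0//; exists N.
Qed.

(* The iteration u := (h + u^2) / 2 computes 1 - sqrt (1 - h). *)
Lemma one_minus_sqrt (h : T) : adj h = h -> nrm h < 1 ->
  exists u, adj u = u /\ u + u - u ** u = h.
Proof.
(* The smaller root of |h| + r^2 = 2 r: the map [g] below preserves the ball of radius [r], and
   [r < 1] is a Lipschitz constant for it there. *)
move=> hs h1; pose r := 1 - Num.sqrt (1 - nrm h).
have s1 : 0 < Num.sqrt (1 - nrm h) by rewrite sqrtr_gt0 subr_gt0.
have s2 : Num.sqrt (1 - nrm h) ^+ 2 = 1 - nrm h by rewrite sqr_sqrtr// subr_ge0 ltW.
have sle : Num.sqrt (1 - nrm h) <= 1.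
  by rewrite -[leRHS](@sqrtr1 R) ler_wsqrtr// lerBlDr lerDl nrm_ge0.
have rE : nrm h + r ^+ 2 = 2 * r by rewrite /r; move: s2; move: (Num.sqrt _) => x; lra.
have r0 : 0 <= r by rewrite subr_ge0.
have r1 : r < 1 by rewrite /r ltrBlDr ltrDl.
pose g (u : T) : T := (2^-1)%:C *: (h + u ** u).
have cm2 : cmod ((2^-1 : R)%:C) = 2^-1 by rewrite cmodR ger0_norm// invr_ge0.
have gball u : nrm u <= r -> nrm (g u) <= r.
  move=> ur; rewrite /g nrmZ cm2 ler_pdivrMl// -rE.
  rewrite (le_trans (nrmD _ _))// lerD2l (le_trans (nrmM _ _))// expr2.
  by rewrite ler_pM// nrm_ge0.
(* The factorization u^2 - v^2 = u (u - v) + (u - v) v avoids commutativity. *)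
have gE u v : g u - g v = (2^-1)%:C *: (u ** (u - v) + (u - v) ** v).
  by rewrite /g -scalerBr cmulBr cmulBl addrA subrK opprD addrACA subrr add0r.
have glip u v : nrm u <= r -> nrm v <= r -> nrm (g u - g v) <= r * nrm (u - v).
  move=> ur vr; rewrite gE nrmZ cm2 ler_pdivrMl//.
  rewrite (le_trans (nrmD _ _))//.
  have A : nrm (u ** (u - v)) <= r * nrm (u - v).
    by rewrite (le_trans (nrmM _ _))// ler_wpM2r// nrm_ge0.
  have B : nrm ((u - v) ** v) <= r * nrm (u - v).
    by rewrite (le_trans (nrmM _ _))// mulrC ler_wpM2r// nrm_ge0.
  by move: A B; move: (nrm _) (nrm _) (nrm (u - v)) => x y z; lra.
pose u n := iter n g 0.
have ur n : nrm (u n) <= r by elim: n => [|n IH]; rewrite ?nrm0// /u iterS gball.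
have ulip N m n : nrm (u (N + m)%N - u (N + n)%N) <= r ^+ N * nrm (u m - u n).
  elim: N => [|N IH]; first by rewrite expr0 mul1r.
  rewrite !addSn /u !iterS (le_trans (glip _ _ (ur _) (ur _)))//.
  by rewrite exprS -mulrA ler_wpM2l.
have [|l lP] := @nrm_complete _ T u.
  move=> e e0; have e20 : 0 < e / 2 by rewrite divr_gt0.
  have r01 : 0 <= r < 1 by rewrite r0 r1.
  have [N NP] := expr_lt_eps r01 e20; exists N => m n Nm Nn.
  rewrite -(subnKC Nm) -(subnKC Nn) (le_trans (ulip _ _ _))//.
  rewrite -[e](@mulfVK _ 2)// ler_pM ?exprn_ge0 ?nrm_ge0//.
  rewrite (le_trans (nrmD _ _))// nrmN (@le_trans _ _ (r + r)) ?lerD//; lra.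
exists l.
have gl : l = g l.
  apply/eqP; rewrite -subr_eq0; apply/eqP/nrm_le0 => e e0.
  (* The three summands of [c] pay for |u_(N+1) - l|, |u_N (u_N - l)| and |(u_N - l) l|. *)
  pose c := 1 + (r + nrm l).
  have c0 : 0 < c by rewrite ltr_pwDl// addr_ge0// nrm_ge0.
  have [|N NP] := lP (e / c); first by rewrite divr_gt0.
  rewrite (le_trans (nrm_sub_trans (u N.+1) _ _))// nrmBC.
  have -> : u N.+1 - g l = (2^-1)%:C *: (u N ** (u N - l) + (u N - l) ** l) by exact: gE.
  rewrite nrmZ cm2.
  have A : nrm (u N ** (u N - l)) <= r * (e / c).
    by rewrite (le_trans (nrmM _ _))// ler_pM ?nrm_ge0 ?NP.
  have B : nrm ((u N - l) ** l) <= nrm l * (e / c).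
    by rewrite (le_trans (nrmM _ _))// mulrC ler_wpM2l ?nrm_ge0 ?NP.
  have C := NP N.+1 (leqnSn _).
  have D := nrmD (u N ** (u N - l)) ((u N - l) ** l).
  have E : e = e / c + r * (e / c) + nrm l * (e / c).
    by move: c0; rewrite /c; move: (r) (nrm l) => x y xy; field; rewrite gt_eqF.
  rewrite [leRHS]E -addrA lerD// (le_trans _ (lerD A B))// (le_trans _ D)//.
  by rewrite ler_piMl ?nrm_ge0// invf_le1// ler1n.
split.
  apply/eqP; rewrite -subr_eq0; apply/eqP/nrm_le0 => e e0.
  have [|N NP] := lP (e / 2); first by rewrite divr_gt0.
  have us n : adj (u n) = u n.
    by elim: n => [|n IH]; rewrite ?adj0// /u iterS /g adjR adjD adjM hs IH.
  rewrite (le_trans (nrm_sub_trans (u N) _ _))// -{1}us -adjB nrm_adj (nrmBC l).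
  by have := NP N (leqnn _); lra.
rewrite {1 2}gl /g -scalerDl -rmorphD.
have -> : 2^-1 + 2^-1 = 1 :> R by lra.
by rewrite scale1r addrK.
Qed.

Lemma star_homD (S : cstarAlgType R) (f : S -> T) (a b : S) : star_hom f -> f (a + b) = f a + f b.
Proof. by case=> fl _ _; have := fl 1 a b; rewrite !scale1r. Qed.

Lemma star_hom0 (S : cstarAlgType R) (f : S -> T) : star_hom f -> f 0 = 0.
Proof.
move=> fh; have := @star_homD S f 0 0 fh; rewrite addr0 => /eqP.
by rewrite -subr_eq0 opprD addNKr oppr_eq0 => /eqP.
Qed.

Lemma star_homZ (S : cstarAlgType R) (f : S -> T) k (a : S) : star_hom f -> f (k *: a) = k *: f a.
Proof. by move=> fh; case: (fh) => fl _ _; have := fl k a 0; rewrite !addr0 star_hom0// addr0. Qed.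

Lemma star_homB (S : cstarAlgType R) (f : S -> T) (a b : S) : star_hom f -> f (a - b) = f a - f b.
Proof. by move=> fh; rewrite star_homD// -scaleN1r star_homZ// scaleN1r. Qed.

End CStarBasics.

Section Representation.
Variables (R : realType) (T : cstarAlgType R) (I : choiceType).
Variable Q : T -> bop R I.
Hypothesis Qh : star_hom Q.

Lemma repM a b x : Q (a ** b) x = Q a (Q b x).
Proof. by case: Qh => _ -> _. Qed.

Lemma rep_adj a x y : ip (Q (adj a) x) y = ip x (Q a y).
Proof. by case: Qh => _ _ ->; rewrite ip_bop [bop_star (adj _)]bop_starK. Qed.

(* If [nrm b < 1] and [b^* b = 2 u - u^2] with [u^* = u], then
   [ip ((1 - Q (b^* b)) x) x = l2n2 ((1 - Q u) x) >= 0]. *)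
Lemma rep_le a x : l2n (Q a x) <= nrm a * l2n x.
Proof.
have H1 b : nrm b < 1 -> l2n2 (Q b x) <= l2n2 x.
  move=> b1; have [||u [us uE]] := @one_minus_sqrt R T (adj b ** b).
  - by rewrite adjM adjK.
  - by rewrite nrm_cstar expr_lt1// nrm_ge0.
  have Qu y z : ip (Q u y) z = ip y (Q u z) by rewrite -{1}us rep_adj.
  have := l2n2_ge0 (x - Q u x); rewrite -ler0c -ipE !ipBl !ipBr.
  have -> : ip (Q u x) (Q u x) = ip (Q (u ** u) x) x by rewrite repM [RHS]Qu.
  rewrite -(Qu x x) => H; rewrite -lecR -!ipE -subr_ge0; apply: le_trans H _.
  rewrite -[ip (Q b x) _]rep_adj -repM -uE star_homB// star_homD//.
  rewrite bop_subE ipBl bop_addE ipD.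
  by rewrite (_ : forall p q r : R[i], p - q - (q - r) = p - (q + q - r))// => *; ring.
apply/ler_addgt0Pr => e e0.
have [x0|x0] := eqVneq (l2n x) 0.
  move/eqP: (x0); rewrite sqrtr_eq0 => x0'.
  have -> : x = 0 by apply: l2n2_eq0; apply/eqP; rewrite eq_le x0' l2n2_ge0.
  by rewrite bop0 l2n0 mulr0 add0r ltW.
have {}x0 : 0 < l2n x by rewrite lt_def x0 l2n_ge0.
(* Slightly larger than [nrm a], so that the strict bound in [H1] applies to [c^-1 a]; the excess
   contributes exactly [e]. *)
pose c := nrm a + e / l2n x.
have c0 : 0 < c by rewrite ltr_wpDl ?nrm_ge0 ?divr_gt0.
have := H1 (c^-1%:C *: a); rewrite nrmZ cmodR ger0_norm ?invr_ge0 ?(ltW c0)//.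
rewrite ltr_pdivrMl// mulr1 ltrDl divr_gt0// => /(_ isT).
rewrite star_homZ// bop_scaleE l2n2Z nc2R.
rewrite -!sqr_l2n -exprMn ler_pXn2r ?nnegrE ?mulr_ge0 ?l2n_ge0 ?invr_ge0 ?(ltW c0)//.
rewrite ler_pdivrMl// /c mulrDl divfK ?gt_eqF//; exact.
Qed.

End Representation.

(** * The complex exponential and the identity theorem *)

Section ComplexExponential.
Variable R : realType.
Implicit Types (z w : R[i]) (n : nat).

(** Built from real functions, which makes the addition law immediate; that it is the sum of the
    exponential series is [exp_psum_cvg]. *)
Definition expc z : R[i] :=
  (expR (complex.Re z) * cos (complex.Im z)) +i*
  (expR (complex.Re z) * sin (complex.Im z)).

Lemma expcD z w : expc (z + w) = expc z * expc w.
Proof.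
case: z w => a b [c d]; rewrite /expc /= expRD cosD sinD.
by apply/eqP; rewrite eq_complex/=; apply/andP; split; apply/eqP; ring.
Qed.

Lemma expcR (x : R) : expc x%:C = (expR x)%:C.
Proof. by rewrite /expc/= cos0 sin0 mulr1 mulr0. Qed.

Definition exp_psum n z : R[i] := \sum_(0 <= k < n) z ^+ k / k`!%:R.

(** Both sides run over the pairs j + k < n, grouped on the left by antidiagonals. *)
Lemma sum_triangle (K : pzRingType) (t u : nat -> K) n :
  \sum_(0 <= m < n) \sum_(0 <= j < m.+1) t j * u (m - j)%N =
  \sum_(0 <= j < n) \sum_(0 <= k < n - j) t j * u k.
Proof.
elim: n => [|n IH]; first by rewrite !big_geq.
rewrite big_nat_recr//= IH [in RHS]big_nat_recr//= subSnn.
rewrite [X in _ + X]big_nat_recr//= addrA; congr (_ + _); last first.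
  by rewrite big_nat1 subnn.
rewrite -big_split/=; apply: eq_big_nat => j /andP[_ jn].
by rewrite subSn ?(ltnW jn)// big_nat_recr.
Qed.

Lemma sum_square_triangle (K : pzRingType) (t u : nat -> K) n :
  (\sum_(0 <= j < n) t j) * (\sum_(0 <= k < n) u k) -
  \sum_(0 <= m < n) \sum_(0 <= j < m.+1) t j * u (m - j)%N =
  \sum_(0 <= j < n) \sum_(n - j <= k < n) t j * u k.
Proof.
rewrite sum_triangle mulr_suml -sumrB; apply: eq_big_nat => j /andP[_ jn].
rewrite mulr_sumr [X in X - _](@big_cat_nat _ _ _ (n - j)) ?leq_subr//=.
by rewrite addrAC subrr add0r.
Qed.

Lemma exp_coeffD (K : numFieldType) (z w : K) n :
  (z + w) ^+ n / n`!%:R =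
  \sum_(0 <= j < n.+1) (z ^+ j / j`!%:R) * (w ^+ (n - j) / (n - j)`!%:R).
Proof.
have nz m : m`!%:R != 0 :> K by rewrite pnatr_eq0 -lt0n fact_gt0.
rewrite addrC exprDn mulr_suml big_mkord; apply: eq_bigr => -[j /= jn] _.
rewrite -mulr_natr -(bin_fact (n := n) (m := j)) 1?ltnS// !natrM.
by field; rewrite !nz pnatr_eq0 -lt0n bin_gt0 -ltnS jn.
Qed.

Lemma exp_psum_defect n z w :
  exp_psum n z * exp_psum n w - exp_psum n (z + w) =
  \sum_(0 <= j < n) \sum_(n - j <= k < n) (z ^+ j / j`!%:R) * (w ^+ k / k`!%:R).
Proof.
rewrite -sum_square_triangle; congr (_ - _).
by apply: eq_big_nat => m _; rewrite exp_coeffD.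
Qed.

Lemma exp_psum_real n (x : R) : exp_psum n x%:C = (series (exp_coeff x) n)%:C.
Proof.
rewrite /exp_psum /series/= rmorph_sum/=; apply: eq_big_nat => k _.
by rewrite rmorphM fmorphV rmorphXn rmorph_nat.
Qed.

Lemma cmod_exp_coeff z k : cmod (z ^+ k / k`!%:R) = cmod z ^+ k / k`!%:R.
Proof.
by apply: complexI; rewrite -cmodE normrM normfV normrX normr_nat cmodE
  rmorphM fmorphV rmorphXn rmorph_nat.
Qed.

Lemma cmod_sum (J : Type) (r : seq J) (P : pred J) (F : J -> R[i]) :
  cmod (\sum_(i <- r | P i) F i) <= \sum_(i <- r | P i) cmod (F i).
Proof.
elim/big_ind2 : _ => //; first by rewrite /cmod nc20 sqrtr0.
by move=> x1 x2 y1 y2 h1 h2; rewrite (le_trans (cmodD _ _))// lerD.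
Qed.

(** The defect is a polynomial in [z] and [w] with nonnegative coefficients, hence dominated by the
    same polynomial at the moduli, where the real exponential shows that it tends to 0. *)
Lemma exp_psum_defect_le n z w :
  cmod (exp_psum n z * exp_psum n w - exp_psum n (z + w)) <=
  series (exp_coeff (cmod z)) n * series (exp_coeff (cmod w)) n -
  series (exp_coeff (cmod z + cmod w)) n.
Proof.
rewrite exp_psum_defect (le_trans (cmod_sum _ _ _))//.
have -> : series (exp_coeff (cmod z)) n * series (exp_coeff (cmod w)) n -
  series (exp_coeff (cmod z + cmod w)) n =
  \sum_(0 <= j < n) \sum_(n - j <= k < n)
     (cmod z ^+ j / j`!%:R) * (cmod w ^+ k / k`!%:R).
  rewrite -sum_square_triangle; congr (_ - _).
  by apply: eq_big_nat => m _; rewrite /exp_coeff/= exp_coeffD.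
apply: ler_sum => j _; rewrite (le_trans (cmod_sum _ _ _))//.
by apply: ler_sum => k _; rewrite cmodM !cmod_exp_coeff.
Qed.

(** Even powers of i are real and odd ones imaginary; [cos_coeff] and [sin_coeff] vanish at indices
    of the wrong parity. *)
Lemma exp_psum_imag n (b : R) :
  exp_psum n (0 +i* b) = series (cos_coeff b) n +i* series (sin_coeff b) n.
Proof.
rewrite /exp_psum /series/=; elim: n => [|n IH]; first by rewrite !big_geq.
rewrite !big_nat_recr//= {}IH.
suff -> : (0 +i* b) ^+ n / n`!%:R = cos_coeff b n +i* sin_coeff b n by [].
have iE : (0 +i* b) = 'i%C * b%:C.
  by apply/eqP; rewrite eq_complex/=; apply/andP; split; apply/eqP; ring.
have fE : (n`!%:R : R[i])^-1 = ((n`!%:R)^-1 : R)%:C.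
  by rewrite fmorphV rmorph_nat.
rewrite iE exprMn fE -rmorphXn -mulrA -rmorphM /=.
rewrite /cos_coeff /sin_coeff /= -exprnP.
have [k [nE|nE]] : exists k, n = k.*2 \/ n = k.*2.+1.
  by exists n./2; rewrite -{1 3}(odd_double_half n); case: (odd n); [right|left].
- have -> : ('i%C : R[i]) ^+ n = ((-1) ^+ k)%:C.
    by rewrite nE -mul2n exprM sqr_i rmorphXn rmorphN rmorph1.
  rewrite nE odd_double doubleK /=; apply/eqP; rewrite eq_complex/=.
  by apply/andP; split; apply/eqP; ring.
- have -> : ('i%C : R[i]) ^+ n = 'i%C * ((-1) ^+ k)%:C.
    by rewrite nE exprS -mul2n exprM sqr_i rmorphXn rmorphN rmorph1.
  rewrite nE/= odd_double/= doubleK; apply/eqP; rewrite eq_complex/=.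
  by apply/andP; split; apply/eqP; ring.
Qed.

Lemma cmod_le z : cmod z <= `|complex.Re z| + `|complex.Im z|.
Proof.
case: z => a b; rewrite (_ : a +i* b = a%:C + 0 +i* b); last first.
  by apply/eqP; rewrite eq_complex/= addr0 add0r !eqxx.
rewrite (le_trans (cmodD _ _))// /= addr0 add0r lerD//.
  by rewrite cmodR.
by rewrite /cmod /nc2/= expr0n/= add0r sqrtr_sqr.
Qed.

(** For z = a + i b, the partial sums at [a] and at [i b] converge by the real theory, and [D]
    bounds the distance from their product to the partial sum at [z]. *)
Lemma exp_psum_cvg z : (fun n => cmod (exp_psum n z - expc z)) @ \oo --> (0 : R).
Proof.
case: z => a b.
set E := fun n : nat => series (exp_coeff a) n.
set C := fun n : nat => series (cos_coeff b) n.
set S := fun n : nat => series (sin_coeff b) n.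
have Ecvg (x : R) : series (exp_coeff x) @ \oo --> expR x by exact: is_cvg_series_exp_coeff.
have Ccvg : C @ \oo --> cos b by rewrite cos.unlock; exact: is_cvg_series_cos_coeff.
have Scvg : S @ \oo --> sin b by rewrite sin.unlock; exact: is_cvg_series_sin_coeff.
pose D n := series (exp_coeff (cmod a%:C)) n * series (exp_coeff (cmod (0 +i* b))) n -
  series (exp_coeff (cmod a%:C + cmod (0 +i* b))) n.
have Dcvg : D @ \oo --> (0 : R).
  rewrite -(subrr (expR (cmod a%:C + cmod (0 +i* b)))) {1}expRD.
  by apply: cvgB; [apply: cvgM; exact: Ecvg|exact: Ecvg].
pose G n := D n + (`|E n * C n - expR a * cos b| + `|E n * S n - expR a * sin b|).
have Gcvg : G @ \oo --> (0 : R).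
  rewrite -[X in _ --> X](addr0 (0 : R)); apply: cvgD => //.
  rewrite -[X in _ --> X](addr0 (0 : R)); apply: cvgD.
    rewrite -(@normr0 _ R); apply: cvg_norm; rewrite -(subrr (expR a * cos b)).
    by apply: cvgB; [apply: cvgM => //; exact: Ecvg|exact: cvg_cst].
  rewrite -(@normr0 _ R); apply: cvg_norm; rewrite -(subrr (expR a * sin b)).
  by apply: cvgB; [apply: cvgM => //; exact: Ecvg|exact: cvg_cst].
apply: (squeeze_cvgr _ (cvg_cst 0) Gcvg).
apply: nearW => n; rewrite cmod_ge0/= /G.
have zE : a +i* b = a%:C + 0 +i* b.
  by apply/eqP; rewrite eq_complex/= addr0 add0r !eqxx.
have -> : exp_psum n (a +i* b) - expc (a +i* b) =
   - (exp_psum n a%:C * exp_psum n (0 +i* b) - exp_psum n (a +i* b)) +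
   (exp_psum n a%:C * exp_psum n (0 +i* b) - expc (a +i* b)).
  by rewrite opprB addrA subrK.
rewrite (le_trans (cmodD _ _))// lerD//.
  by rewrite cmodN zE exp_psum_defect_le.
rewrite exp_psum_real exp_psum_imag (le_trans (cmod_le _))//.
rewrite lerD//=.
  by rewrite /expc/= mul0r subr0.
by rewrite /expc/= mul0r addr0.
Qed.

Lemma entire_expc (T : cstarAlgType R) (k : R[i]) (a : T) :
  entire (fun z => expc (k * z) *: a).
Proof.
(* The Taylor coefficients at [z0]. The series converges everywhere, so the radius 1 is an arbitrary
   choice. *)
move=> z0; exists (fun n => (k ^+ n / n`!%:R * expc (k * z0)) *: a), 1.
split => [|h _]; first exact: ltr01.
have sE n : \sum_(0 <= j < n) h ^+ j *: ((k ^+ j / j`!%:R * expc (k * z0)) *: a) =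
    (exp_psum n (k * h) * expc (k * z0)) *: a.
  rewrite /exp_psum !mulr_suml scaler_suml; apply: eq_big_nat => j _.
  by rewrite scalerA exprMn; congr (_ *: _); ring.
apply/cvgrPdist_le => e e0; have [eE _] := (lec0P _).1 (ltW e0).
have e0' : 0 < complex.Re e by rewrite -ltcR -eE.
pose M := cmod (expc (k * z0)) * nrm a + 1.
have M0 : 0 < M by rewrite ltr_wpDl// mulr_ge0 ?cmod_ge0 ?nrm_ge0.
have := exp_psum_cvg (k * h).
move=> /cvgrPdist_le/(_ (complex.Re e / M) (divr_gt0 e0' M0)).
apply: filterS => n; rewrite sub0r normrN ger0_norm ?cmod_ge0// => H.
rewrite sE mulrDr expcD [expc (k * z0) * _]mulrC -scalerBl -mulrBl eE nrmE lecR.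
rewrite nrmZ cmodM -(cmodN (_ - _)) opprB -mulrA.
rewrite -[leRHS](divfK (lt0r_neq0 M0)) ler_pM ?cmod_ge0 ?mulr_ge0 ?cmod_ge0 ?nrm_ge0//.
by rewrite lerDl.
Qed.

End ComplexExponential.

(** * Power series and the identity theorem *)

Section IdentityTheorem.
Variable R : realType.
Implicit Types (f : R[i] -> R[i]) (c : nat -> R[i]) (h : R[i]).

Definition psum_to c (r : R) f := forall h, cmod h < r -> forall e : R, 0 < e ->
  exists N, forall n, (N <= n)%N -> cmod (\sum_(0 <= k < n) h ^+ k * c k - f h) <= e.

Definition holomorphic f := forall z, exists c (r : R), 0 < r /\
  psum_to c r (fun h => f (z + h)).

Lemma cmod0 : cmod (0 : R[i]) = 0.
Proof. by rewrite /cmod nc20 sqrtr0. Qed.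

Lemma cmod_le_eps (z : R[i]) : (forall e, 0 < e -> cmod z <= e) -> z = 0.
Proof.
move=> H; apply: cmod_eq0; apply/eqP; rewrite eq_le cmod_ge0 andbT.
by apply/ler_addgt0Pr => e e0; rewrite add0r H.
Qed.

(** Each term at [s] is the difference of two consecutive partial sums, eventually within 1 of the
    limit, so it is at most 2 from some index on; the finitely many earlier terms are added to the
    bound. *)
Lemma psum_to_coef_bounded c (r s : R) f : 0 < s < r -> psum_to c r f ->
  exists2 M : R, 0 < M & forall k, cmod (c k) * s ^+ k <= M.
Proof.
move=> /andP[s0 sr] cf; have sE : cmod s%:C = s by rewrite cmodR gtr0_norm.
have [|N NP] := cf s%:C _ 1 ltr01; first by rewrite sE.
have H k : (N <= k)%N -> cmod (c k) * s ^+ k <= 2.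
  move=> Nk; have A := NP _ Nk; have B := NP _ (leqW Nk).
  rewrite mulrC -{1}sE -cmodX -cmodM.
  have -> : s%:C ^+ k * c k = (\sum_(0 <= j < k.+1) s%:C ^+ j * c j - f s%:C) +
     - (\sum_(0 <= j < k) s%:C ^+ j * c j - f s%:C).
    by rewrite big_nat_recr//= opprB addrA subrK addrAC subrr add0r.
  by rewrite (le_trans (cmodD _ _))// cmodN (le_trans (lerD B A)).
pose M := 2 + \sum_(0 <= k < N) cmod (c k) * s ^+ k.
have p k : 0 <= cmod (c k) * s ^+ k by rewrite mulr_ge0 ?cmod_ge0 ?exprn_ge0 ?ltW.
have S0 : 0 <= \sum_(0 <= k < N) cmod (c k) * s ^+ k by apply: sumr_ge0.
exists M => [|k]; first by rewrite ltr_pwDl.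
have [/H Nk|kN] := leqP N k; first by rewrite (le_trans Nk)// lerDl.
rewrite /M (@big_cat_nat _ _ _ k)//= ?(ltnW kN)// (@big_ltn _ _ _ k)//.
have A : 0 <= \sum_(0 <= i < k) cmod (c i) * s ^+ i by apply: sumr_ge0.
have B : 0 <= \sum_(k.+1 <= i < N) cmod (c i) * s ^+ i by apply: sumr_ge0.
by move: A B (p k); move: (\sum_(0 <= i < k) _) (\sum_(k.+1 <= i < N) _) (_ * _) => x y z; lra.
Qed.

Lemma geometric_tail (q : R) m n : 0 <= q <= 2^-1 ->
  \sum_(m <= k < n) q ^+ k <= 2 * q ^+ m.
Proof.
move=> /andP[q0 q2]; have [mn|nm] := leqP m n; last first.
  by rewrite big_geq ?(ltnW nm)// mulr_ge0// exprn_ge0.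
(* Subtracting [2 q^n] makes the bound provable by induction on [n]. *)
suff : \sum_(m <= k < n) q ^+ k <= 2 * q ^+ m - 2 * q ^+ n.
  by move/le_trans; apply; rewrite lerBlDr lerDl mulr_ge0// exprn_ge0.
elim: n mn => [|n IH mn]; first by rewrite leqn0 => /eqP->; rewrite big_geq// subrr.
have [mn'|nm] := leqP m n; last first.
  have -> : m = n.+1 by apply/eqP; rewrite eqn_leq mn.
  by rewrite big_geq// subrr.
rewrite big_nat_recr//= (le_trans (lerD (IH mn') (lexx _)))// exprS.
have : q * q ^+ n <= 2^-1 * q ^+ n by rewrite ler_wpM2r// exprn_ge0.
by move: (q ^+ n) (q ^+ m) => x y; lra.
Qed.

(* The zeros of a power series that is not identically zero are isolated. *)
Lemma psum_to_coef0 c (r : R) f : 0 < r -> psum_to c r f ->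
  (forall d : R, 0 < d -> exists h, [/\ h != 0, cmod h < d & f h = 0]) ->
  forall k, c k = 0.
Proof.
move=> r0 cf zf; pose s := r / 2.
have s0 : 0 < s by rewrite divr_gt0.
have sr : 0 < s < r by rewrite s0 /s ltr_pdivrMr// ltr_pMr// ltr1n.
have [M M0 MP] := psum_to_coef_bounded sr cf.
elim/ltn_ind => m IH; apply: cmod_le_eps => e e0.
(* At a zero [h], the term of index [m] is bounded by the tail, so |c_m| <= K |h|. In [d], the bound
   [e / K] makes this at most [e], and [s / 2] makes the ratio |h| / s at most 1/2, as
   [geometric_tail] requires. *)
pose K := 2 * M / s ^+ m.+1.
have K0 : 0 < K by rewrite divr_gt0 ?mulr_gt0 ?exprn_gt0.
pose d := Num.min (s / 2) (e / K).
have d0 : 0 < d by rewrite lt_min (divr_gt0 e0 K0) (divr_gt0 s0).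
have [h [h0 hd fh]] := zf _ d0.
have ch : 0 < cmod h.
  by rewrite lt_def cmod_ge0 andbT; apply: contra_neq h0; exact: cmod_eq0.
have [hs he] : cmod h < s / 2 /\ cmod h < e / K by move: hd; rewrite lt_min => /andP[].
have hr : cmod h < r.
  apply: (lt_trans hs); case/andP: sr => _; apply: lt_trans.
  by rewrite ltr_pdivrMr// ltr_pMr// ltr1n.
have q12 : 0 <= cmod h / s <= 2^-1.
  by rewrite divr_ge0 ?cmod_ge0 ?(ltW s0)//= ler_pdivrMr// mulrC ltW.
suff H : cmod (h ^+ m * c m) <= 2 * M * (cmod h / s) ^+ m.+1.
  rewrite cmodM cmodX in H.
  have hm : 0 < cmod h ^+ m by rewrite exprn_gt0.
  rewrite -(ler_pM2l hm) (le_trans H)//.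
  rewrite expr_div_n mulrA mulrAC -/K exprSr mulrCA ler_pM2l//.
  by rewrite mulrC -ler_pdivlMr// ltW.
apply/ler_addgt0Pr => d' d'0.
have [N NP] := cf h hr _ d'0.
pose n := maxn N m.+1.
have := NP n (leq_maxl _ _); rewrite fh subr0 => A.
have mn : (m.+1 <= n)%N by rewrite leq_maxr.
move: A; rewrite (@big_cat_nat _ _ _ m.+1)//= big_nat_recr//=.
rewrite [X in X + _ + _]big1_seq ?add0r; last first.
  by move=> i; rewrite mem_index_iota/= => im; rewrite IH ?mulr0.
move=> A; set X := h ^+ m * c m in A *; set Y := \sum_(m.+1 <= k < n) _ in A.
have -> : X = (X + Y) + - Y by rewrite addrK.
rewrite (le_trans (cmodD _ _))// cmodN addrC lerD//.
apply: (@le_trans _ _ (\sum_(m.+1 <= k < n) M * (cmod h / s) ^+ k)).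
  rewrite (le_trans (cmod_sum _ _ _))//; apply: ler_sum => k _.
  rewrite cmodM cmodX expr_div_n mulrCA ler_wpM2l ?exprn_ge0 ?cmod_ge0//.
  by rewrite ler_pdivlMr ?exprn_gt0.
by rewrite -mulr_sumr -mulrA mulrCA ler_pM2l// geometric_tail.
Qed.

Lemma psum_to_zero c (r : R) f : 0 < r -> psum_to c r f ->
  (forall d : R, 0 < d -> exists h, [/\ h != 0, cmod h < d & f h = 0]) ->
  forall h, cmod h < r -> f h = 0.
Proof.
move=> r0 cf zf h hr; have c0 := psum_to_coef0 r0 cf zf.
apply: cmod_le_eps => e e0; have [N /(_ N (leqnn _))] := cf h hr _ e0.
rewrite big1 => [|k _]; last by rewrite c0 mulr0.
by rewrite sub0r cmodN.
Qed.

Lemma cmod_imag (b : R) : cmod (0 +i* b) = `|b|.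
Proof. by rewrite /cmod /nc2/= expr0n/= add0r sqrtr_sqr. Qed.

(** The heights [t] such that [f] vanishes near i t form a set [Z] that is open, closed because
    zeros are isolated, and contains 0 because [f] vanishes on the real axis; the line is
    connected. *)
Lemma holomorphic_zero f : holomorphic f -> (forall t : R, f t%:C = 0) ->
  forall t : R, f (0 +i* t) = 0.
Proof.
move=> fh f0 t.
pose Z := [set t : R | exists2 r : R, 0 < r & forall h, cmod h < r -> f (0 +i* t + h) = 0].
have open1 (u : R) : Z u -> exists2 r : R, 0 < r & forall v, `|v - u| < r -> Z v.
  move=> [r r0 fr]; exists (r / 2); first by rewrite divr_gt0.
  move=> v vu; exists (r / 2); first by rewrite divr_gt0.
  move=> h hr; have -> : 0 +i* v + h = 0 +i* u + (0 +i* (v - u) + h).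
    rewrite addrA; congr (_ + _); apply/eqP; rewrite eq_complex/=.
    by apply/andP; split; apply/eqP; ring.
  by apply: fr; rewrite (le_lt_trans (cmodD _ _))// cmod_imag; lra.
have closed1 (u : R) : (forall r : R, 0 < r -> exists2 v, Z v & `|v - u| < r) -> Z u.
  move=> uZ; have [c [r [r0 cf]]] := fh (0 +i* u).
  exists r => //; apply: (psum_to_zero r0 cf) => d d0.
  have [v [s s0 fs] vu] := uZ (d / 2) (divr_gt0 d0 (ltr0n _ 2)).
  (* The point x + i (v - u) is a zero relative to i u; its positive real part makes it nonzero even
     if [v = u]. *)
  pose x := Num.min (s / 2) (d / 4).
  have x0 : 0 < x by rewrite lt_min !divr_gt0.
  have xs : x < s.
    by rewrite (@le_lt_trans _ _ (s / 2)) ?ge_min ?lexx//; lra.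
  have xd : x <= d / 4 by rewrite ge_min lexx orbT.
  exists (x +i* (v - u)); split.
  - by rewrite eq_complex/= negb_and (gt_eqF x0).
  - rewrite (le_lt_trans (cmod_le _))//= (gtr0_norm x0); lra.
  - have -> : 0 +i* u + x +i* (v - u) = 0 +i* v + x%:C.
      by apply/eqP; rewrite eq_complex/=; apply/andP; split; apply/eqP; ring.
    by apply: fs; rewrite cmodR gtr0_norm.
have Z0 : Z 0.
  have [c [r [r0 cf]]] := fh 0; exists r => //.
  have E : (0 +i* 0 : R[i]) = 0 by [].
  rewrite E; apply: (psum_to_zero r0 cf) => d d0.
  exists (d / 2)%:C; split.
  - by rewrite eq_complex/= negb_and gt_eqF// divr_gt0.
  - by rewrite cmodR gtr0_norm ?divr_gt0//; lra.
  - by rewrite add0r f0.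
suff ZT : Z = setT.
  have [r r0 fr] : Z t by rewrite ZT.
  by rewrite -[X in f X]addr0 fr// cmod0.
have conn : connected [set: R] by apply/connected_intervalP.
apply: conn; first by exists 0.
- exists Z; last by rewrite setTI.
  rewrite openE => u /open1[r r0 Zr]; apply/nbhs_ballP; exists r => //= v.
  by rewrite /ball/= distrC => /Zr.
- exists Z; last by rewrite setTI.
  move=> u uZ; apply: closed1 => r r0.
  have [v [Zv]] := uZ _ (nbhsx_ballx u r r0).
  by rewrite /ball/= distrC => vu; exists v.
Qed.

Lemma holomorphic_real_eq f g : holomorphic f -> holomorphic g ->
  (forall t : R, f t%:C = g t%:C) -> forall t : R, f (0 +i* t) = g (0 +i* t).
Proof.
move=> fh gh fg t; apply/eqP; rewrite -subr_eq0; apply/eqP.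
apply: (holomorphic_zero (f := fun z => f z - g z)) => [z|u]; last first.
  by rewrite fg subrr.
have [c [r [r0 cf]]] := fh z; have [d [s [s0 dg]]] := gh z.
exists (fun k => c k - d k), (Num.min r s); split; first by rewrite lt_min r0.
move=> h; rewrite lt_min => /andP[hr hs] e e0.
have [N NP] := cf h hr (e / 2) (divr_gt0 e0 (ltr0n _ 2)).
have [M MP] := dg h hs (e / 2) (divr_gt0 e0 (ltr0n _ 2)).
exists (maxn N M) => n; rewrite geq_max => /andP[/NP A /MP B].
have -> : \sum_(0 <= k < n) h ^+ k * (c k - d k) - (f (z + h) - g (z + h)) =
    (\sum_(0 <= k < n) h ^+ k * c k - f (z + h)) +
    - (\sum_(0 <= k < n) h ^+ k * d k - g (z + h)).
  under eq_bigr do rewrite mulrBr.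
  by rewrite sumrB; move: (\sum_(_ <= _ < _) _) (\sum_(_ <= _ < _) _) (f _) (g _) => p q u v; ring.
by rewrite (le_trans (cmodD _ _))// cmodN; lra.
Qed.

(** A bounded functional maps a norm-convergent power series to a scalar one, which reduces
    vector-valued functions to the scalar identity theorem. *)
Lemma entire_holomorphic (T : cstarAlgType R) (F : R[i] -> T) (L : T -> R[i]) (C : R) :
  (forall (k : R[i]) a b, L (k *: a + b) = k * L a + L b) ->
  (forall a, cmod (L a) <= C * nrm a) -> entire F -> holomorphic (fun z => L (F z)).
Proof.
move=> Ll LC Fe z; have [c [rad [rad0 cF]]] := Fe z.
have [radE _] := (lec0P _).1 (ltW rad0).
have L0 : L 0 = 0.
  have := Ll 1 0 0; rewrite scaler0 addr0 mul1r => /eqP.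
  by rewrite -subr_eq0 opprD addNKr oppr_eq0 => /eqP.
have LB a b : L (a - b) = L a - L b by rewrite addrC -scaleN1r Ll mulN1r addrC.
have LS n h : L (\sum_(0 <= k < n) h ^+ k *: c k) = \sum_(0 <= k < n) h ^+ k * L (c k).
  elim: n => [|n IH]; first by rewrite !big_geq.
  by rewrite !big_nat_recr//= addrC Ll IH addrC.
exists (fun k => L (c k)), (complex.Re rad); split; first by rewrite -ltcR -radE.
move=> h hr e e0.
have /cF/cvgrPdist_le H : `|h| < rad by rewrite radE cmodE ltcR.
pose C' := `|C| + 1.
have C'0 : 0 < C' by rewrite ltr_wpDl.
have := H (e / C')%:C; rewrite ltcR divr_gt0// => /(_ isT)[N _ NP].
exists N => n /NP /=; rewrite nrmE lecR => A.
rewrite -LS -LB (le_trans (LC _))// nrmBC.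
rewrite -[e](divfK (lt0r_neq0 C'0)) mulrC (le_trans (ler_wpM2l _ (ler_norm C)))//.
  exact: nrm_ge0.
by rewrite ler_pM ?nrm_ge0// lerDl.
Qed.

End IdentityTheorem.

(** * Positive functionals and the Toeplitz relations *)

Section PositiveFunctionals.
Variables (R : realType) (T : cstarAlgType R).
Implicit Types (a b x y z : T) (w : T -> R[i]).

Definition bounded_linear w : Prop :=
  (forall (k : R[i]) a b, w (k *: a + b) = k * w a + w b) /\
  exists C : R, 0 <= C /\ forall a, cmod (w a) <= C * nrm a.

Definition posfun w : Prop := bounded_linear w /\ forall a, 0 <= w (adj a ** a).

Lemma bl0 w : bounded_linear w -> w 0 = 0.
Proof.
move=> [wl _]; have := wl 1 0 0; rewrite scaler0 addr0 mul1r => /eqP.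
by rewrite -subr_eq0 opprD addNKr oppr_eq0 => /eqP.
Qed.

Lemma blD w a b : bounded_linear w -> w (a + b) = w a + w b.
Proof. by move=> [wl _]; rewrite -[a]scale1r wl mul1r scale1r. Qed.

Lemma blZ w k a : bounded_linear w -> w (k *: a) = k * w a.
Proof. by move=> wb; case: (wb) => wl _; rewrite -[k *: a]addr0 wl bl0// addr0. Qed.

Lemma blN w a : bounded_linear w -> w (- a) = - w a.
Proof. by move=> wb; rewrite -scaleN1r blZ// mulN1r. Qed.

Lemma blB w a b : bounded_linear w -> w (a - b) = w a - w b.
Proof. by move=> wb; rewrite blD// blN. Qed.

Lemma bl_sum w (J : Type) (r : seq J) (P : pred J) (F : J -> T) : bounded_linear w ->
  w (\sum_(i <- r | P i) F i) = \sum_(i <- r | P i) w (F i).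
Proof.
move=> wb; elim/big_rec2 : _ => [|i y x _ <-]; first exact: bl0.
by rewrite blD.
Qed.

Lemma bl_comb w w' (k k' : R[i]) : bounded_linear w -> bounded_linear w' ->
  bounded_linear (fun a => k * w a + k' * w' a).
Proof.
move=> [wl [C [C0 wC]]] [wl' [C' [C0' wC']]]; split=> [l a b|].
  by rewrite wl wl'; ring.
exists (cmod k * C + cmod k' * C'); split.
  by rewrite addr_ge0// mulr_ge0 ?cmod_ge0.
move=> a; rewrite (le_trans (cmodD _ _))// !cmodM mulrDl -!mulrA.
by rewrite lerD// ler_wpM2l ?cmod_ge0.
Qed.

Lemma bl_mull w x : bounded_linear w -> bounded_linear (fun a => w (x ** a)).
Proof.
move=> [wl [C [C0 wC]]]; split=> [k a b|]; first by rewrite cmulDr cmulZr wl.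
exists (C * nrm x); split=> [|a]; first by rewrite mulr_ge0 ?nrm_ge0.
by rewrite (le_trans (wC _))// -mulrA ler_wpM2l// nrmM.
Qed.

Lemma bl_mulr w x : bounded_linear w -> bounded_linear (fun a => w (a ** x)).
Proof.
move=> [wl [C [C0 wC]]]; split=> [k a b|]; first by rewrite cmulDl cmulZl wl.
exists (C * nrm x); split=> [|a]; first by rewrite mulr_ge0 ?nrm_ge0.
by rewrite (le_trans (wC _))// -mulrA ler_wpM2l// mulrC nrmM.
Qed.

Lemma posfun_CauchySchwarz w a b : posfun w ->
  nc2 (w (adj b ** a)) <= complex.Re (w (adj a ** a)) * complex.Re (w (adj b ** b)).
Proof.
move=> [wb w0]; have := @sesqui_CauchySchwarz R T (fun a b => w (adj b ** a)).
apply=> // [k x y z|k x y z].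
  by rewrite cmulDr cmulZr blD// blZ.
by rewrite adjD Defs.adjZ cmulDl cmulZl blD// blZ.
Qed.

Definition null z := forall w, posfun w -> w z = 0.

Lemma null0 : null 0.
Proof. by move=> w [wb _]; exact: bl0. Qed.

Lemma nullD z y : null z -> null y -> null (z + y).
Proof. by move=> z0 y0 w wp; case: (wp) => wb _; rewrite blD// z0// y0// addr0. Qed.

Lemma nullZ k z : null z -> null (k *: z).
Proof. by move=> z0 w wp; case: (wp) => wb _; rewrite blZ// z0// mulr0. Qed.

Lemma nullN z : null z -> null (- z).
Proof. by rewrite -scaleN1r; exact: nullZ. Qed.

(* The functional a |-> w ((l + x)^* a (l + x)), with l + x in the unitization. *)
Lemma posfun_compress w (l : R[i]) x : posfun w ->
  posfun (fun a => (l * conjc l) * w a + conjc l * w (a ** x) +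
    (l * w (adj x ** a) + w (adj x ** (a ** x)))).
Proof.
move=> [wb w0]; split; last first.
  move=> a; have := w0 (l *: a + a ** x).
  rewrite adjD Defs.adjZ adjM !cmulDl !cmulDr !cmulZl !cmulZr !blD// !blZ//.
  by rewrite !cmulA; congr (0 <= _); ring.
have H1 := bl_mulr x wb; have H2 := bl_mull (adj x) wb.
have H3 := bl_mulr x H2.
have := bl_comb 1 1 (bl_comb (l * conjc l) (conjc l) wb H1) (bl_comb l 1 H2 H3).
by under eq_fun do rewrite !mul1r.
Qed.

(** Polarization in the scalar [l] of [posfun_compress]: [l = 0] removes the term w(x^* z x), and
    [l = 1], [l = i] then separate w(z x) from w(x^* z). *)
Lemma null_mul z x : null z -> null (z ** x) /\ null (adj x ** z).
Proof.
move=> z0; suff H w : posfun w -> w (z ** x) = 0 /\ w (adj x ** z) = 0.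
  by split=> w /H[].
move=> wp; have E l := z0 _ (posfun_compress l x wp).
move: (E 0) (E 1) (E 'i%C); rewrite z0//.
rewrite !conjc0 conjc1 !mul0r !mul1r !add0r => -> + {E}.
rewrite !addr0 mulr0 add0r.
case: (w (z ** x)) (w (adj x ** z)) => a b [c d].
move=> /eqP; rewrite eq_complex/= => /andP[/eqP E1 /eqP E2].
move=> /eqP; rewrite eq_complex/= => /andP[/eqP E3 /eqP E4].
by split; apply/eqP; rewrite eq_complex/=; apply/andP; split; apply/eqP; lra.
Qed.

Lemma null_mulr z x : null z -> null (z ** x).
Proof. by move=> /(null_mul x)[]. Qed.

Lemma null_mull z x : null z -> null (x ** z).
Proof. by move=> /(null_mul (adj x))[]; rewrite adjK. Qed.

(** Cauchy-Schwarz, with [z ** adj z] as one of the two diagonal factors. *)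
Lemma null_cstar z b : null (z ** adj z) -> null (z ** b) /\ null (b ** adj z).
Proof.
move=> z0; split=> w wp; apply/nc2_eq0/eqP; rewrite eq_le nc2_ge0 andbT.
  have := posfun_CauchySchwarz b (adj z) wp.
  by rewrite adjK z0//= mulr0.
have := posfun_CauchySchwarz (adj z) (adj b) wp.
by rewrite !adjK z0//= mul0r.
Qed.

Lemma null_sum_cstar z y : null (z ** adj z + adj y ** y) -> null (z ** adj z).
Proof.
move=> H w wp; case: (wp) => wb w0; have := H w wp; rewrite blD//.
have /lec0P[] := w0 y; have /lec0P[] := w0 (adj z); rewrite adjK.
move=> -> z0 -> y0 /eqP; rewrite -rmorphD; move/eqP => [E]; congr (_ +i* _).
by apply/eqP; rewrite eq_le z0 andbT; lra.
Qed.

Definition eqv a b := null (a - b).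

Lemma eqvP a b : eqv a b <-> forall w, posfun w -> w a = w b.
Proof.
split=> [H w wp|H w wp]; case: (wp) => wb _.
  by apply/eqP; rewrite -subr_eq0 -blB// H.
by rewrite blB// H// subrr.
Qed.

Lemma eqv_refl a : eqv a a. Proof. by rewrite /eqv subrr; exact: null0. Qed.

Lemma eqv_sym a b : eqv a b -> eqv b a.
Proof. by move/nullN; rewrite opprB. Qed.

Lemma eqv_trans b a c : eqv a b -> eqv b c -> eqv a c.
Proof. by move=> ab bc; have := nullD ab bc; rewrite addrA subrK. Qed.

Lemma eqv_mulr a b x : eqv a b -> eqv (a ** x) (b ** x).
Proof. by move=> /null_mulr => /(_ x); rewrite cmulBl. Qed.

Lemma eqv_mull a b x : eqv a b -> eqv (x ** a) (x ** b).
Proof. by move=> /null_mull => /(_ x); rewrite cmulBr. Qed.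

Lemma eqvD a b a' b' : eqv a b -> eqv a' b' -> eqv (a + a') (b + b').
Proof. by move=> H1 H2; rewrite /eqv opprD addrACA; exact: nullD. Qed.

Lemma eqvZ k a b : eqv a b -> eqv (k *: a) (k *: b).
Proof. by move=> H; rewrite /eqv -scalerBr; exact: nullZ. Qed.

Lemma closed_nrm (B : set T) :
  (forall a, (forall e : R, 0 < e -> exists2 b, B b & nrm (a - b) <= e) -> B a) ->
  closed B.
Proof.
move=> H a aB; apply: H => e e0.
have e0' : 0 < e%:C by rewrite ltcR.
have [b [Bb]] := aB _ (nbhsx_ballx a _ e0').
by rewrite -ball_normE/= nrmE ltcR => /ltW; exists b.
Qed.

(** Only differences have to be respected, so that conditions on [adj a], which are conjugate-linear
    in [a], are covered. *)
Lemma closed_zeros (J : Type) (P : J -> Prop) (f : J -> T -> R[i]) :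
  (forall j, P j -> forall a b, f j (a - b) = f j a - f j b) ->
  (forall j, P j -> exists C : R, 0 <= C /\ forall a, cmod (f j a) <= C * nrm a) ->
  closed [set a | forall j, P j -> f j a = 0].
Proof.
move=> fB fC; apply: closed_nrm => a aP j Pj; have [C [C0 CP]] := fC j Pj.
apply: cmod_le_eps => e e0; have C1 : 0 < C + 1 by rewrite ltr_wpDl.
have [b /(_ j Pj) bP ab] := aP (e / (C + 1)) (divr_gt0 e0 C1).
rewrite -[f j a]subr0 -bP -fB// (le_trans (CP _))//.
by rewrite -[leRHS](divfK (lt0r_neq0 C1)) mulrC ler_pM ?nrm_ge0// lerDl ler01.
Qed.

Lemma state_le w a : state w -> cmod (w a) <= nrm a.
Proof.
move=> [wl w0 wsup].
have wZ k b : w (k *: b) = k * w b.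
  have w00 : w 0 = 0.
    have := wl 1 0 0; rewrite scaler0 addr0 mul1r => /eqP.
    by rewrite -subr_eq0 opprD addNKr oppr_eq0 => /eqP.
  by rewrite -[k *: b]addr0 wl w00 addr0.
have H b : nrm b <= 1 -> cmod (w b) <= 1.
  move=> b1; rewrite -lee_fin -wsup; apply: ereal_sup_ubound.
  exists b; first by rewrite /= nrmE -(rmorph1 (real_complex R)) lecR.
  by rewrite cmodE.
have [a0|a0] := eqVneq (nrm a) 0.
  by rewrite (nrm_eq0 a0) -(scale0r (0 : T)) wZ mul0r cmod0 nrm_ge0.
have {}a0 : 0 < nrm a by rewrite lt_def a0 nrm_ge0.
have := H ((nrm a)^-1%:C *: a).
rewrite wZ nrmZ cmodM !cmodR ger0_norm ?invr_ge0 ?(ltW a0)//.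
by rewrite mulVf ?gt_eqF// => /(_ (lexx _)); rewrite ler_pdivrMl// mulr1.
Qed.

Lemma state_posfun w : state w -> posfun w.
Proof.
move=> ws; case: (ws) => wl w0 _; split => //; split => //.
by exists 1; split => // a; rewrite mul1r; exact: state_le.
Qed.

End PositiveFunctionals.

(** * Path elements and their relations modulo null elements *)

Section PathElements.
Variables (R : realType) (E : fin_digraph) (T : cstarAlgType R).
Variables (p : vertex E -> T) (s : edge E -> T).
Hypothesis hT : tck_family p s.
Local Notation elt := (path_elt p s).
Implicit Types (mu nu : gpath E).

Lemma p_adj v : adj (p v) = p v. Proof. by case: hT => /(_ v)[]. Qed.
Lemma p_idem v : p v ** p v = p v. Proof. by case: hT => /(_ v)[]. Qed.
Lemma p_orth v w : v != w -> p v ** p w = 0. Proof. by case: hT => _ + _ _ _; apply. Qed.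
Lemma s_star_s e : adj (s e) ** s e = p (src e). Proof. by case: hT. Qed.

Lemma p_mul v w : p v ** p w = if v == w then p v else 0.
Proof. by case: eqVneq => [<-|vw]; [exact: p_idem|exact: p_orth]. Qed.

Lemma s_p e : s e ** p (src e) = s e.
Proof. by rewrite -s_star_s cmulA; case: hT. Qed.

Lemma p_s_adj e : p (src e) ** adj (s e) = adj (s e).
Proof. by rewrite -p_adj -adjM s_p. Qed.

Fact gvertex_subproof v : @is_path E (v, [::] : seq (edge E)).1 (v, [::] : seq (edge E)).2.
Proof. by []. Qed.
Definition gvertex v : gpath E := exist _ (v, [::]) (gvertex_subproof v).

Fact gcons_subproof e mu : path_rng mu = src e ->
  @is_path E (rng e, e :: (val mu).2).1 (rng e, e :: (val mu).2).2.
Proof. by move=> /= <-; rewrite eqxx; exact: (valP mu). Qed.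
Definition gcons e mu (h : path_rng mu = src e) : gpath E :=
  exist _ (rng e, e :: (val mu).2) (gcons_subproof h).

Fact is_path_rcons v l e : @is_path E v l -> last v [seq src f | f <- l] = rng e ->
  @is_path E v (rcons l e).
Proof.
elim: l v => [|f l IH] v /=; first by move=> _ ->; rewrite eqxx.
by move=> /andP[-> /IH]; apply.
Qed.
Fact grcons_subproof mu e : path_src mu = rng e ->
  @is_path E ((val mu).1, rcons (val mu).2 e).1 ((val mu).1, rcons (val mu).2 e).2.
Proof. by move=> h; apply: is_path_rcons h; exact: (valP mu). Qed.
Definition grcons mu e (h : path_src mu = rng e) : gpath E :=
  exist _ ((val mu).1, rcons (val mu).2 e) (grcons_subproof h).

Lemma path_rng_cons e mu (h : path_rng mu = src e) : path_rng (gcons h) = rng e.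
Proof. by []. Qed.

Lemma path_src_cons e mu (h : path_rng mu = src e) : path_src (gcons h) = path_src mu.
Proof. by rewrite /path_src/= -h. Qed.

Lemma path_len_cons e mu (h : path_rng mu = src e) :
  path_len (gcons h) = (path_len mu).+1.
Proof. by []. Qed.

Lemma path_src_rcons mu e (h : path_src mu = rng e) : path_src (grcons h) = src e.
Proof. by rewrite /path_src/= map_rcons last_rcons. Qed.

Lemma path_len_rcons mu e (h : path_src mu = rng e) :
  path_len (grcons h) = (path_len mu).+1.
Proof. by rewrite /path_len/= size_rcons. Qed.

Lemma gpath_eq mu nu : path_rng mu = path_rng nu -> (sval mu).2 = (sval nu).2 ->
  mu = nu.
Proof.
by case: mu nu => -[a b] h [[c d] k]; rewrite /path_rng/= => ac bd;
  apply: val_inj; rewrite /= ac bd.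
Qed.

Lemma gpath_cases mu : (exists v, mu = gvertex v) \/
  (exists e nu (h : path_rng nu = src e), mu = gcons h).
Proof.
case: mu => -[v [|e l]] h; first by left; exists v; apply: val_inj.
right; have := h; move=> /= /andP[/eqP ev lp].
exists e, (exist _ (src e, l) lp : gpath E), erefl; apply: val_inj => /=.
by rewrite ev.
Qed.

Lemma gpath_ind (P : gpath E -> Prop) : (forall v, P (gvertex v)) ->
  (forall e mu (h : path_rng mu = src e), P mu -> P (gcons h)) -> forall mu, P mu.
Proof.
move=> Pv Pc mu; have [n] := ubnP (path_len mu).
elim: n mu => // n IH mu; have [[v ->] _|[e [nu [h ->]]]] := gpath_cases mu => //.
by rewrite path_len_cons ltnS => hn; apply: Pc; exact: IH.
Qed.

Lemma elt_vertex v : elt (gvertex v) = p v. Proof. by []. Qed.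

Lemma elt_cons e mu (h : path_rng mu = src e) : elt (gcons h) = s e ** elt mu.
Proof.
rewrite /path_elt /=; case: mu h => -[v [|f l]] hmu /= h.
  by rewrite /path_rng/= in h; rewrite h s_p.
by elim/last_ind : l {hmu h} => [|l g IH]//=; rewrite !foldl_rcons IH cmulA.
Qed.

Lemma elt_src mu : elt mu ** p (path_src mu) = elt mu.
Proof.
elim/gpath_ind : mu => [v|e mu h IH]; first exact: p_idem.
by rewrite path_src_cons elt_cons -cmulA IH.
Qed.

(** For [mu] a vertex, [p v ** s e = s e] is available only modulo null elements; the second
    alternative keeps the statement an exact equality. *)
Lemma elt_rcons mu e (h : path_src mu = rng e) : elt (grcons h) = elt mu ** s e \/
  exists v, mu = gvertex v /\ elt (grcons h) = s e.
Proof.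
case: mu h => -[v [|f l]] hmu /= h; last by left; rewrite /path_elt/= foldl_rcons.
by right; exists v; split; first exact: val_inj.
Qed.

Lemma eqv_ps_both e : eqv (p (rng e) ** s e) (s e) /\
  eqv (adj (s e) ** p (rng e)) (adj (s e)).
Proof.
case: (hT) => _ _ _ _ /(_ (rng e) (finset.set1 e)) [f /set1P->//|c].
rewrite big_set1 => H; set q := p (rng e).
have qq : q ** q = q by exact: p_idem.
(* Formally z = (1 - q) s_e and y = c (1 - q). Since s_e s_e^* + c^* c = q, the sum z z^* + y^* y is
   (1 - q) q (1 - q) = 0, and positivity makes both summands null. *)
pose z := s e - q ** s e; pose y := c - c ** q.
have zy : null (z ** adj z + adj y ** y).
  move=> w [wb _]; rewrite /z /y !adjB !adjM !p_adj -/q.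
  rewrite !(cmulBl, cmulBr) !cmulA -!(cmulA q (adj c) c) -H.
  by rewrite -/q !(cmulBl, cmulBr) !cmulA !qq !(blB, blD)//; ring.
have zs : z ** p (src e) = z by rewrite /z cmulBl -cmulA s_p.
have sz : p (src e) ** adj z = adj z by rewrite -{2}zs adjM p_adj.
have N b := null_cstar b (null_sum_cstar zy).
split; apply: eqv_sym; rewrite /eqv.
  by rewrite -/z -zs; exact: (N _).1.
have -> : adj (s e) ** q = adj (q ** s e) by rewrite adjM p_adj.
by rewrite -adjB -/z -sz; exact: (N _).2.
Qed.

Lemma eqv_p_s e : eqv (p (rng e) ** s e) (s e).
Proof. by case: (eqv_ps_both e). Qed.

Lemma eqv_s_adj_p e : eqv (adj (s e) ** p (rng e)) (adj (s e)).
Proof. by case: (eqv_ps_both e). Qed.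

Lemma null_s_adj_s e f : e != f -> null (adj (s e) ** s f).
Proof.
move=> ef; have [ref|ref] := eqVneq (rng e) (rng f); last first.
  (* For different ranges, the two range projections inserted between the factors are orthogonal. *)
  have A := eqv_mulr (s f) (eqv_s_adj_p e).
  have B := eqv_mull (adj (s e) ** p (rng e)) (eqv_p_s f).
  have := eqv_trans (eqv_sym A) (eqv_sym B).
  by rewrite !cmulA -(cmulA (adj (s e)) (p _) (p _)) p_orth// cmul0r cmul0l /eqv subr0.
case: (hT) => _ _ _ _ /(_ (rng e) [set e; f]%SET) [g /set2P[]->//|c].
rewrite big_setU1/= ?inE// big_set1 => H.
set x := adj (s e) ** s f.
have xp : x ** p (src f) = x by rewrite /x -cmulA s_p.
(* Compressing p - s_e s_e^* - s_f s_f^* = c^* c by [s e] shows that x x^* plus a term of the form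
   y^* y equals s_e^* (p s_e - s_e), which is null. *)
rewrite -xp; apply: (null_cstar _ _).1; apply: (@null_sum_cstar _ _ _ (c ** s e)).
have -> : x ** adj x + adj (c ** s e) ** (c ** s e) =
    adj (s e) ** (p (rng e) ** s e) - adj (s e) ** s e.
  rewrite /x !adjM adjK !cmulA -[_ ** adj c ** c]cmulA -H.
  rewrite !(cmulBr, cmulBl, cmulDr, cmulDl) !cmulA opprD.
  have -> : adj (s e) ** s e ** adj (s e) ** s e = adj (s e) ** s e.
    by rewrite -!cmulA; congr (_ ** _); rewrite cmulA; case: hT.
  by rewrite addrCA; congr (_ + _); rewrite addrC subrK.
rewrite -cmulBr; apply: null_mull; exact: eqv_p_s.
Qed.

Lemma eqv_p_elt mu : eqv (p (path_rng mu) ** elt mu) (elt mu).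
Proof.
elim/gpath_ind : mu => [v|e mu h _]; first by rewrite elt_vertex p_idem; exact: eqv_refl.
by rewrite elt_cons path_rng_cons cmulA; apply: eqv_mulr; exact: eqv_p_s.
Qed.

Lemma eqv_p_mul_elt v mu :
  eqv (p v ** elt mu) (if v == path_rng mu then elt mu else 0).
Proof.
apply: eqv_trans (eqv_mull (p v) (eqv_sym (eqv_p_elt mu))) _.
rewrite cmulA p_mul; case: eqVneq => [->|_]; first exact: eqv_p_elt.
by rewrite cmul0l; exact: eqv_refl.
Qed.

(** Induction on the first edges: distinct ones are orthogonal up to a null element, equal ones
    leave [p (src e)], which the rest of the path absorbs. *)
Lemma eqv_elt_adj_elt mu nu : path_len mu = path_len nu ->
  eqv (adj (elt nu) ** elt mu) (if mu == nu then p (path_src mu) else 0).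
Proof.
elim/gpath_ind : mu nu => [v|e mu h IH] nu.
  case: (gpath_cases nu) => [[w ->] _|[f [nu' [h' ->]]]//].
  rewrite !elt_vertex p_adj p_mul (_ : (gvertex v == gvertex w) = (w == v)); last first.
    by rewrite eq_sym; apply/eqP/eqP => [[]|->].
  by case: eqVneq => [->|_]; exact: eqv_refl.
case: (gpath_cases nu) => [[w ->]//|[f [nu' [h' ->]]] [lE]].
rewrite !elt_cons adjM !cmulA -(cmulA _ (adj (s f))) path_src_cons.
have [fe|ef] := eqVneq f e.
  subst f; rewrite s_star_s -cmulA.
  have H : eqv (p (src e) ** elt mu) (elt mu) by rewrite -h; exact: eqv_p_elt.
  apply: eqv_trans (eqv_mull _ H) _.
  apply: eqv_trans (IH _ lE) _.
  suff -> : (gcons h == gcons h') = (mu == nu') by exact: eqv_refl.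
  apply/eqP/eqP => [[E1]|E1]; last by subst nu'; apply: val_inj.
  by apply: gpath_eq => //; rewrite h h'.
have -> : (gcons h == gcons h') = false.
  by apply/eqP => -[_ E1 _]; rewrite E1 eqxx in ef.
have := null_mulr (elt mu) (null_mull (adj (elt nu')) (null_s_adj_s ef)).
by rewrite /eqv subr0.
Qed.

End PathElements.

(** * The unit and uniqueness of functionals on the generated algebra *)

Section Generation.
Variables (R : realType) (E : fin_digraph) (T : cstarAlgType R).
Variables (p : vertex E -> T) (s : edge E -> T).
Hypothesis hT : tck_family p s.
Hypothesis gen : forall B : set T, cstar_subalg B ->
  (forall v, B (p v)) -> (forall e, B (s e)) -> B = setT.
Local Notation elt := (path_elt p s).
Implicit Types (mu nu : gpath E) (a b : T).

(** The unit of the algebra, up to null elements; it exists because the vertex set is finite. *)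
Definition vsum : T := \sum_v p v.

Lemma vsum_p v : vsum ** p v = p v.
Proof.
rewrite /vsum (bigD1 v)//= cmulDl (p_idem hT)// (_ : _ ** _ = 0) ?addr0//.
elim/big_rec : _ => [|w x wv IH]; first by rewrite cmul0l.
by rewrite cmulDl IH (p_orth hT)// addr0.
Qed.

Lemma vsum_adj : adj vsum = vsum.
Proof.
rewrite /vsum; elim/big_rec : _ => [|v x _ IH]; first by rewrite adj0.
by rewrite adjD IH (p_adj hT).
Qed.

Lemma p_vsum v : p v ** vsum = p v.
Proof. by rewrite -vsum_adj -((p_adj hT)) -adjM vsum_p. Qed.

Lemma vsum_idem : vsum ** vsum = vsum.
Proof.
rewrite {2}/vsum; under [RHS]eq_bigr do rewrite -vsum_p.
elim/big_rec2 : _ => [|v x y _ IH]; first by rewrite cmul0r.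
by rewrite cmulDr IH.
Qed.

Lemma nrm_vsum_le : nrm vsum <= 1.
Proof.
have := nrm_cstar vsum; rewrite vsum_adj vsum_idem expr2 => H.
have [->|n0] := eqVneq (nrm vsum) 0; first exact: ler01.
by rewrite -[leLHS](mulKf n0) -H mulVf.
Qed.

(* The four conditions are closed under the involution, which need not
   preserve null elements a priori. *)
Lemma vsum_unit a : [/\ eqv (a ** vsum) a, eqv (vsum ** a) a,
  eqv (adj a ** vsum) (adj a) & eqv (vsum ** adj a) (adj a)].
Proof.
(* The four conditions as zeros of functions indexed by [j] and [w], the form in which
   [closed_zeros] applies. *)
pose f (j : 'I_4) (w : T -> R[i]) (a : T) :=
  w (nth 0 [:: a ** vsum - a; vsum ** a - a; adj a ** vsum - adj a;
    vsum ** adj a - adj a] j).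
pose B := [set a | forall j : 'I_4 * (T -> R[i]), posfun j.2 -> f j.1 j.2 a = 0].
have BE a' : B a' <-> [/\ eqv (a' ** vsum) a', eqv (vsum ** a') a',
    eqv (adj a' ** vsum) (adj a') & eqv (vsum ** adj a') (adj a')].
  split=> [H|[H1 H2 H3 H4] [[j jlt] w] /= wp].
    split=> w wp; [have := H (@Ordinal 4 0 isT, w) wp | have := H (@Ordinal 4 1 isT, w) wp |
      have := H (@Ordinal 4 2 isT, w) wp | have := H (@Ordinal 4 3 isT, w) wp]; exact.
  by rewrite /f; case: j jlt => [|[|[|[|]]]]//= _; [exact: H1|exact: H2|exact: H3|exact: H4].
suff BT : B = setT by apply/BE; rewrite BT.
apply: gen; last 2 first.
- move=> v; apply/BE; rewrite (p_adj hT)// p_vsum vsum_p; split; exact: eqv_refl.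
- move=> e; apply/BE; split.
  + by rewrite -((s_p hT) e) -cmulA p_vsum; exact: eqv_refl.
  + apply: (eqv_trans (eqv_mull vsum (eqv_sym ((eqv_p_s hT) e)))).
    by rewrite cmulA vsum_p; exact: (eqv_p_s hT).
  + apply: (eqv_trans (eqv_mulr vsum (eqv_sym ((eqv_s_adj_p hT) e)))).
    by rewrite -cmulA p_vsum; exact: (eqv_s_adj_p hT).
  + by rewrite -((p_s_adj hT) e) cmulA vsum_p; exact: eqv_refl.
split.
- apply: closed_zeros => -[j w] [/= wb _].
    move=> x y; rewrite /f -blB//; congr w.
    case: j => [[|[|[|[|]]]]]//= _; rewrite ?adjB !(cmulBl, cmulBr) !opprB addrACA [RHS]addrACA;
      by congr (_ + _); rewrite addrC.
  have [_ [C [C0 wC]]] := wb.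
  exists (C * (nrm vsum + 1)); split; first by rewrite mulr_ge0// addr_ge0// nrm_ge0.
  move=> x; rewrite /f (le_trans (wC _))// -mulrA ler_wpM2l//.
  have K (y z : T) : nrm y <= nrm vsum * nrm x -> nrm z <= nrm x ->
      nrm (y - z) <= (nrm vsum + 1) * nrm x.
    by move=> h1 h2; rewrite (le_trans (nrmD _ _))// nrmN mulrDl mul1r lerD.
  case: j => [[|[|[|[|]]]]]//= _; apply: K; rewrite ?nrm_adj//.
  + by rewrite mulrC nrmM.
  + exact: nrmM.
  + by rewrite mulrC -(nrm_adj x) nrmM.
  + by rewrite -(nrm_adj x) nrmM.
- by apply/BE; rewrite adj0 cmul0l cmul0r; split; exact: eqv_refl.
- move=> k x y /BE[x1 x2 x3 x4] /BE[y1 y2 y3 y4]; apply/BE.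
  rewrite adjD Defs.adjZ !(cmulDl, cmulDr, cmulZl, cmulZr).
  by split; apply: eqvD => //; exact: eqvZ.
- move=> x y /BE[x1 x2 x3 x4] /BE[y1 y2 y3 y4]; apply/BE; rewrite adjM; split.
  + by rewrite -cmulA; exact: eqv_mull.
  + by rewrite cmulA; exact: eqv_mulr.
  + by rewrite -cmulA; exact: eqv_mull.
  + by rewrite cmulA; exact: eqv_mulr.
- by move=> x /BE[x1 x2 x3 x4]; apply/BE; rewrite adjK.
Qed.

Definition span_null (L : T -> R[i]) : Prop :=
  [/\ bounded_linear L, forall z, null z -> L z = 0
    & forall mu nu, L (elt mu ** adj (elt nu)) = 0].

Lemma eqv_s_elt e mu : eqv (s e ** elt mu) 0 \/
  exists nu, s e ** elt mu = elt nu.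
Proof.
have [h|h] := eqVneq (path_rng mu) (src e).
  by right; exists (gcons h); rewrite (elt_cons hT).
left; apply: (eqv_trans (eqv_mull _ (eqv_sym ((eqv_p_elt hT) mu)))).
rewrite -((s_p hT) e) -cmulA (cmulA (p _)) (p_orth hT) ?cmul0l ?cmul0r// 1?eq_sym//.
exact: eqv_refl.
Qed.

(** If [mu] has an edge, its first edge either cancels against [e] or is orthogonal to it. If [mu]
    is a vertex, [e] moves to the other factor and lengthens [nu] at its end. *)
Lemma eqv_s_adj_elt e mu nu : exists mu' nu',
  eqv (adj (s e) ** (elt mu ** adj (elt nu))) 0 \/
  eqv (adj (s e) ** (elt mu ** adj (elt nu))) (elt mu' ** adj (elt nu')).
Proof.
have [[v ->]|[f [mu' [h ->]]]] := gpath_cases mu.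
  rewrite elt_vertex.
  have [nv|nv] := eqVneq v (path_src nu); last first.
    exists mu, nu; left; rewrite -((elt_src hT) nu) adjM (p_adj hT)//.
    by rewrite (cmulA (p v)) (p_orth hT)// cmul0l cmul0r; exact: eqv_refl.
  have -> : p v ** adj (elt nu) = adj (elt nu).
    by rewrite nv -{2}((elt_src hT) nu) adjM (p_adj hT).
  have [ev|ev] := eqVneq (path_src nu) (rng e); last first.
    exists mu, nu; left; apply: (eqv_trans (eqv_mulr _ (eqv_sym ((eqv_s_adj_p hT) e)))).
    rewrite -((elt_src hT) nu) adjM (p_adj hT)// cmulA -(cmulA _ (p _) (p _)).
    by rewrite (p_orth hT) 1?eq_sym// cmul0r cmul0l; exact: eqv_refl.
  exists (gvertex (src e)), (grcons ev); right.
  rewrite elt_vertex -adjM.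
  have [->|[w [nE ->]]] := elt_rcons p s ev.
    rewrite [X in eqv _ X](_ : _ = adj (elt nu ** s e)); first exact: eqv_refl.
    by rewrite adjM cmulA (p_s_adj hT).
  have we : w = rng e by rewrite -ev nE.
  by rewrite (p_s_adj hT) nE elt_vertex adjM (p_adj hT) we; exact: (eqv_s_adj_p hT).
exists mu', nu; rewrite (elt_cons hT)// cmulA cmulA.
have [ef|ef] := eqVneq e f; last first.
  left; rewrite /eqv subr0.
  by apply: null_mulr; apply: null_mulr; exact: (null_s_adj_s hT).
right; subst f; rewrite (s_star_s hT)// -h; apply: eqv_mulr; exact: (eqv_p_elt hT).
Qed.

(** The set [B] quantifies over all functionals of this kind, and this makes it closed under
    products: for x in [B], the functional L' (x .) is again of this kind. Intersecting with [B']
    gives stability under adjoints. *)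
Lemma span_null_mull (L : T -> R[i]) x : span_null L ->
  span_null (fun a => L (x ** a)).
Proof.
pose B := [set x | forall j : (T -> R[i]) * (gpath E * gpath E), span_null j.1 ->
  j.1 (x ** (elt j.2.1 ** adj (elt j.2.2))) = 0].
pose B' := [set x | forall j : (T -> R[i]) * (gpath E * gpath E), span_null j.1 ->
  j.1 (adj x ** (elt j.2.1 ** adj (elt j.2.2))) = 0].
have BP (L' : T -> R[i]) x' : B x' -> span_null L' -> span_null (fun a => L' (x' ** a)).
  move=> Bx' sL; case: (sL) => L1 L2 L3; split.
  - exact: bl_mull.
  - by move=> z /(null_mull x') /L2.
  - by move=> mu nu; exact: (Bx' (L', (mu, nu)) sL).
suff BT : B `&` B' = setT.
  by have [Bx _] : (B `&` B') x; [rewrite BT|exact: BP].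
apply: gen.
- split.
  + apply: closedI; apply: closed_zeros => -[L' [mu nu]] [/= L1 _ _].
    * by move=> a b; rewrite cmulBl blB.
    * have [_ HC] := bl_mulr (elt mu ** adj (elt nu)) L1; exact: HC.
    * by move=> a b; rewrite adjB cmulBl blB.
    * have [_ [C [C0 HC]]] := bl_mulr (elt mu ** adj (elt nu)) L1.
      by exists C; split => // a; rewrite -(nrm_adj a).
  + by split=> -[L' [mu nu]] [/= L1 _ _]; rewrite ?adj0 cmul0l bl0.
  + move=> k a b [Ba Ba'] [Bb Bb']; split=> -[L' [mu nu]] sL; case: (sL) => /= L1 _ _.
      rewrite cmulDl cmulZl blD// blZ//.
      by have /= -> := Ba _ sL; have /= -> := Bb _ sL; rewrite mulr0 addr0.
    rewrite adjD Defs.adjZ cmulDl cmulZl blD// blZ//.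
    by have /= -> := Ba' _ sL; have /= -> := Bb' _ sL; rewrite mulr0 addr0.
  + move=> a b [Ba Ba'] [Bb Bb']; split=> -[L' [mu nu]] sL /=.
      by rewrite -cmulA; exact: (Bb (fun z => L' (a ** z), (mu, nu)) (BP _ _ Ba sL)).
    rewrite adjM -cmulA.
    by apply: (Ba' (fun z => L' (adj b ** z), (mu, nu))); apply: BP.
  + by move=> a [Ba Ba']; split=> // j; rewrite adjK; exact: Ba.
- move=> v; suff Bv : B (p v) by split => // j; rewrite (p_adj hT)//; exact: Bv.
  move=> [L' [mu nu]] [/= L1 L2 L3]; rewrite cmulA.
  have := L2 _ (eqv_mulr (adj (elt nu)) ((eqv_p_mul_elt hT) v mu)).
  rewrite blB// => /eqP; rewrite subr_eq0 => /eqP ->.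
  by case: ifP => _; rewrite ?L3// cmul0l bl0.
- move=> e; split=> -[L' [mu nu]] [/= L1 L2 L3].
    rewrite cmulA; have [H|[nu' ->//]] := eqv_s_elt e mu.
    have := L2 _ (eqv_mulr (adj (elt nu)) H).
    by rewrite blB// cmul0l bl0// subr0.
  have [mu' [nu' [H|H]]] := eqv_s_adj_elt e mu nu.
    by have := L2 _ H; rewrite subr0.
  by have := L2 _ H; rewrite blB// L3 subr0.
Qed.

(** Since [vsum] acts as a unit, L a is the sum of the L (a p_v), and [p v] is itself a spanning
    element, with both paths equal to the vertex [v]. *)
Lemma span_null_eq0 (L : T -> R[i]) a : span_null L -> L a = 0.
Proof.
move=> sL; case: (sL) => L1 L2 _; have [H _ _ _] := vsum_unit a.
have := L2 _ H; rewrite blB// => /eqP; rewrite subr_eq0 => /eqP <-.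
rewrite (_ : a ** vsum = \sum_v a ** p v); last first.
  rewrite /vsum; elim/big_rec2 : _ => [|v x y _ <-]; first by rewrite cmul0r.
  by rewrite cmulDr.
rewrite bl_sum// big1// => v _.
have [_ _ H3] := span_null_mull a sL.
by have := H3 (gvertex v) (gvertex v); rewrite elt_vertex (p_adj hT)// (p_idem hT).
Qed.

Lemma posfun_unique (w w' : T -> R[i]) : posfun w -> posfun w' ->
  (forall mu nu, w (elt mu ** adj (elt nu)) = w' (elt mu ** adj (elt nu))) -> w = w'.
Proof.
move=> wp wp' H; apply/funext => a; apply/eqP; rewrite -subr_eq0; apply/eqP.
case: (wp) (wp') => wb _ [wb' _].
have D b : w b - w' b = 1 * w b + (-1) * w' b by rewrite mul1r mulN1r.
rewrite D; apply: (@span_null_eq0 (fun b => 1 * w b + (-1) * w' b)); split.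
- exact: bl_comb.
- by move=> z z0; rewrite !z0// !mulr0 addr0.
- by move=> mu nu; rewrite -D H subrr.
Qed.

(** A positive functional attains its norm at the unit: by Cauchy-Schwarz, |w a|^2 <= w (a^* a) w
    (vsum) <= w (vsum) on the unit ball, and the supremum is 1. *)
Lemma state_vsum (w : T -> R[i]) : state w -> w vsum = 1.
Proof.
move=> ws; have wp := state_posfun ws; case: (wp) => wb w0.
have q0 : 0 <= w vsum by have := w0 vsum; rewrite vsum_adj vsum_idem.
have [qE qR] := (lec0P _).1 q0.
have le1 : complex.Re (w vsum) <= 1.
  have := le_trans (state_le vsum ws) nrm_vsum_le.
  by rewrite qE cmodR ger0_norm.
rewrite qE; congr _%:C; apply/eqP; rewrite eq_le le1/=.
suff : 1 <= Num.sqrt (complex.Re (w vsum)).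
  by rewrite -{1}(@sqrtr1 R) ler_psqrt ?nnegrE.
case: (ws) => _ _ wsup; rewrite -lee_fin -wsup.
apply: ge_ereal_sup => _ [a a1 <-].
rewrite cmodE lee_fin.
have n1 : nrm a <= 1 by rewrite -lecR -nrmE.
have [_ H _ _] := vsum_unit a.
have := H w wp; rewrite blB// => /eqP; rewrite subr_eq0 => /eqP <-.
rewrite ler_wsqrtr//.
have := posfun_CauchySchwarz a vsum wp; rewrite vsum_adj vsum_idem.
move/le_trans; apply; rewrite ler_piMl//.
have [aE aR] := (lec0P _).1 (w0 a).
have := state_le (adj a ** a) ws; rewrite {1}aE cmodR ger0_norm// nrm_cstar.
by move/le_trans; apply; rewrite expr_le1 ?nrm_ge0.
Qed.

End Generation.

(** * Values of a KMS state on the spanning elements *)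

Section KMSFormula.
Variables (R : realType) (E : fin_digraph) (T : cstarAlgType R).
Variables (p : vertex E -> T) (s : edge E -> T) (gamma : R[i] -> T -> T) (beta : R).
Hypothesis hT : tck_family p s.
Hypothesis gen : forall B : set T, cstar_subalg B ->
  (forall v, B (p v)) -> (forall e, B (s e)) -> B = setT.
Hypothesis hgamma : gauge_action p s gamma.
Local Notation elt := (path_elt p s).
Implicit Types (mu nu : gpath E) (a b : T).

Lemma expc_0 : expc (0 : R[i]) = 1.
Proof. by rewrite -(rmorph0 (real_complex R)) expcR expR0. Qed.

Lemma expcN (z : R[i]) : expc (- z) = (expc z)^-1.
Proof.
have := expcD z (- z); rewrite subrr expc_0 => /esym H.
have z0 : expc z != 0 by apply: contra_eq_neq H => ->; rewrite mul0r eq_sym oner_eq0.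
by apply: (mulfI z0); rewrite H mulfV.
Qed.

Lemma expc_natz (n : nat) (z : R[i]) : expc (n%:R * z) = expc z ^+ n.
Proof.
by elim: n => [|n IH]; rewrite ?mul0r ?expc_0 ?expr0// -natr1 mulrDl expcD IH mul1r exprSr.
Qed.

Lemma expc_intz (k : int) (z : R[i]) : expc (k%:~R * z) = expc z ^ k.
Proof.
case: k => n; first exact: expc_natz.
by rewrite NegzE mulrNz mulNr expcN expc_natz -exprnN.
Qed.

Lemma expc_imag (t : R) : expc ('i%C * t%:C) = cos t +i* sin t.
Proof.
rewrite /expc /=; have -> : 0 * t - 1 * 0 = 0 :> R by ring.
have -> : 0 * 0 + 1 * t = t :> R by ring.
by rewrite expR0 !mul1r.
Qed.

Lemma cmod_cos_sin (t : R) : `|cos t +i* sin t| = 1 :> R[i].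
Proof. by rewrite cmodE /cmod /nc2/= cos2Dsin2 sqrtr1. Qed.

Definition degree mu nu : int := (path_len mu)%:Z - (path_len nu)%:Z.

Definition span_ext mu nu (z : R[i]) : T :=
  expc ('i%C * (degree mu nu)%:~R * z) *: (elt mu ** adj (elt nu)).

Lemma gauge_span t mu nu : gauge_dynamics gamma t (elt mu ** adj (elt nu)) =
  expc ((degree mu nu)%:~R * ('i%C * t%:C)) *: (elt mu ** adj (elt nu)).
Proof.
case: hgamma => _ _ H; rewrite /gauge_dynamics H ?cmod_cos_sin//.
by rewrite expc_intz expc_imag.
Qed.

Lemma span_extP mu nu :
  analytic_ext (gauge_dynamics gamma) (elt mu ** adj (elt nu)) (span_ext mu nu).
Proof.
split; first exact: entire_expc.
move=> t; rewrite gauge_span /span_ext; congr (expc _ *: _).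
by rewrite -mulrA mulrCA.
Qed.

(** One formula for both clauses of [kms_state]: at [beta = 0] the factor is 1 and the trace
    property is what remains. *)
Lemma kms_span phi mu nu mu' nu' : kms_state (gauge_dynamics gamma) beta phi ->
  phi ((elt mu ** adj (elt nu)) ** (elt mu' ** adj (elt nu'))) =
  (expR (- beta * (degree mu nu)%:~R))%:C *
  phi ((elt mu' ** adj (elt nu')) ** (elt mu ** adj (elt nu))).
Proof.
move=> [ps]; have [pb _] := state_posfun ps.
case: eqVneq => [-> [_ ->]|b0 H]; first by rewrite oppr0 mul0r expR0 mul1r.
rewrite (H _ _ _ _ (span_extP mu nu) (span_extP mu' nu')) /span_ext cmulZr blZ//.
congr (_ * _); rewrite -expcR; congr expc.
rewrite (_ : (degree mu nu)%:~R = ((degree mu nu)%:~R : R)%:C); last by rewrite rmorph_int.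
by apply/eqP; rewrite eq_complex/=; apply/andP; split; apply/eqP; ring.
Qed.

(** Brings s_mu into the shape of a spanning element, to which [kms_span] applies. *)
Lemma elt_vertexE mu : elt mu = elt mu ** adj (elt (gvertex (path_src mu))).
Proof. by rewrite elt_vertex (p_adj hT) (elt_src hT). Qed.

Lemma adj_elt_vertexE mu : adj (elt mu) = elt (gvertex (path_src mu)) ** adj (elt mu).
Proof. by rewrite elt_vertex -(p_adj hT) -adjM (elt_src hT). Qed.

Lemma kms_formula phi mu nu : kms_state (gauge_dynamics gamma) beta phi ->
  phi (elt mu ** adj (elt nu)) = if mu == nu
    then (expR (- beta * (path_len mu)%:R))%:C * phi (p (path_src mu)) else 0.
Proof.
move=> kms; case: (kms) => ps K; have wp := state_posfun ps.
have [pb _] := wp.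
(* Moving s_mu around s_nu^* costs x^|mu|; for equal lengths s_nu^* s_mu is a vertex projection or
   null. *)
have E1 : phi (elt mu ** adj (elt nu)) =
    (expR (- beta * (path_len mu)%:R))%:C * phi (adj (elt nu) ** elt mu).
  have := kms_span mu (gvertex (path_src mu)) (gvertex (path_src nu)) nu kms.
  by rewrite -!elt_vertexE -!adj_elt_vertexE /degree/= subr0.
have [lE|lN] := eqVneq (path_len mu) (path_len nu).
  have := (eqvP _ _).1 (eqv_elt_adj_elt hT lE) _ wp.
  rewrite E1 => ->; case: ifP => //; rewrite bl0// mulr0//.
have -> : (mu == nu) = false by apply: contra_neqF lN => /eqP->.
have [b0|b0] := eqVneq beta 0.
  move: K; rewrite b0 eqxx => -[inv _].
  have k0 : (degree mu nu)%:~R != 0 :> R.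
    by rewrite intr_eq0 subr_eq0; apply: contra_neq lN => -[].
  (* At this time the dynamics multiplies the element by e^(i pi) = -1, so invariance forces the
     value 0. *)
  have := inv (pi / (degree mu nu)%:~R) (elt mu ** adj (elt nu)).
  rewrite gauge_span blZ//.
  set k := degree mu nu in k0 *.
  have -> : k%:~R * ('i%C * (pi / k%:~R)%:C) = 'i%C * (pi : R)%:C :> R[i].
    rewrite mulrCA; congr (_ * _).
    rewrite (_ : k%:~R = (k%:~R : R)%:C); last by rewrite rmorph_int.
    by rewrite -rmorphM mulrC divfK.
  rewrite expc_imag cospi sinpi.
  case: (phi _) => u v [U V]; apply/eqP; rewrite eq_complex/=.
  by apply/andP; split; apply/eqP; lra.
(* Moving s_nu^* back gives phi = e^(beta (|nu| - |mu|)) phi, whose factor differs from 1. *)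
have E2 : phi (adj (elt nu) ** elt mu) =
    (expR (beta * (path_len nu)%:R))%:C * phi (elt mu ** adj (elt nu)).
  have := kms_span (gvertex (path_src nu)) nu mu (gvertex (path_src mu)) kms.
  by rewrite -!elt_vertexE -!adj_elt_vertexE /degree/= sub0r mulrNz mulrNN.
move: E1; rewrite E2 mulrA -rmorphM -expRD => /eqP.
rewrite -subr_eq0 -{1}[phi _]mul1r -mulrBl mulf_eq0 => /orP[|/eqP//].
rewrite -(rmorph1 (real_complex R)) -rmorphB => /eqP[] /eqP.
rewrite subr_eq0 eq_sym -[eqbRHS]expR0 (inj_eq (@expR_inj R)) addrC mulNr -mulrBr mulf_eq0.
rewrite (negbTE b0)/=.
by rewrite subr_eq0 eqr_nat eq_sym (negbTE lN).
Qed.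

End KMSFormula.

(** * The vertex matrix and the path series *)

Section PowerSummability.
Variable R : realType.

Definition abs_bounded (u : nat -> R[i]) :=
  exists C : R, forall N, \sum_(0 <= k < N) cmod (u k) <= C.

(** Summing |u_(n+1)| <= |u_(n+1) - z u_n| + |z| |u_n| gives (1 - |z|) S <= |u_0| + C for the
    partial sums S. *)
Lemma abs_bounded_recurrence (z : R[i]) (u : nat -> R[i]) : cmod z < 1 ->
  abs_bounded (fun n => u n.+1 - z * u n) -> abs_bounded u.
Proof.
move=> z1 [C CP]; exists ((cmod (u 0%N) + C) / (1 - cmod z)) => N.
rewrite ler_pdivlMr ?subr_gt0// mulrBr mulr1 lerBlDr.
have H : \sum_(0 <= k < N.+1) cmod (u k) <=
    cmod (u 0%N) + C + \sum_(0 <= k < N) cmod (u k) * cmod z.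
  rewrite big_nat_recl// -addrA lerD2l.
  apply: (le_trans _ (lerD (CP N) (lexx _))).
  rewrite -big_split/=; apply: ler_sum => k _.
  rewrite [_ * cmod z]mulrC -cmodM; apply: le_trans (cmodD _ _).
  by rewrite subrK.
rewrite mulr_suml; apply: le_trans H.
by rewrite big_nat_recr//= lerDl cmod_ge0.
Qed.

(* The matrix sequence [M^k q(M)] vanishes for [q] the characteristic polynomial;
   the linear factors of [q] are then removed one at a time. *)
Lemma mx_powers_summable n (M : 'M[R[i]]_n) :
  (forall z, eigenvalue M z -> cmod z < 1) ->
  forall i j, abs_bounded (fun k => (M ^+ k) i j).
Proof.
case: n M => [|n] M Mz i j; first by case: i.
have [rs] := closed_field_poly_normal (char_poly M).
rewrite (monicP (char_poly_monic M)) scale1r => rsE.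
have rs1 z : z \in rs -> cmod z < 1.
  by move=> zrs; apply: Mz; rewrite eigenvalue_root_char rsE root_prod_XsubC.
(* Replacing [q] by q (X - z) turns this sequence into u(k+1) - z u(k), the shape of
   [abs_bounded_recurrence]. *)
pose u (q : {poly R[i]}) k := (horner_mx M ('X^k * q)) i j.
suff H l : {subset l <= rs} -> forall q,
    abs_bounded (u (q * \prod_(z <- l) ('X - z%:P))) -> abs_bounded (u q).
  have [||C CP] := H rs _ 1; first by [].
    exists 0 => N; rewrite big1// => k _; rewrite /u mul1r -rsE rmorphM/=.
    by rewrite Cayley_Hamilton mulr0 mxE cmod0.
  exists C => N; apply: le_trans (CP N); apply: ler_sum => k _.
  by rewrite /u mulr1 rmorphXn/= horner_mx_X.
elim: l => [|z l IH] lrs q; first by rewrite big_nil mulr1.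
have lrs' : {subset l <= rs} by move=> y yl; apply: lrs; rewrite inE yl orbT.
rewrite big_cons mulrA => /(IH lrs')[C CP].
apply: (@abs_bounded_recurrence z); first by apply/rs1/lrs; rewrite inE eqxx.
exists C => N; apply: le_trans (CP N); apply: ler_sum => k _.
rewrite (_ : u q k.+1 - z * u q k = u (q * ('X - z%:P)) k)// /u.
have -> : 'X^k * (q * ('X - z%:P)) = 'X^(k.+1) * q - z *: ('X^k * q).
  by rewrite -mul_polyC exprSr; ring.
have -> (a b : {poly R[i]}) : horner_mx M (a - z *: b) = horner_mx M a - z *: horner_mx M b.
  by rewrite [LHS]rmorphB; congr (_ - _); exact: linearZ.
by rewrite mxE [X in _ = _ + X]mxE [X in _ = _ - X]mxE.
Qed.

(** Otherwise N e would stay below a fixed bound for all N. *)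
Lemma abs_bounded_small (I : finType) (u : I -> nat -> R) :
  (forall i k, 0 <= u i k) ->
  (forall i, exists C : R, forall N, \sum_(0 <= k < N) u i k <= C) ->
  forall e : R, 0 < e -> exists k, \sum_i u i k <= e.
Proof.
move=> u0 /choice[C CP] e e0; apply/not_existsP => H.
have {}H k : e <= \sum_i u i k by apply: ltW; rewrite ltNge; apply/negP; exact: H.
pose D := \sum_i C i.
have DP N : N%:R * e <= D.
  apply: (@le_trans _ _ (\sum_(0 <= k < N) \sum_i u i k)).
    apply: (@le_trans _ _ (\sum_(0 <= k < N) e)); last by apply: ler_sum.
    by rewrite big_const_nat subn0 iter_addr_0 mulr_natl.
  by rewrite exchange_big/=; apply: ler_sum => i _; exact: CP.
have := DP (Num.bound (D / e)); rewrite -ler_pdivlMr// leNgt.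
by rewrite archi_boundP// divr_ge0 ?(ltW e0)//; have := DP 0%N; rewrite mul0r.
Qed.

End PowerSummability.

(** * The resolvent below the spectral bound *)

Section SpectralRadius.
Variables (R : realType) (n : nat) (A : 'M[R]_n).
Local Notation Ac := (map_mx (real_complex R) A).

Lemma cmod_eigenvalue_le z : eigenvalue Ac z -> cmod z <= spectral_radius A.
Proof.
move=> zA; apply: ub_le_sup; last by exists z => //; rewrite cmodE.
(* The supremum is usable only for a bounded set; the sum of the moduli of all roots of the
   characteristic polynomial is an upper bound. *)
have [rs] := closed_field_poly_normal (char_poly Ac).
rewrite (monicP (char_poly_monic Ac)) scale1r => rsE.
exists (\sum_(w <- rs) cmod w) => _ [w wA <-]; rewrite cmodE.
have : w \in rs by move: wA; rewrite /= eigenvalue_root_char rsE root_prod_XsubC.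
move=> wrs; rewrite [leRHS](big_rem w)//= lerDl; apply: sumr_ge0 => *; exact: cmod_ge0.
Qed.

Variable beta : R.
Hypothesis hbeta : (lne (spectral_radius A)%:E < beta%:E)%E.
Let x := expR (- beta).
Let M := x *: A.

Lemma spectral_radius_lt : spectral_radius A < expR beta.
Proof.
(* Here the logarithm is -oo and the hypothesis on [beta] says nothing, but e^beta is positive. *)
have [r0|r0] := leP (spectral_radius A) 0; first by rewrite (le_lt_trans r0)// expR_gt0.
move: hbeta; rewrite lne_EFin// lte_fin => H.
by rewrite -(@lnK _ (spectral_radius A)) ?posrE// ltr_expR.
Qed.

Lemma eigenvalue_scaled_lt1 z : eigenvalue (map_mx (real_complex R) M) z -> cmod z < 1.
Proof.
move=> /eigenvalueP[v vM v0].
have x0 : 0 < x by exact: expR_gt0.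
have xc : x%:C != 0 :> R[i] by rewrite eq_complex/= negb_and (gt_eqF x0).
have : eigenvalue Ac (x%:C^-1 * z).
  apply/eigenvalueP; exists v => //.
  by rewrite -scalerA -vM map_mxZ -scalemxAr scalerA mulVf// scale1r.
move/cmod_eigenvalue_le; rewrite -fmorphV cmodM cmodR ger0_norm ?invr_ge0 ?(ltW x0)//.
rewrite ler_pdivrMl// => /le_lt_trans; apply.
rewrite -(@expR0 R) -(subrr beta) addrC expRD ltr_pM2l//.
exact: spectral_radius_lt.
Qed.

Lemma scaled_powers_summable i j : exists C : R, forall N,
  \sum_(0 <= k < N) `|(M ^+ k) i j| <= C.
Proof.
have [C CP] := mx_powers_summable eigenvalue_scaled_lt1 i j.
exists C => N; apply: le_trans (CP N); apply: ler_sum => k _.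
suff -> : (map_mx (real_complex R) M) ^+ k = map_mx (real_complex R) (M ^+ k).
  by rewrite mxE cmodR.
elim: k => [|k IH]; first by rewrite !expr0 map_mx1.
by rewrite !exprS IH; exact: (esym (map_mxM _ _ _)).
Qed.

Lemma one_minus_unitmx : (1%:M - M) \in unitmx.
Proof.
rewrite -(map_unitmx (real_complex R)) map_mxB map_mx1.
have : ~~ eigenvalue (map_mx (real_complex R) M) 1.
  apply/negP => /eigenvalue_scaled_lt1.
  by rewrite -(rmorph1 (real_complex R)) cmodR normr1 ltxx.
rewrite /eigenvalue negbK /eigenspace kermx_eq0 row_free_unit.
by rewrite -(opprB 1%:M) -scaleN1r unitmxZ// unitrN unitr1.
Qed.

(** No Neumann series: m = eps + M m with nonnegative [eps] and [M] gives M^k m <= m entrywise for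
    every k, and M^k m becomes arbitrarily small for suitable k. *)
Lemma resolvent_ge0 (eps : 'cV[R]_n) : (forall i j, 0 <= A i j) ->
  (forall i, 0 <= eps i 0) -> forall i, 0 <= (invmx (1%:M - M) *m eps) i 0.
Proof.
move=> A0 e0 i; set m := _ *m _.
have mE : m = eps + M *m m.
  have : (1%:M - M) *m m = eps by rewrite mulKVmx// one_minus_unitmx.
  by rewrite mulmxBl mul1mx => <-; rewrite subrK.
have M0 k a b : 0 <= (M ^+ k) a b.
  elim: k a b => [|k IH] a b; first by rewrite expr0 mxE ler0n.
  rewrite exprS [M * _]/(M *m _) mxE; apply: sumr_ge0 => c _; rewrite mulr_ge0//.
  by rewrite mxE mulr_ge0 ?A0// expR_ge0.
have me k : ((M ^+ k) *m m) i 0 <= m i 0.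
  elim: k => [|k IH]; first by rewrite expr0 mul1mx.
  apply: le_trans IH; rewrite (_ : M ^+ k.+1 *m m = M ^+ k *m (M *m m)); last first.
    by rewrite exprSr mulmxA.
  rewrite [in leRHS]mE mulmxDr [leRHS]mxE lerDr mxE.
  by apply: sumr_ge0 => c _; rewrite mulr_ge0.
rewrite -oppr_le0; apply/ler_addgt0Pr => d d0; rewrite add0r.
(* [S] dominates every |m_j|, so a power whose row [i] has absolute sum at most d / S satisfies
   |(M^k m)_i| <= d. *)
pose S := 1 + \sum_j `|m j 0|.
have S0 : 0 < S by rewrite ltr_pwDl// sumr_ge0.
have [k kP] := @abs_bounded_small R 'I_n (fun j k => `|(M ^+ k) i j|)
  (fun _ _ => normr_ge0 _) (scaled_powers_summable i) (d / S) (divr_gt0 d0 S0).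
rewrite (@le_trans _ _ (- ((M ^+ k) *m m) i 0))// ?lerN2 ?me//.
rewrite (le_trans (ler_norm _))// normrN mxE (le_trans (ler_norm_sum _ _ _))//.
apply: (@le_trans _ _ (\sum_j `|(M ^+ k) i j| * S)).
  apply: ler_sum => j _; rewrite normrM ler_wpM2l// /S (bigD1 j)//=.
  by rewrite addrCA lerDl addr_ge0// sumr_ge0.
by rewrite -mulr_suml -ler_pdivlMr.
Qed.

End SpectralRadius.

(** * The path series and the powers of the vertex matrix *)

Section PathSeries.
Variables (R : realType) (E : fin_digraph).
Implicit Types (mu nu : gpath E).

Lemma is_path_rconsP (v : vertex E) l e :
  is_path v (rcons l e) = is_path v l && (last v [seq src f | f <- l] == rng e).
Proof.
elim: l v => [|f l IH] v /=; first by rewrite andbT eq_sym.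
by rewrite IH andbA.
Qed.

Lemma gpath_rcases mu : (exists v, mu = gvertex v) \/
  (exists nu e (h : path_src nu = rng e), mu = grcons h).
Proof.
case: mu => -[v l] h; case/lastP : l h => [|l e] h.
  by left; exists v; apply: val_inj.
right; have := h; rewrite /= is_path_rconsP => /andP[hl /eqP he].
exists (exist _ (v, l) hl : gpath E), e, he; exact: val_inj.
Qed.

Definition last_edge mu : option (edge E) := ohead (rev (val mu).2).

Lemma last_edge_rcons mu e (h : path_src mu = rng e) : last_edge (grcons h) = Some e.
Proof. by rewrite /last_edge/= rev_rcons. Qed.

(** A total form of [grcons], usable as a reindexing map; the value at non-composable pairs is a
    placeholder. *)
Definition gsnoc (e : edge E) mu : gpath E :=
  match pselect (path_src mu = rng e) with
  | left h => grcons h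
  | right _ => mu
  end.

Lemma gsnocE (e : edge E) mu (h : path_src mu = rng e) : gsnoc e mu = grcons h.
Proof. by rewrite /gsnoc; case: pselect => // h'; congr grcons; exact: Prop_irrelevance. Qed.

Lemma grcons_inj mu nu e (h : path_src mu = rng e) (k : path_src nu = rng e) :
  grcons h = grcons k -> mu = nu.
Proof.
move=> /(congr1 val)/= [H1 /rcons_inj[H2]]; exact: gpath_eq.
Qed.

(** A general weight of the length covers both the full series and its truncations. *)
Definition len_sum (f : nat -> \bar R) (v : vertex E) : \bar R :=
  (\esum_(mu in [set mu : gpath E | path_src mu = v]) f (path_len mu))%E.

(** A path with source [v] is [v] itself or ends in a unique edge with source [v]; deleting that
    edge leaves a path with source its range and shifts the length by one. *)
Lemma len_sum_rec (f : nat -> \bar R) v : (forall n, (0 <= f n)%E) ->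
  len_sum f v = (f 0%N + \sum_(e | src e == v) len_sum (fun n => f n.+1) (rng e))%E.
Proof.
move=> f0; rewrite /len_sum; set A := [set mu | path_src mu = v].
rewrite (esumID [set mu | path_len mu = 0%N])//; congr (_ + _)%E.
  rewrite (_ : A `&` _ = [set gvertex v]) ?esum_set1//.
  apply/seteqP; split => [mu [/= Amu l0]|mu ->//].
  by have [[w wE]|[nu [e [h muE]]]] := gpath_rcases mu; move: Amu l0;
    [rewrite wE /A/= => <- | rewrite muE path_len_rcons].
set A' := A `&` _.
transitivity (\esum_(mu in A') \sum_(e | src e == v)
    (if mu \in [set mu | last_edge mu = Some e] then f (path_len mu) else 0))%E.
  apply: eq_esum => mu [/= Amu l0].
  have [[w wE]|[nu [e [h muE]]]] := gpath_rcases mu; first by rewrite wE in l0.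
  have ev : src e == v by rewrite -Amu muE path_src_rcons.
  rewrite (bigD1 e)//= mem_set/= ?muE ?last_edge_rcons//.
  rewrite big1 ?adde0// => e' /andP[_ ee']; rewrite memNset//= last_edge_rcons => -[ee].
  by rewrite ee eqxx in ee'.
rewrite esum_sum; last by move=> mu e _ _; case: ifP.
apply: eq_bigr => e /eqP ev; rewrite -esum_mkcondr.
rewrite (@reindex_esum _ _ _ [set mu | path_src mu = rng e] _ (gsnoc e)).
  by apply: eq_esum => mu /= h; rewrite (gsnocE h) path_len_rcons.
split.
- move=> mu /= h; rewrite (gsnocE h) last_edge_rcons; split => //; split => /=.
    by rewrite /A/= path_src_rcons.
  by rewrite path_len_rcons.
- move=> mu nu; rewrite !inE => h k; rewrite (gsnocE h) (gsnocE k).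
  exact: grcons_inj.
- move=> mu [[/= Amu l0] le].
  have [[w wE]|[nu [e' [h muE]]]] := gpath_rcases mu; first by rewrite wE in le.
  have ee : e' = e by move: le; rewrite muE last_edge_rcons => -[].
  by subst e'; exists nu => //; rewrite (gsnocE h).
Qed.

Variable beta : R.
Local Notation A := (adjacency R E).
Hypothesis hbeta : (lne (spectral_radius A)%:E < beta%:E)%E.
Let x := expR (- beta).
Let M := x *: A.

Lemma adjacency_ge0 i j : 0 <= A i j.
Proof. by rewrite mxE ler0n. Qed.

Lemma kms_mxE : kms_mx E beta = 1%:M - M. Proof. by []. Qed.

Lemma kms_mx_unit : kms_mx E beta \in unitmx.
Proof. exact: one_minus_unitmx. Qed.

Lemma kms_resolvent_ge0 eps : (forall v, 0 <= coef eps v) ->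
  forall v, 0 <= coef (invmx (kms_mx E beta) *m eps) v.
Proof.
move=> e0 v; apply: (resolvent_ge0 hbeta); first exact: adjacency_ge0.
by move=> i; have := e0 (enum_val i); rewrite /coef enum_valK.
Qed.

Lemma sum_edges_adjacency (g : vertex E -> R) v :
  \sum_(e | src e == v) g (rng e) =
  \sum_(i < #|vertex E|) g (enum_val i) * A i (enum_rank v).
Proof.
rewrite (partition_big (fun e => enum_rank (rng e)) xpredT)//=.
apply: eq_bigr => i _; rewrite mxE enum_rankK.
rewrite (eq_bigr (fun=> g (enum_val i))); last first.
  by move=> e /andP[_ /eqP <-]; rewrite enum_rankK.
rewrite big_const iter_addr_0 mulr_natr; congr (_ *+ _).
apply: eq_card => e; rewrite [LHS]unfold_in andbC -(can_eq enum_valK) enum_rankK.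
by apply/idP/idP; rewrite inE.
Qed.

Lemma expR_path_len n : expR (- beta * n%:R) = x ^+ n.
Proof. by rewrite mulrC expRM_natl. Qed.

(** Weights cut off at length [N]: the sums become finite and computable before the convergence of
    the full series is known. *)
Definition trunc N (n : nat) : \bar R := if (n < N)%N then (x ^+ n)%:E else 0%E.

Lemma trunc_ge0 N n : (0 <= trunc N n)%E.
Proof. by rewrite /trunc; case: ifP => // _; rewrite lee_fin exprn_ge0// expR_ge0. Qed.

Lemma len_sumZ (f : nat -> \bar R) v : (forall n, (0 <= f n)%E) ->
  len_sum (fun n => x%:E * f n)%E v = (x%:E * len_sum f v)%E.
Proof.
move=> f0; rewrite /len_sum; have x0 : 0 < x by exact: expR_gt0.
apply/eqP; rewrite eq_le; apply/andP; split.
  apply: ge_ereal_sup => _ [X [fX XA] <-].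
  rewrite fsbig_finite//= -ge0_sume_distrr// lee_wpmul2l ?lee_fin ?(ltW x0)//.
  by apply: ereal_sup_ubound; exists X => //; rewrite fsbig_finite.
rewrite -lee_pdivlMl//; apply: ge_ereal_sup => _ [X [fX XA] <-].
rewrite lee_pdivlMl// fsbig_finite//= ge0_sume_distrr//.
by apply: ereal_sup_ubound; exists X => //; rewrite fsbig_finite.
Qed.

(** The k-th inner sum is a column sum of [M^k], the weighted number of paths of length k with
    source [v]. The induction rests on the truncation at N+1, shifted by one edge, being x times the
    truncation at N. *)
Lemma len_sum_trunc N v : len_sum (trunc N) v =
  (\sum_(0 <= k < N) \sum_i (M ^+ k) i (enum_rank v))%:E.
Proof.
elim: N v => [|N IH] v.
  by rewrite big_geq// /len_sum esum1.
rewrite len_sum_rec; last exact: trunc_ge0.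
rewrite {1}/trunc/= expr0.
have -> : (fun n => trunc N.+1 n.+1) = (fun n => x%:E * trunc N n)%E.
  by apply/funext => n; rewrite /trunc ltnS; case: ifP; rewrite ?mule0// exprS EFinM.
rewrite (eq_bigr (fun e =>
    (x * \sum_(0 <= k < N) \sum_i (M ^+ k) i (enum_rank (rng e)))%:E)); last first.
  by move=> e _; rewrite len_sumZ ?IH ?EFinM// => n; exact: trunc_ge0.
rewrite sumEFin -EFinD; congr EFin.
rewrite (sum_edges_adjacency (fun u => x * \sum_(0 <= k < N) \sum_i (M ^+ k) i (enum_rank u))).
rewrite big_nat_recl//; congr (_ + _).
  under eq_bigr do rewrite expr0 mxE.
  by rewrite (bigD1 (enum_rank v))//= eqxx big1 ?addr0// => i /negbTE ->.
under [LHS]eq_bigr do rewrite enum_valK -mulrA mulrCA mulr_suml.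
rewrite exchange_big/=; apply: eq_bigr => k _.
under [RHS]eq_bigr do rewrite exprSr [M ^+ k * M]/(M ^+ k *m M) mxE.
rewrite [RHS]exchange_big/=; apply: eq_bigr => i _.
rewrite -mulr_suml; congr (_ * _).
by rewrite [RHS]mxE.
Qed.

(** The lengths in a finite set of paths are bounded, so its sum is at most a truncated series, and
    these have a common bound by summability of the matrix powers. *)
Lemma path_series_fin (v : vertex E) : path_series beta v \is a fin_num.
Proof.
have /choice[C CP] i := scaled_powers_summable hbeta i (enum_rank v).
rewrite ge0_fin_numE; last by apply: esum_ge0 => mu _; rewrite lee_fin expR_ge0.
apply: (@le_lt_trans _ _ (\sum_i C i)%:E); last by rewrite ltry.
apply: ge_ereal_sup => _ [X [fX XA] <-].
have [N NX] : exists N, forall mu, X mu -> (path_len mu < N)%N.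
  have [l lX] := (finite_seqP X).1 fX.
  exists (\max_(mu <- l) path_len mu).+1 => mu; rewrite lX /= ltnS => ml.
  exact: leq_bigmax_seq.
apply: (@le_trans _ _ (len_sum (trunc N) v)).
  apply: ereal_sup_ubound; exists X => //; apply: eq_fsbigr => mu /set_mem/NX muN.
  by rewrite /trunc muN expR_path_len.
rewrite len_sum_trunc lee_fin exchange_big/=; apply: ler_sum => i _.
apply: le_trans (CP i N); apply: ler_sum => k _; exact: ler_norm.
Qed.

Lemma path_series_rec (v : vertex E) : path_series beta v =
  (1 + \sum_(e | src e == v) x%:E * path_series beta (rng e))%E.
Proof.
have H f w : (forall n, f n = (x ^+ n)%:E) -> path_series beta w = len_sum f w.
  move=> fE; apply: eq_esum => mu _; rewrite fE expR_path_len//.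
rewrite (H (fun n => (x ^+ n)%:E))// len_sum_rec; last first.
  by move=> n; rewrite lee_fin exprn_ge0// expR_ge0.
rewrite expr0; congr (_ + _)%E; apply: eq_bigr => e _.
rewrite (H (fun n => (x ^+ n)%:E))// -len_sumZ; last first.
  by move=> n; rewrite lee_fin exprn_ge0// expR_ge0.
by congr len_sum; apply/funext => n; rewrite exprS EFinM.
Qed.

Lemma path_sum_rec (v : vertex E) :
  path_sum beta v = 1 + \sum_(i < #|vertex E|) path_sum beta (enum_val i) * M i (enum_rank v).
Proof.
rewrite -[RHS]/(fine (_)%:E); congr fine; rewrite path_series_rec.
rewrite (eq_bigr (fun e => (x * path_sum beta (rng e))%:E)); last first.
  by move=> e _; rewrite EFinM /path_sum fineK ?path_series_fin.
rewrite sumEFin -EFinD; congr (_ + _)%:E.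
rewrite (sum_edges_adjacency (fun u => x * path_sum beta u)).
by apply: eq_bigr => i _; rewrite [M _ _]mxE mulrA (mulrC x).
Qed.

Lemma path_sum_ge1 (v : vertex E) : 1 <= path_sum beta v.
Proof.
rewrite path_sum_rec lerDl; apply: sumr_ge0 => i _; rewrite mulr_ge0//.
  apply: fine_ge0; apply: esum_ge0 => mu _; rewrite lee_fin expR_ge0//.
by rewrite mxE mulr_ge0 ?expR_ge0 ?adjacency_ge0.
Qed.

Lemma sum_coefE (g : vertex E -> R) : \sum_v g v = \sum_(i < #|vertex E|) g (enum_val i).
Proof.
rewrite (reindex (@enum_val (vertex E) xpredT))//=.
exact: onW_bij (@enum_val_bij _).
Qed.

Lemma sum_resolvent eps : \sum_v coef (invmx (kms_mx E beta) *m eps) v =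
  \sum_v coef eps v * path_sum beta v.
Proof.
set m := _ *m eps; have <- : kms_mx E beta *m m = eps.
  by rewrite mulKVmx// kms_mx_unit.
rewrite !sum_coefE; under [RHS]eq_bigr do rewrite /coef enum_valK.
under [LHS]eq_bigr do rewrite /coef enum_valK.
rewrite kms_mxE mulmxBl mul1mx.
under [RHS]eq_bigr do rewrite mxE [X in _ + X]mxE [X in _ - X]mxE mulrBl.
rewrite sumrB; apply/eqP; rewrite eq_sym subr_eq; apply/eqP.
under [LHS]eq_bigr do rewrite path_sum_rec enum_valK mulrDr mulr1.
rewrite big_split/=; congr (_ + _).
under [LHS]eq_bigr do rewrite mulr_sumr.
rewrite exchange_big/=; apply: eq_bigr => i _.
rewrite mulr_suml; apply: eq_bigr => j _.
by rewrite mulrCA mulrC [m j 0 * _]mulrC.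
Qed.

End PathSeries.

(** * The path space representation *)

Section ConcreteOperators.
Variables (R : realType) (I : choiceType).
Local Notation H := (l2 R I).
Implicit Types f g : H.

Definition pbij (j k : I -> option I) := forall a b, j a = Some b <-> k b = Some a.

Lemma pbij_sym j k : pbij j k -> pbij k j.
Proof. by move=> jk a b; split=> /jk. Qed.

(** Pull-back along [j]; on basis vectors it therefore acts by the inverse [k], taking h_b to h_(k
    b), or to 0 where [k] is undefined. *)
Definition pact (j : I -> option I) (f : I -> R[i]) (i : I) : R[i] :=
  if j i is Some i' then f i' else 0.

Section PartialBijection.
Variables (j k : I -> option I) (jk : pbij j k).

Lemma pact_nnsum_le f : (nnsum (fun i => nc2 (pact j f i)) <= nnsum (fun i => nc2 (f i)))%E.
Proof.
rewrite (nnsum_reindex (g := fun b => if k b is Some _ then nc2 (f b) else 0) jk).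
- by apply: le_nnsum => b; case: (k b) => //; rewrite nc2_ge0.
- by move=> a ja; rewrite /pact ja nc20.
- by move=> b ->.
- by move=> a b ja; rewrite /pact ja (proj1 (jk a b) ja).
Qed.

Fact pact_subproof f : sq_summable (pact j f).
Proof. by apply: le_lt_trans (pact_nnsum_le f) _; exact: l2P. Qed.
Definition pl2 f : H := L2 (pact_subproof f).

Lemma l2n_pl2 f : l2n (pl2 f) <= 1 * l2n f.
Proof.
rewrite mul1r ler_wsqrtr// -lee_fin /l2n2 !fineK ?nnsum_fin ?l2P//;
  by [exact: pact_nnsum_le | move=> i; exact: nc2_ge0].
Qed.

End PartialBijection.

Fact pbop_subproof1 j k (jk : pbij j k) f g :
  ip (pl2 jk f) g = ip f (pl2 (pbij_sym jk) g).
Proof.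
apply: (csum_reindex jk) => [a ja|b kb|a b ja] /=; rewrite /pact.
- by rewrite ja mul0r.
- by rewrite kb conjc0 mulr0.
- by rewrite ja (proj1 (jk a b) ja).
Qed.

Fact pbop_subproof2 j k (jk : pbij j k) :
  exists M : R, 0 <= M /\ forall f, l2n (pl2 jk f) <= M * l2n f.
Proof. by exists 1; split => // f; exact: l2n_pl2. Qed.

Definition pbop j k (jk : pbij j k) : bop R I :=
  BOp (pbop_subproof1 jk) (pbop_subproof2 jk).
Arguments pbop : simpl never.

Lemma pbopE j k (jk : pbij j k) f i : pbop jk f i = pact j f i.
Proof. by []. Qed.

Lemma pbop_star j k (jk : pbij j k) : adj (pbop jk) = pbop (pbij_sym jk).
Proof. by apply: bop_ext. Qed.

Fact dmul_subproof (u : I -> R[i]) (u1 : forall i, nc2 (u i) <= 1) f :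
  sq_summable (fun i => u i * f i).
Proof.
apply: (@nnsum_finS _ _ _ (fun i => nc2 (f i))); last exact: l2P.
by move=> i; rewrite nc2_ge0/= nc2M ler_piMl ?nc2_ge0.
Qed.

Definition dl2 u (u1 : forall i, nc2 (u i) <= 1) f : H := L2 (dmul_subproof u1 f).

Fact nc2J_le (u : I -> R[i]) (u1 : forall i, nc2 (u i) <= 1) i : nc2 (conjc (u i)) <= 1.
Proof. by rewrite nc2J. Qed.

Fact dbop_subproof1 u (u1 : forall i, nc2 (u i) <= 1) f g :
  ip (dl2 u1 f) g = ip f (dl2 (nc2J_le u1) g).
Proof.
congr csum; apply/funext => i /=.
by rewrite rmorphM/= conjcK mulrCA mulrA.
Qed.

Fact dbop_subproof2 u (u1 : forall i, nc2 (u i) <= 1) :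
  exists M : R, 0 <= M /\ forall f, l2n (dl2 u1 f) <= M * l2n f.
Proof.
exists 1; split => // f.
rewrite mul1r ler_wsqrtr// -lee_fin /l2n2 !fineK ?nnsum_fin ?l2P//;
  try by move=> i; exact: nc2_ge0.
by apply: le_nnsum => i /=; rewrite nc2M ler_piMl ?nc2_ge0.
Qed.

Definition dbop u (u1 : forall i, nc2 (u i) <= 1) : bop R I :=
  BOp (dbop_subproof1 u1) (dbop_subproof2 u1).
Arguments dbop : simpl never.

Lemma dbopE u (u1 : forall i, nc2 (u i) <= 1) f i : dbop u1 f i = u i * f i.
Proof. by []. Qed.

Lemma dbop_star u (u1 : forall i, nc2 (u i) <= 1) : adj (dbop u1) = dbop (nc2J_le u1).
Proof. exact: bop_ext. Qed.

Fact indic_le1 (A : I -> bool) i : nc2 ((A i)%:R : R[i]) <= 1.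
Proof. by case: (A i); rewrite ?nc20 // -(rmorph1 (real_complex R)) nc2R expr1n. Qed.

Definition proj (A : I -> bool) : bop R I := dbop (indic_le1 A).

Lemma projE A f i : proj A f i = if A i then f i else 0.
Proof. by rewrite dbopE; case: (A i); rewrite ?mul1r ?mul0r. Qed.

Lemma proj_adj A : adj (proj A) = proj A.
Proof.
rewrite dbop_star; apply: bop_ext => f; apply: l2_ext => i.
by rewrite !dbopE; case: (A i); rewrite ?conjc1 ?conjc0.
Qed.

Lemma cmul_bopE (a b : bop R I) f : (a ** b) f = a (b f). Proof. by []. Qed.

Lemma bop_sumE (J : Type) (r : seq J) (P : pred J) (F : J -> bop R I) f i :
  (\sum_(e <- r | P e) F e) f i = \sum_(e <- r | P e) F e f i.
Proof. by elim/big_rec2 : _ => // e y x _ <-. Qed.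

Fact delta_subproof (a : I) : sq_summable (fun i => (i == a)%:R : R[i]).
Proof.
apply: (@le_lt_trans _ _ 1%E); last by rewrite ltry.
apply: nnsum_le => s us; have [as_|as_] := boolP (a \in s).
  rewrite (big_rem a)//= eqxx big_seq big1 ?addr0 => [|i].
    by rewrite -(rmorph1 (real_complex R)) nc2R expr1n.
  by rewrite mem_rem_uniq// inE => /andP[/negbTE -> _]; rewrite nc20.
rewrite big_seq big1// => i si; case: eqVneq => [ia|_]; last exact: nc20.
by rewrite -ia si in as_.
Qed.
Definition delta a : H := L2 (delta_subproof a).

Lemma deltaE a i : delta a i = (i == a)%:R. Proof. by []. Qed.

Lemma ip_delta f a : ip f (delta a) = f a.
Proof.
pose j (i : I) := if i == a then Some i else None.
have jj : pbij j j.
  by move=> x y; rewrite /j; split;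
    [case: eqVneq => // -> [<-]|case: eqVneq => // -> [<-]]; rewrite eqxx.
rewrite (_ : ip f (delta a) = csum (fun i => if i == a then f a else 0)); last first.
  congr csum; apply/funext => i; rewrite deltaE.
  by case: eqVneq => [->|_]; rewrite ?conjc1 ?mulr1 ?conjc0 ?mulr0.
have H1 (u : R) : rsum (fun i : I => if i == a then u else 0) = u.
  wlog u0 : u / 0 <= u => [hw|].
    have [/hw//|u0] := leP 0 u.
    have E : (fun i => if i == a then u else 0) = (fun i => -1 * (if i == a then - u else 0)).
      by apply/funext => i; case: ifP => _; rewrite ?mulr0// mulN1r opprK.
    rewrite E rsumZ ?hw ?mulN1r ?opprK//; first by rewrite oppr_ge0 ltW.
    apply: (@le_lt_trans _ _ `|u|%:E); last by rewrite ltry.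
    rewrite /nnsum -(@esum_set1 R I a (fun=> `|u|%:E)) ?lee_fin//.
    rewrite [leRHS]esum_mkcond; apply: le_esum => i _.
    case: eqVneq => [->|ia]; first by rewrite mem_set//= normrN.
    by rewrite memNset//= ?normr0//; exact/eqP.
  have nE : nnsum (fun i : I => if i == a then u else 0) = u%:E.
    rewrite /nnsum -(@esum_set1 R I a (fun=> u%:E)) ?lee_fin//.
    rewrite [RHS]esum_mkcond; apply: eq_esum => i _.
    case: eqVneq => [->|ia]; first by rewrite mem_set.
    by rewrite memNset//=; exact/eqP.
  by rewrite rsum_nn ?nE ?ltry// => i; case: ifP.
rewrite /csum; case: (f a) => u v.
rewrite (_ : (fun i => complex.Re _) = (fun i => if i == a then u else 0)); last first.
  by apply/funext => i; case: ifP.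
rewrite (_ : (fun i => complex.Im _) = (fun i => if i == a then v else 0)); last first.
  by apply/funext => i; case: ifP.
by rewrite !H1.
Qed.

Lemma l2_coord_le f i : cmod (f i) <= l2n f.
Proof. by rewrite ler_wsqrtr// nc2_le_l2n2. Qed.

End ConcreteOperators.
Arguments pbop R {I j k} jk : simpl never.
Arguments dbop R {I u} u1 : simpl never.

(** * Intertwiners checked on generators *)

Section Intertwiner.
Variables (R : realType) (T : cstarAlgType R) (I : choiceType).
Variables (Q1 Q2 : T -> bop R I) (W : bop R I).
Hypothesis (h1 : star_hom Q1) (h2 : star_hom Q2).

(** The elements satisfying the first relation alone need not be stable under adjoints; the relation
    for [adj W] is its mirror image, and adjoints exchange the two. Closedness comes from
    contractivity of representations. *)
Lemma intertwine (gens : set T) :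
  (forall B : set T, cstar_subalg B -> gens `<=` B -> B = setT) ->
  (forall a, gens a -> W ** Q2 a = Q1 a ** W /\ adj W ** Q1 a = Q2 a ** adj W) ->
  forall a, W ** Q2 a = Q1 a ** W.
Proof.
move=> gen hg a; pose B := [set a | W ** Q2 a = Q1 a ** W /\ adj W ** Q1 a = Q2 a ** adj W].
suff BT : B = setT by have [] : B a by rewrite BT.
apply: gen => //; split.
- pose f1 (j : l2 R I * l2 R I) a := ip (W (Q2 a j.1) - Q1 a (W j.1)) j.2.
  pose f2 (j : l2 R I * l2 R I) a := ip (adj W (Q1 a j.1) - Q2 a (adj W j.1)) j.2.
  have -> : B = [set a | forall j, True -> f1 j a = 0] `&` [set a | forall j, True -> f2 j a = 0].
    apply/seteqP; split => [b [E1 E2]|b [E1 E2]].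
      by split=> j _; rewrite /f1 /f2 -!cmul_bopE ?E1 ?E2 subrr ip0l.
    split; apply: bop_ext => x; apply/eqP; rewrite -subr_eq0; apply/eqP;
      by apply: ip_injl => y; rewrite ip0l;
        first [exact: (E1 (x, y) Logic.I)|exact: (E2 (x, y) Logic.I)].
  have K (W' : bop R I) (P1 P2 : T -> bop R I) (hP1 : star_hom P1) (hP2 : star_hom P2) :
      closed [set a | forall j : l2 R I * l2 R I, True ->
        ip (W' (P2 a j.1) - P1 a (W' j.1)) j.2 = 0].
    apply: closed_zeros => -[x y] _ /=.
      move=> u v; rewrite !star_homB// !bop_subE.
      have -> : W' (P2 u x - P2 v x) = W' (P2 u x) - W' (P2 v x).
        by rewrite addrC -scaleN1r bop_lin scaleN1r addrC.
      by rewrite !ipBl; ring.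
    exists (onorm W' * l2n x * l2n y + l2n (W' x) * l2n y).
    split; first by rewrite addr_ge0// !mulr_ge0 ?onorm_ge0 ?l2n_ge0.
    have CS (f g : l2 R I) : cmod (ip f g) <= l2n f * l2n g.
      by rewrite -sqrtrM ?l2n2_ge0// ler_wsqrtr// ip_CauchySchwarz.
    move=> u; rewrite ipBl (le_trans (cmodD _ _))// cmodN mulrDl lerD//.
      rewrite (le_trans (CS _ _))// (mulrAC _ _ (nrm u)) ler_wpM2r ?l2n_ge0//.
      rewrite (le_trans (le_onorm _ _))// -mulrA ler_wpM2l ?onorm_ge0// mulrC.
      exact: rep_le.
    rewrite (le_trans (CS _ _))// mulrAC ler_wpM2r ?l2n_ge0// mulrC.
    exact: rep_le.
  by apply: closedI; exact: K.
- by split; rewrite (star_hom0 h1) (star_hom0 h2);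
    rewrite (cmul0l (T := bop R I)) (cmul0r (T := bop R I)).
- move=> k u v [u1 u2] [v1 v2]; case: (h1) (h2) => l1 _ _ [l2 _ _].
  by split; rewrite l1 l2 !(cmulDl, cmulDr, cmulZl, cmulZr) ?u1 ?v1 ?u2 ?v2.
- move=> u v [u1 u2] [v1 v2]; case: (h1) (h2) => _ m1 _ [_ m2 _].
  by split; rewrite m1 m2 cmulA ?u1 ?u2 -!cmulA ?v1 ?v2.
- move=> u [u1 u2]; case: (h1) (h2) => _ _ a1 [_ _ a2].
  split; rewrite a1 a2.
    by have := congr1 adj u2; rewrite !adjM adjK => <-.
  by have := congr1 adj u1; rewrite !adjM => <-.
Qed.

End Intertwiner.

(** * The Toeplitz family on path space *)

Section PathSpaceFamily.
Variables (R : realType) (E : fin_digraph).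
Local Notation G := (gpath E).
Local Notation I := (gpath E * gpath E)%type.
Local Notation H := (l2 R I).
Implicit Types (mu nu la ka : G).

Definition pcons (e : edge E) mu : option G :=
  match pselect (path_rng mu = src e) with
  | left h => Some (gcons h)
  | right _ => None
  end.

Lemma pconsE (e : edge E) mu (h : path_rng mu = src e) : pcons e mu = Some (gcons h).
Proof.
by rewrite /pcons; case: pselect => // h'; congr (Some (gcons _)); exact: Prop_irrelevance.
Qed.

Lemma pcons_None (e : edge E) mu : path_rng mu <> src e -> pcons e mu = None.
Proof. by rewrite /pcons; case: pselect. Qed.

Lemma pcons_Some (e : edge E) mu la : pcons e mu = Some la ->
  exists h : path_rng mu = src e, la = gcons h.
Proof. by rewrite /pcons; case: pselect => // h [<-]; exists h. Qed.

Lemma gcons_inj e f mu nu (h : path_rng mu = src e) (k : path_rng nu = src f) :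
  gcons h = gcons k -> e = f /\ mu = nu.
Proof.
move=> /(congr1 val)/= [_ ef lE]; split => //; apply: gpath_eq => //.
by rewrite h k ef.
Qed.

Definition puncons (e : edge E) la : option G :=
  match pselect (exists mu, pcons e mu = Some la) with
  | left h => Some (sval (cid h))
  | right _ => None
  end.

Lemma punconsP e la mu : puncons e la = Some mu <-> pcons e mu = Some la.
Proof.
rewrite /puncons; case: pselect => [h|h]; last first.
  by split=> // mE; case: h; exists mu.
have P := svalP (cid h); set nu := sval _ in P *.
split=> [[<-]//|mE]; congr Some.
have [h1 E1] := pcons_Some P; have [h2 E2] := pcons_Some mE.
by have [_ ->] := gcons_inj (etrans (esym E1) E2).
Qed.

Lemma puncons_gcons e mu (h : path_rng mu = src e) : puncons e (gcons h) = Some mu.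
Proof. by apply/punconsP; exact: pconsE. Qed.

Lemma puncons_vertex e v : puncons e (gvertex v) = None.
Proof.
case: (puncons _ _) (punconsP e (gvertex v)) => // mu /(_ mu)[/(_ erefl)+ _].
by move=> /pcons_Some[h /(congr1 (@path_len E))].
Qed.

Lemma puncons_neq e f mu (h : path_rng mu = src f) : e != f -> puncons e (gcons h) = None.
Proof.
move=> ef; case P : (puncons _ _) => [nu|//].
move/punconsP : P => /pcons_Some[k /gcons_inj[fe _]].
by rewrite fe eqxx in ef.
Qed.

Lemma puncons_Some e la mu : puncons e la = Some mu ->
  exists h : path_rng mu = src e, la = gcons h.
Proof. by move/punconsP/pcons_Some. Qed.

Definition on_fst (f : G -> option G) (i : I) : option I :=
  if f i.1 is Some la then Some (la, i.2) else None.

Lemma on_fst_pbij f g : (forall la mu, f la = Some mu <-> g mu = Some la) ->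
  pbij (on_fst f) (on_fst g).
Proof.
move=> fg [a b] [c d]; rewrite /on_fst/=; split.
  by case F : (f a) => [c'|//] [<- <-]; rewrite (proj1 (fg _ _) F).
by case F : (g c) => [c'|//] [<- <-]; rewrite (proj2 (fg _ _) F).
Qed.

(** Since [pbop] pulls back, removing [e] appears in the definition, while basis vectors h_(mu,ka)
    go to h_(e mu,ka). *)
Definition opS (e : edge E) : bop R I := pbop R (on_fst_pbij (punconsP e)).
Arguments opS : simpl never.
Definition opP (v : vertex E) : bop R I := proj R (fun i : I => path_rng i.1 == v).
Arguments opP : simpl never.

Lemma opSE e f i : opS e f i = if puncons e i.1 is Some la then f (la, i.2) else 0.
Proof. by rewrite pbopE /pact /on_fst; case: (puncons _ _). Qed.

Lemma opS_adjE e f i : adj (opS e) f i = if pcons e i.1 is Some la then f (la, i.2) else 0.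
Proof. by rewrite pbop_star pbopE /pact /on_fst; case: (pcons _ _). Qed.

Lemma opPE v f i : opP v f i = if path_rng i.1 == v then f i else 0.
Proof. exact: projE. Qed.

Lemma opSS_E e f i : (opS e ** adj (opS e)) f i = if puncons e i.1 is Some _ then f i else 0.
Proof.
rewrite cmul_bopE opSE; case P : (puncons _ _) => [la|//].
by rewrite opS_adjE/= (proj1 (punconsP _ _ _) P); case: i P.
Qed.

(** A path has at most one first edge, so at most one summand contributes at each index. *)
Lemma sum_opSS_E (F : pred (edge E)) f i :
  (\sum_(e | F e) opS e ** adj (opS e)) f i =
  if [exists e, F e && (puncons e i.1 != None)] then f i else 0.
Proof.
rewrite bop_sumE; under eq_bigr do rewrite opSS_E.
have [/existsP[e /andP[Fe Pe]]|nE] := boolP [exists e, F e && (puncons e i.1 != None)].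
  rewrite (bigD1 e)//= big1 ?addr0; first by case: (puncons e _) Pe.
  move=> e' /andP[_ ee']; case P : (puncons e i.1) Pe => [la|//] _.
  have [h ->] := puncons_Some P; by rewrite puncons_neq.
apply: big1 => e Fe; case P : (puncons e i.1) => [la|//].
by case/existsP : nE; exists e; rewrite Fe P.
Qed.

Lemma path_space_tck : tck_family opP opS.
Proof.
split.
- move=> v; split; first exact: proj_adj.
  apply: bop_ext => f; apply: l2_ext => i; rewrite cmul_bopE !opPE.
  by case: (path_rng i.1 == v).
- move=> v w vw; apply: bop_ext => f; apply: l2_ext => i.
  rewrite cmul_bopE !opPE; case: eqVneq => [->|//]; by rewrite (negbTE vw).
- move=> e; apply: bop_ext => f; apply: l2_ext => i.
  rewrite -[RHS]/(opS e f i) -cmulA cmul_bopE opSE [in RHS]opSE.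
  case P : (puncons _ _) => [la|//]; rewrite cmul_bopE opS_adjE/=.
  by rewrite (proj1 (punconsP _ _ _) P) /pact /on_fst/= P.
- move=> e; apply: bop_ext => f; apply: l2_ext => -[la ka].
  rewrite cmul_bopE opS_adjE opPE/=.
  have [h|h] := eqVneq (path_rng la) (src e).
    by rewrite (pconsE h) /pact /on_fst/= puncons_gcons.
  by rewrite pcons_None//; exact/eqP.
- move=> v F Fv.
  (* The paths with range [v] that do not begin with an edge of [F]. The defect is the projection
     onto them and so is its own witness [c]. *)
  pose A (i : I) := (path_rng i.1 == v) && ~~ [exists e, (e \in F) && (puncons e i.1 != None)].
  exists (proj R A); rewrite proj_adj; apply: bop_ext => f; apply: l2_ext => i.
  rewrite bop_subE l2_subE sum_opSS_E opPE cmul_bopE !projE /A.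
  have [/existsP[e /andP[eF Pe]]|_] :=
    boolP [exists e, (e \in F) && (puncons e i.1 != None)]; last first.
    by rewrite andbT subr0; case: (path_rng i.1 == v).
  case P : (puncons e i.1) Pe => [la|//] _; have [h ->] := puncons_Some P.
  by rewrite path_rng_cons Fv// eqxx/= subrr.
Qed.

End PathSpaceFamily.

(** * The Gibbs vector state *)

Section GibbsState.
Variables (R : realType) (E : fin_digraph) (T : cstarAlgType R).
Variables (p : vertex E -> T) (s : edge E -> T) (gamma : R[i] -> T -> T) (beta : R).
Hypothesis hT : tck_family p s.
Hypothesis gen : forall B : set T, cstar_subalg B ->
  (forall v, B (p v)) -> (forall e, B (s e)) -> B = setT.
Hypothesis hgamma : gauge_action p s gamma.
Hypothesis hbeta : (lne (spectral_radius (adjacency R E))%:E < beta%:E)%E.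
Local Notation G := (gpath E).
Local Notation I := (gpath E * gpath E)%type.
Local Notation H := (l2 R I).
Local Notation elt := (path_elt p s).
Implicit Types (mu nu la ka : G) (a b c : T).

Variable Q : T -> bop R I.
Hypothesis Qh : star_hom Q.
Hypothesis Qp : forall v, Q (p v) = opP R v.
Hypothesis Qs : forall e, Q (s e) = opS R e.

Lemma gen_sub (B : set T) : cstar_subalg B ->
  [set a | (exists v, a = p v) \/ (exists e, a = s e)] `<=` B -> B = setT.
Proof. by move=> HB sB; apply: gen => // [v|e]; apply: sB; [left; exists v|right; exists e]. Qed.

Lemma commutant (W : bop R I) :
  (forall v, W ** opP R v = opP R v ** W /\ adj W ** opP R v = opP R v ** adj W) ->
  (forall e, W ** opS R e = opS R e ** W /\ adj W ** opS R e = opS R e ** adj W) ->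
  forall a f, W (Q a f) = Q a (W f).
Proof.
move=> WP WS a f; rewrite -!cmul_bopE; congr (bop_fun _ f).
apply: (intertwine Qh Qh gen_sub) => b [[v ->]|[e ->]]; rewrite ?Qp ?Qs.
  exact: WP.
exact: WS.
Qed.

(* Right multiplication by a matrix unit, in the second coordinate. *)
Definition rmx_fun (ka ka' : G) (i : I) : option I :=
  if i.2 == ka then Some (i.1, ka') else None.

Lemma rmx_pbij ka ka' : pbij (rmx_fun ka ka') (rmx_fun ka' ka).
Proof.
move=> [a b] [c d]; rewrite /rmx_fun/=; split.
  by case: eqVneq => [->|//] [<- <-]; rewrite eqxx.
by case: eqVneq => [->|//] [<- <-]; rewrite eqxx.
Qed.

Definition rmx ka ka' : bop R I := pbop R (rmx_pbij ka ka').

Lemma rmxE ka ka' f i : rmx ka ka' f i = if i.2 == ka then f (i.1, ka') else 0.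
Proof. by rewrite pbopE /pact /rmx_fun; case: ifP. Qed.

Lemma rmx_adj ka ka' : adj (rmx ka ka') = rmx ka' ka.
Proof.
rewrite pbop_star; apply: bop_ext => f; apply: l2_ext => i.
by rewrite rmxE pbopE /pact /rmx_fun; case: ifP.
Qed.

Lemma rmx_commutes ka ka' a f : rmx ka ka' (Q a f) = Q a (rmx ka ka' f).
Proof.
have K v la la' : rmx la la' ** opP R v = opP R v ** rmx la la'.
  apply: bop_ext => g; apply: l2_ext => -[x y].
  by rewrite !cmul_bopE rmxE !opPE rmxE/=; do 2 case: ifP => _.
have L e la la' : rmx la la' ** opS R e = opS R e ** rmx la la'.
  apply: bop_ext => g; apply: l2_ext => -[x y].
  rewrite !cmul_bopE rmxE !opSE; cbn [fst snd].
  by case: (puncons e x) => [z|]; rewrite ?rmxE; cbn [fst snd]; case: (y == la).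
apply: commutant => [v|e]; rewrite rmx_adj; split; by [exact: K | exact: L].
Qed.

(** Prepending edges preserves the source. Entries between paths of different sources thus vanish,
    so a single [eps] coefficient enters each term in [gibbs_swap]. *)
Lemma src_commutes v a f : proj R (fun i : I => path_src i.1 == v) (Q a f) =
  Q a (proj R (fun i : I => path_src i.1 == v) f).
Proof.
set W := proj R _.
have K w : W ** opP R w = opP R w ** W.
  apply: bop_ext => g; apply: l2_ext => -[x y].
  by rewrite !cmul_bopE !projE; do 2 case: ifP => _.
have L e : W ** opS R e = opS R e ** W.
  apply: bop_ext => g; apply: l2_ext => -[x y].
  rewrite !cmul_bopE projE !opSE; cbn [fst snd].
  case P : (puncons e x) => [z|]; last by case: (path_src x == v).
  by have [h ->] := puncons_Some P; rewrite path_src_cons projE.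
by apply: commutant => [w|e]; rewrite proj_adj; split; by [exact: K | exact: L].
Qed.

(* The matrix of [Q a], which acts on the first coordinate only. *)
Definition ent a la ka : R[i] := Q a (delta R (ka, ka)) (la, ka).

Lemma ent_adj a la ka : ent (adj a) la ka = conjc (ent a ka la).
Proof.
rewrite /ent -ip_delta (rep_adj Qh) ipC; congr conjc; rewrite ip_delta.
(* Passing to the adjoint leaves the second coordinate [ka] where [la] is wanted; the commuting
   [rmx] relabels it. *)
have -> : delta R (la, ka) = rmx ka la (delta R (la, la)).
  apply: l2_ext => -[x y]; rewrite rmxE !deltaE !xpair_eqE/=.
  by case: (y == ka); rewrite ?andbT ?andbF ?eqxx ?andbT.
by rewrite -rmx_commutes rmxE/= eqxx.
Qed.

Lemma ent_src a la ka : path_src la != path_src ka -> ent a la ka = 0.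
Proof.
move=> lk; rewrite /ent.
have -> : delta R (ka, ka) = proj R (fun i : I => path_src i.1 == path_src ka) (delta R (ka, ka)).
  apply: l2_ext => -[x y]; rewrite projE !deltaE !xpair_eqE/=.
  by case: (x =P ka) => [->|_]; rewrite ?eqxx//=; case: ifP.
by rewrite -src_commutes projE/= (negbTE lk).
Qed.

Lemma ent_linear k a b la ka : ent (k *: a + b) la ka = k * ent a la ka + ent b la ka.
Proof. by case: Qh => Ql _ _; rewrite /ent Ql. Qed.

Lemma ent_le a la ka : cmod (ent a la ka) <= l2n (delta R (ka, ka)) * nrm a.
Proof. by rewrite mulrC (le_trans (l2_coord_le _ _))//; exact: rep_le. Qed.

Section Gauge.
Variable t : R.
Let z : R[i] := cos t +i* sin t.

Fact zpow_le1 (i : I) : nc2 (z ^+ path_len i.1) <= 1.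
Proof.
rewrite -sqr_cmod cmodX (_ : cmod z = 1) ?expr1n//.
by have := cmod_cos_sin t; rewrite cmodE => -[].
Qed.

(** The unitary that implements the gauge action, counting only the edges of the first
    coordinate. *)
Definition opU : bop R I := dbop R zpow_le1.

Lemma gauge_p v : gauge_dynamics gamma t (p v) = p v.
Proof.
have := gauge_span hgamma t (gvertex v) (gvertex v).
by rewrite !elt_vertex (p_adj hT) (p_idem hT) /degree subrr mul0r expc_0 scale1r.
Qed.

Lemma gauge_s e : gauge_dynamics gamma t (s e) = z *: s e.
Proof.
have h : path_rng (gvertex (src e)) = src e by [].
have := gauge_span hgamma t (gcons h) (gvertex (src e)).
rewrite (elt_cons hT) !elt_vertex (p_adj hT) -!cmulA (p_idem hT) (s_p hT).
by rewrite /degree path_len_cons/= mul1r expc_imag.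
Qed.

Lemma z_unit : conjc z * z = 1.
Proof.
rewrite mulrC -nc2E /nc2/= cos2Dsin2; exact: rmorph1.
Qed.

(** [opU] intertwines two representations, [Q] and [Q] composed with the dynamics, so the generators
    suffice. *)
Lemma gauge_covariant a f : opU (Q a f) = Q (gauge_dynamics gamma t a) (opU f).
Proof.
have zh : star_hom (gauge_dynamics gamma t).
  by case: hgamma => /(_ _ (cmod_cos_sin t))[].
have h1 : star_hom (fun a => Q (gauge_dynamics gamma t a)).
  case: (Qh) zh => l1 m1 a1 [l2 m2 a2]; split=> [k x y|x y|x].
  - by rewrite l2 l1.
  - by rewrite m2 m1.
  - by rewrite a2 a1.
rewrite -[LHS]cmul_bopE -[RHS]cmul_bopE; congr (bop_fun _ f).
apply: (intertwine h1 Qh gen_sub) => b [[v ->]|[e ->]].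
  rewrite gauge_p Qp; split; apply: bop_ext => g; apply: l2_ext => -[x y].
    by rewrite !cmul_bopE dbopE !opPE dbopE/=; case: ifP; rewrite ?mulr0.
  by rewrite !cmul_bopE dbop_star dbopE !opPE dbopE/=; case: ifP; rewrite ?mulr0.
rewrite gauge_s star_homZ// Qs; split; apply: bop_ext => g; apply: l2_ext => -[x y].
  rewrite !cmul_bopE bop_scaleE l2_scaleE dbopE !opSE; cbn [fst snd].
  case P : (puncons e x) => [w|]; last by rewrite !mulr0.
  have [h ->] := puncons_Some P.
  by rewrite dbopE; cbn [fst snd]; rewrite path_len_cons exprS mulrA.
rewrite !cmul_bopE dbop_star dbopE bop_scaleE l2_scaleE !opSE; cbn [fst snd].
case P : (puncons e x) => [w|]; last by rewrite !mulr0.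
have [h ->] := puncons_Some P.
rewrite dbopE; cbn [fst snd]; rewrite path_len_cons exprS rmorphM.
by rewrite -[RHS]mul1r -z_unit; ring.
Qed.

End Gauge.

Variable eps : 'cV[R]_#|vertex E|.
Hypothesis eps_Sigma : Sigma beta eps.

Let eps_ge0 v : 0 <= coef eps v. Proof. by case: eps_Sigma. Qed.

Definition gibbs (la : G) : R := expR (- beta * (path_len la)%:R) * coef eps (path_src la).

Lemma gibbs_ge0 la : 0 <= gibbs la.
Proof. by rewrite mulr_ge0 ?expR_ge0. Qed.

(** Grouping the paths by source turns the total mass into eps . y. *)
Lemma nnsum_gibbs : nnsum gibbs = 1%E.
Proof.
have [_ <-] := eps_Sigma.
transitivity (\esum_(la in [set: G]) \sum_(v : vertex E)
    ((coef eps v)%:E * (if la \in [set la : G | path_src la = v]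
      then (expR (- beta * (path_len la)%:R))%:E else 0)))%E.
  apply: eq_esum => la _; rewrite (bigD1 (path_src la))//= mem_set//.
  rewrite big1 ?adde0; first by rewrite -EFinM mulrC.
  by move=> v vl; rewrite memNset ?mule0//= => lv; rewrite lv eqxx in vl.
rewrite esum_sum; last first.
  by move=> la v _ _; rewrite mule_ge0 ?lee_fin//; case: ifP => // _; rewrite lee_fin expR_ge0.
rewrite -sumEFin; apply: eq_bigr => v _.
have S : (\esum_(la in [set: G]) (if la \in [set la : G | path_src la = v]
    then (expR (- beta * (path_len la)%:R))%:E else 0) = (path_sum beta v)%:E)%E.
  by rewrite -esum_mkcondr setTI /path_sum fineK// path_series_fin.
have := @nnsumZ R G (coef eps v) (fun la => if la \in [set la : G | path_src la = v]
    then expR (- beta * (path_len la)%:R) else 0) (eps_ge0 v).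
rewrite /nnsum => H; rewrite EFinM -S.
have E1 : (\esum_(la in [set: G]) (if la \in [set la : G | path_src la = v]
    then (expR (- beta * (path_len la)%:R))%:E else 0) =
   \esum_(la in [set: G]) (if la \in [set la : G | path_src la = v]
    then expR (- beta * (path_len la)%:R) else 0)%:E)%E.
  by apply: eq_esum => la _; case: ifP.
rewrite E1 -H; last by move=> la; case: ifP => // _; rewrite expR_ge0.
by apply: eq_esum => la _; case: ifP => _; rewrite EFinM.
Qed.

Lemma nnsum_diag (u : G -> R) : nnsum (fun i : I => if i.1 == i.2 then u i.1 else 0) = nnsum u.
Proof.
rewrite /nnsum (esum_mkcond setT).
transitivity (\esum_(i in [set i : I | i.1 = i.2]) (u i.1)%:E)%E.
  rewrite [RHS]esum_mkcond; apply: eq_esum => i _; rewrite in_setT.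
  by case: eqVneq => [ie|/eqP ie]; [rewrite mem_set|rewrite memNset].
rewrite (@reindex_esum _ _ _ [set: G] _ (fun la => (la, la)))//.
split => //; first by move=> x y _ _ [].
by move=> [x y] /= xy; exists x; rewrite // xy.
Qed.

Fact xi_subproof : sq_summable (fun i : I =>
  if i.1 == i.2 then (Num.sqrt (gibbs i.1))%:C else 0).
Proof.
rewrite /sq_summable (_ : (fun _ => _) = fun i : I => if i.1 == i.2 then gibbs i.1 else 0).
  by rewrite nnsum_diag nnsum_gibbs ltry.
apply/funext => i; case: ifP => _; last exact: nc20.
by rewrite nc2R sqr_sqrtr// gibbs_ge0.
Qed.
Definition xi : H := L2 xi_subproof.

Lemma xiE i : xi i = if i.1 == i.2 then (Num.sqrt (gibbs i.1))%:C else 0.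
Proof. by []. Qed.

Lemma l2n2_xi : l2n2 xi = 1.
Proof.
rewrite /l2n2 (_ : (fun i => nc2 (xi i)) = fun i : I => if i.1 == i.2 then gibbs i.1 else 0).
  by rewrite nnsum_diag nnsum_gibbs.
apply/funext => i; rewrite xiE; case: ifP => _; last exact: nc20.
by rewrite nc2R sqr_sqrtr// gibbs_ge0.
Qed.

Definition gibbs_state a : R[i] := ip (Q a xi) xi.
Local Notation phi := gibbs_state.

Lemma Q_vsum f : Q (vsum p) f = f.
Proof.
have QS (J : Type) (r : seq J) (F : J -> T) : Q (\sum_(j <- r) F j) = \sum_(j <- r) Q (F j).
  elim: r => [|j r IH]; first by rewrite !big_nil (star_hom0 Qh).
  by rewrite !big_cons (star_homD _ _ Qh) IH.
apply: l2_ext => i; rewrite /vsum QS bop_sumE (bigD1 (path_rng i.1))//= Qp opPE eqxx.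
by rewrite big1 ?addr0// => v vi; rewrite Qp opPE eq_sym (negbTE vi).
Qed.

Lemma gibbs_state_state : state phi.
Proof.
have xi1 : l2n xi = 1 by rewrite /l2n l2n2_xi sqrtr1.
have phi_le a : cmod (phi a) <= nrm a.
  have := ip_CauchySchwarz (Q a xi) xi; rewrite l2n2_xi mulr1 => H.
  apply: (@le_trans _ _ (l2n (Q a xi))); first by rewrite ler_wsqrtr.
  by rewrite (le_trans (rep_le Qh a xi))// xi1 mulr1.
split.
- by move=> k a b; case: Qh => Ql _ _; rewrite /phi Ql ipDl.
- move=> a; rewrite /phi (repM Qh) (rep_adj Qh); exact: ip_ge0.
- apply/eqP; rewrite eq_le; apply/andP; split.
    apply: ge_ereal_sup => _ [a a1 <-]; rewrite cmodE lee_fin (le_trans (phi_le a))//.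
    by rewrite -lecR -nrmE.
  (* The supremum is attained at [vsum], which [Q] maps to the identity. *)
  apply: ereal_sup_ubound; exists (vsum p).
    by rewrite /= nrmE -(rmorph1 (real_complex R)) lecR (nrm_vsum_le hT).
  by rewrite /phi Q_vsum ipE l2n2_xi cmodE cmodR normr1.
Qed.

(** Restricting to second coordinate [ka] commutes with [Q a] and cuts [xi] down to a multiple of
    h_(ka,ka). *)
Lemma Q_xi a la ka : Q a xi (la, ka) = (Num.sqrt (gibbs ka))%:C * ent a la ka.
Proof.
have -> : Q a xi (la, ka) = rmx ka ka (Q a xi) (la, ka) by rewrite rmxE/= eqxx.
rewrite rmx_commutes (_ : rmx ka ka xi = (Num.sqrt (gibbs ka))%:C *: delta R (ka, ka)).
  by rewrite bopZ l2_scaleE.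
apply: l2_ext => -[x y]; rewrite rmxE l2_scaleE deltaE xiE xpair_eqE; cbn [fst snd].
by case: (y =P ka) => _; rewrite ?andbT ?andbF ?mulr0//; case: (x =P ka) => [->|_];
  rewrite ?mulr1 ?mulr0.
Qed.

Lemma csum_swap (F : I -> R[i]) : csum F = csum (fun i : I => F (i.2, i.1)).
Proof.
apply: (@csum_reindex _ _ (fun i => Some (i.2, i.1)) (fun i => Some (i.2, i.1))) => //.
  by move=> [a b] [c d]; split=> [[<- <-]|[<- <-]].
by move=> [a b] _ [<-].
Qed.

(** Both sides are sums over pairs of paths, with terms gibbs(ka) b(la,ka) a(ka,la) on the left and
    gibbs(la) b(la,ka) c(ka,la) on the right after the exchange. The factor in [c] converts one
    weight into the other. *)
Lemma gibbs_swap a b c :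
  (forall la ka, ent c la ka =
    (expR (- beta * ((path_len la)%:R - (path_len ka)%:R)))%:C * ent a la ka) ->
  phi (a ** b) = phi (b ** c).
Proof.
move=> ca; rewrite /phi !(repM Qh) -[X in ip (Q X _) _ = _](adjK a) (rep_adj Qh).
rewrite -[X in _ = ip (Q X _) _](adjK b) (rep_adj Qh) [RHS]csum_swap.
have conjcM (u v : R[i]) : conjc (u * v) = conjc u * conjc v by rewrite rmorphM.
congr csum; apply/funext => -[la ka]; cbn [fst snd].
rewrite !Q_xi !ent_adj !conjcM !conjcK !conjc_real.
(* The weights compare only for equal sources, where their [eps] factors agree; all other terms
   vanish. *)
have [ska|ska] := eqVneq (path_src la) (path_src ka); last first.
  by rewrite (ent_src b ska) (ent_src c) 1?eq_sym// !(mulr0, mul0r).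
have G2 x : (Num.sqrt (gibbs x))%:C * (Num.sqrt (gibbs x))%:C = (gibbs x)%:C.
  by rewrite -rmorphM -expr2 sqr_sqrtr// gibbs_ge0.
transitivity ((gibbs ka)%:C * (ent b la ka * ent a ka la)); first by rewrite -G2; ring.
rewrite ca; set x := expR (- beta * ((path_len ka)%:R - _)).
have CM (u v : R) : (u * v)%:C = u%:C * v%:C by rewrite rmorphM.
transitivity ((gibbs la * x)%:C * (ent b la ka * ent a ka la)); last by rewrite CM -G2; ring.
congr (_%:C * _); rewrite /gibbs /x ska mulrAC -expRD; congr (expR _ * _).
by rewrite -mulrDr; congr (_ * _); rewrite addrC subrK.
Qed.

Lemma ent_gauge t a la ka : ent (gauge_dynamics gamma t a) la ka =
  expc ('i%C * ((path_len la)%:R - (path_len ka)%:R) * t%:C) * ent a la ka.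
Proof.
set z := cos t +i* sin t : R[i].
have zn n : z ^+ n = expc (n%:R * ('i%C * t%:C)) by rewrite expc_natz expc_imag.
have H := congr1 (fun f : H => f (la, ka)) (gauge_covariant t a (delta R (ka, ka))).
move: H; rewrite {1}/opU dbopE; cbn [fst snd].
rewrite (_ : opU t (delta R (ka, ka)) = z ^+ path_len ka *: delta R (ka, ka)); last first.
  apply: l2_ext => -[x y]; rewrite /opU dbopE l2_scaleE deltaE xpair_eqE; cbn [fst snd].
  by case: (x =P ka) => [->|_]//=; rewrite !mulr0.
rewrite bopZ l2_scaleE -/(ent a la ka) -/(ent (gauge_dynamics gamma t a) la ka) => H.
have -> : 'i%C * ((path_len la)%:R - (path_len ka)%:R) * t%:C =
    - ((path_len ka)%:R * ('i%C * t%:C)) + (path_len la)%:R * ('i%C * t%:C) :> R[i].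
  by ring.
rewrite expcD expcN -!zn -mulrA H mulKf// expf_neq0//.
by rewrite -normr_eq0 cmod_cos_sin oner_eq0.
Qed.

Lemma ent_analytic a F la ka : analytic_ext (gauge_dynamics gamma) a F ->
  ent (F (0 +i* beta)) la ka =
    (expR (- beta * ((path_len la)%:R - (path_len ka)%:R)))%:C * ent a la ka.
Proof.
move=> [Fe FR]; set k : R := (path_len la)%:R - (path_len ka)%:R.
have kC : ((path_len la)%:R - (path_len ka)%:R : R[i]) = k%:C.
  by rewrite /k rmorphB !rmorph_nat.
have Lh G' : entire G' -> holomorphic (fun w => ent (G' w) la ka).
  move=> G'e.
  apply: (@entire_holomorphic _ T G' (fun a => ent a la ka) (l2n (delta R (ka, ka)))) => //.
    by move=> c x y; exact: ent_linear.
  by move=> x; exact: ent_le.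
(* The comparison function: on the real axis its entry agrees with that of [F], by gauge covariance,
   and at i beta it has the required factor. *)
have gentire : entire (fun w => expc ('i%C * k%:C * w) *: a) by exact: entire_expc.
have entZ (c0 : R[i]) (x : T) : ent (c0 *: x) la ka = c0 * ent x la ka.
  by rewrite /ent (star_homZ _ _ Qh).
have := holomorphic_real_eq (Lh _ Fe) (Lh _ gentire) _ beta => ->; last first.
  by move=> t; rewrite FR ent_gauge entZ kC.
rewrite entZ -expcR; congr (expc _ * _).
by apply/eqP; rewrite eq_complex/=; apply/andP; split; apply/eqP; ring.
Qed.

Lemma gibbs_state_kms : kms_state (gauge_dynamics gamma) beta phi.
Proof.
split; first exact: gibbs_state_state.
case: ifPn => [/eqP b0|_]; last first.
  move=> a b F Gb aF _; apply: gibbs_swap => la ka; exact: ent_analytic.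
split; last first.
  by move=> a b; apply: gibbs_swap => la ka; rewrite b0 oppr0 mul0r expR0 mul1r.
(* Pairing with [xi] sees only diagonal entries, which the gauge action fixes. *)
move=> t a; congr csum; apply/funext => -[la ka]; rewrite xiE; cbn [fst snd].
case: (la =P ka) => [->|_]; last by rewrite conjc0 !mulr0.
by rewrite !Q_xi ent_gauge subrr mulr0 mul0r expc_0 mul1r.
Qed.

(** [Q] maps this element to the projection onto first coordinate the vertex path [v], because every
    longer path with range [v] has a first edge there. Its only meeting point with [xi] is (v, v),
    of weight eps_v. *)
Lemma gibbs_state_defect v :
  phi (p v - \sum_(e | rng e == v) s e ** adj (s e)) = (coef eps v)%:C.
Proof.
have QS (J : Type) (r : seq J) (P : pred J) (F : J -> T) :
    Q (\sum_(j <- r | P j) F j) = \sum_(j <- r | P j) Q (F j).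
  elim/big_rec2 : _ => [|j x y _ <-]; first exact: star_hom0.
  exact: star_homD.
have E1 : Q (p v - \sum_(e | rng e == v) s e ** adj (s e)) =
    proj R (fun i : I => i.1 == gvertex v).
  rewrite (star_homB _ _ Qh) QS.
  rewrite (eq_bigr (fun e => opS R e ** adj (opS R e))); last first.
    by move=> e _; case: Qh => _ m a; rewrite m a Qs.
  apply: bop_ext => f; apply: l2_ext => -[la ka].
  rewrite bop_subE l2_subE sum_opSS_E Qp opPE projE; cbn [fst snd].
  have [[w ->]|[e [nu [h ->]]]] := gpath_cases la.
    rewrite (_ : [exists e, _] = false); last first.
      by apply/existsP => -[e]; rewrite puncons_vertex andbF.
    rewrite subr0; have [->|wv] := eqVneq w v; first by rewrite !eqxx.
    by case: eqP => // -[wv']; rewrite wv' eqxx in wv.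
  rewrite path_rng_cons; have [rv|rv] := eqVneq (rng e) v.
    rewrite (_ : [exists e, _] = true); last first.
      by apply/existsP; exists e; rewrite rv eqxx puncons_gcons.
    by rewrite subrr; case: eqP.
  rewrite (_ : [exists e, _] = false); last first.
    apply/existsP => -[f' /andP[/eqP fv]]; have [fe|fe] := eqVneq f' e.
        by move=> _; move: rv; rewrite -fe fv eqxx.
    by rewrite puncons_neq.
  by rewrite subr0; case: eqP.
rewrite /phi E1.
have gv : gibbs (gvertex v) = coef eps v by rewrite /gibbs mulr0 expR0 mul1r.
have -> : ip (proj R (fun i : I => i.1 == gvertex v) xi) xi =
    ip ((Num.sqrt (coef eps v))%:C *: xi) (delta R (gvertex v, gvertex v)).
  congr csum; apply/funext => -[x y]; rewrite projE l2_scaleE deltaE xpair_eqE; cbn [fst snd].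
  have [->|xv] := eqVneq x (gvertex v); last by rewrite conjc0 mulr0 mul0r.
  rewrite xiE; cbn [fst snd]; rewrite [y == _]eq_sym.
  have [|] := eqVneq (gvertex v) y => _; last by rewrite mul0r mulr0 mul0r.
  by rewrite gv andbT conjc_real conjc1 mulr1.
rewrite ip_delta l2_scaleE xiE; cbn [fst snd].
by rewrite eqxx gv -rmorphM -expr2 sqr_sqrtr.
Qed.

End GibbsState.

(** * KMS states *)

Section KMSStates.
Variables (R : realType) (E : fin_digraph) (T : cstarAlgType R).
Variables (p : vertex E -> T) (s : edge E -> T) (gamma : R[i] -> T -> T) (beta : R).
Hypothesis hT : tck_family p s.
Hypothesis gen : forall B : set T, cstar_subalg B ->
  (forall v, B (p v)) -> (forall e, B (s e)) -> B = setT.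
Hypothesis hgamma : gauge_action p s gamma.
Hypothesis hbeta : (lne (spectral_radius (adjacency R E))%:E < beta%:E)%E.
Local Notation elt := (path_elt p s).
Local Notation kms := (kms_state (gauge_dynamics gamma) beta).
Local Notation M := (@kms_mx R E beta).
Implicit Types (phi : T -> R[i]) (mu nu : gpath E).

Definition vertex_weights phi : 'cV[R]_#|vertex E| :=
  \col_i complex.Re (phi (p (enum_val i))).
Local Notation wt := vertex_weights.

Lemma coef_weights phi v : coef (wt phi) v = complex.Re (phi (p v)).
Proof. by rewrite /coef mxE enum_rankK. Qed.

Lemma state_p phi v : state phi -> phi (p v) = (coef (wt phi) v)%:C.
Proof.
move=> [_ phi0 _]; have := phi0 (p v); rewrite (p_adj hT) (p_idem hT) => /lec0P[H _].
by rewrite coef_weights -H.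
Qed.

Lemma sum_coef_weights phi : state phi -> \sum_v coef (wt phi) v = 1.
Proof.
move=> ps; have [pb _] := state_posfun ps.
have := state_vsum hT gen ps; rewrite /vsum bl_sum//.
rewrite (eq_bigr (fun v => (coef (wt phi) v)%:C)); last by move=> v _; exact: state_p.
by rewrite -rmorph_sum -(rmorph1 (real_complex R)) => -[].
Qed.

Lemma kms_edge phi e : kms phi ->
  phi (s e ** adj (s e)) = (expR (- beta))%:C * phi (p (src e)).
Proof.
move=> K; have h : path_rng (gvertex (src e)) = src e by [].
have := kms_formula hT hgamma (gcons h) (gcons h) K.
by rewrite eqxx (elt_cons hT) elt_vertex (s_p hT) path_len_cons path_src_cons mulr1.
Qed.

Lemma sum_in_edges_adjacency (g : vertex E -> R) v :
  \sum_(e | rng e == v) g (src e) =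
  \sum_i adjacency R E (enum_rank v) i * g (enum_val i).
Proof.
rewrite (partition_big (fun e => enum_rank (src e)) xpredT)//=.
apply: eq_bigr => i _; rewrite mxE enum_rankK.
rewrite (eq_bigr (fun=> g (enum_val i))); last first.
  by move=> e /andP[_ /eqP <-]; rewrite enum_rankK.
rewrite big_const iter_addr_0 mulr_natl; congr (_ *+ _).
apply: eq_card => e; rewrite [LHS]unfold_in -(can_eq enum_valK) enum_rankK.
by apply/idP/idP; rewrite inE.
Qed.

Lemma kms_defect phi v : kms phi ->
  phi (p v - \sum_(e | rng e == v) s e ** adj (s e)) = (coef (M *m wt phi) v)%:C.
Proof.
move=> K; case: (K) => ps _; have [pb _] := state_posfun ps.
rewrite blB// bl_sum// (eq_bigr (fun e => (expR (- beta) * coef (wt phi) (src e))%:C)); last first.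
  by move=> e _; rewrite kms_edge// state_p// -rmorphM.
rewrite state_p// -rmorph_sum -rmorphB; congr _%:C.
rewrite (sum_in_edges_adjacency (fun w => expR (- beta) * coef (wt phi) w)).
rewrite kms_mxE mulmxBl mul1mx /coef [RHS]mxE [X in _ = _ + X]mxE; congr (_ - _).
rewrite [RHS]mxE; apply: eq_bigr => i _.
by rewrite [X in _ = X * _]mxE enum_valK mulrCA mulrA.
Qed.

Lemma kms_Sigma phi : kms phi -> Sigma beta (M *m wt phi).
Proof.
move=> K; case: (K) => ps _; split; last first.
  by rewrite -sum_resolvent// mulKmx ?kms_mx_unit// sum_coef_weights.
move=> v; have [_ phi0 _] := ps.
case: (hT) => _ _ _ _ /(_ v [set e | rng e == v]%SET) [e|c cE]; first by rewrite inE => /eqP.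
have := phi0 c; rewrite -cE (eq_bigl (fun e => rng e == v)); last by move=> e; rewrite inE.
by rewrite kms_defect// lecR.
Qed.

Lemma kms_weights phi mu nu : kms phi -> phi (elt mu ** adj (elt nu)) =
  if mu == nu then (expR (- beta * (path_len mu)%:R) * coef (wt phi) (path_src mu))%:C
  else 0.
Proof.
move=> K; case: (K) => ps _; rewrite (kms_formula hT hgamma mu nu K).
by case: ifP => // _; rewrite state_p// -rmorphM.
Qed.

Lemma formula_weights phi m : (forall mu nu, phi (elt mu ** adj (elt nu)) =
    if mu == nu then (expR (- beta * (path_len mu)%:R) * coef m (path_src mu))%:C
    else 0) ->
  wt phi = m.
Proof.
move=> H; apply/colP => i; have := H (gvertex (enum_val i)) (gvertex (enum_val i)).
rewrite eqxx elt_vertex (p_adj hT) (p_idem hT) mulr0 expR0 mul1r mxE => ->.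
by rewrite /coef/= enum_valK.
Qed.

(** The combination is shown to be a positive functional with the right values; uniqueness
    identifies it with [phi], so its KMS property never has to be verified directly. *)
Lemma kms_convex (I : finType) (t : I -> R) (x : I -> T -> R[i]) phi :
  (forall i, 0 <= t i) -> (forall i, kms (x i)) -> kms phi ->
  wt phi = \sum_i t i *: wt (x i) -> phi = (fun a => \sum_i (t i)%:C * x i a).
Proof.
move=> t0 Kx K phiE; apply: (posfun_unique hT gen).
- by case: K => /state_posfun.
- have xp i : posfun (x i) by case: (Kx i) => /state_posfun.
  split; last first.
    move=> a; apply: sumr_ge0 => i _; rewrite mulr_ge0 ?lecR ?t0//.
    by case: (xp i).
  rewrite (_ : (fun a => _) = \sum_i (fun a => (t i)%:C * x i a)); last first.
    by apply/funext => a; rewrite fct_sumE.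
  apply: (big_ind (@bounded_linear R T)).
  + split=> [k a b|]; first by rewrite mulr0 addr0.
    by exists 0; split => // a; rewrite cmod0 mul0r.
  + move=> f g /bl_comb => /(_ g 1 1) H /H.
    by rewrite (_ : (fun a => _) = f + g)//; apply/funext => a; rewrite !mul1r.
  + move=> i _; have [xb _] := xp i; have := bl_comb (t i)%:C 0 xb xb.
    rewrite (_ : (fun a => _ + _) = fun a => (t i)%:C * x i a)//.
    by apply/funext => a; rewrite mul0r addr0.
- move=> mu nu; rewrite kms_weights//.
  rewrite (eq_bigr (fun i => if mu == nu then (expR (- beta * (path_len mu)%:R) *
      (t i * coef (wt (x i)) (path_src mu)))%:C else 0)); last first.
    move=> i _; rewrite kms_weights//; case: ifP => _; last by rewrite mulr0.
    by rewrite -rmorphM mulrCA.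
  case: ifP => _; last by rewrite big1.
  rewrite -rmorph_sum -mulr_sumr; congr (_ * _)%:C.
  by rewrite phiE /coef summxE; apply: eq_bigr => i _; rewrite mxE.
Qed.

Lemma kms_eq phi psi : kms phi -> kms psi -> wt phi = wt psi -> phi = psi.
Proof.
move=> K K' phiE; apply: (posfun_unique hT gen).
- by case: K => /state_posfun.
- by case: K' => /state_posfun.
- by move=> mu nu; rewrite !kms_weights// phiE.
Qed.

Hypothesis universal : forall (B : cstarAlgType R) (P : vertex E -> B) (S : edge E -> B),
  tck_family P S -> exists f : T -> B, [/\ star_hom f, forall v, f (p v) = P v
                                         & forall e, f (s e) = S e].

Lemma kms_exists eps : Sigma beta eps ->
  exists phi, kms phi /\ wt phi = invmx M *m eps.
Proof.
move=> He; have [Q [Qh Qp Qs]] := universal (path_space_tck R E).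
have K := gibbs_state_kms hT gen hgamma hbeta Qh Qp Qs He.
exists (gibbs_state hbeta Q He); split=> //.
rewrite -[LHS](mulKmx (kms_mx_unit hbeta)); congr (_ *m _); apply/colP => i.
have := kms_defect (enum_val i) K; rewrite (gibbs_state_defect hbeta Qh Qp Qs He) => -[].
by rewrite /coef enum_valK.
Qed.

End KMSStates.

(** Passage from vertices to ordinals as indices. The independence assumed is linear, which is
    stronger than affine independence. *)
Lemma simplex_finType (R : realType) (X : Type) (K : set (X -> R[i])) (I : finType)
    (x : I -> X -> R[i]) : (0 < #|I|)%N ->
  (forall t : I -> R, (forall a, \sum_i (t i)%:C * x i a = 0) -> forall i, t i = 0) ->
  K = [set phi | exists t : I -> R, [/\ forall i, 0 <= t i, \sum_i t i = 1
        & phi = (fun a => \sum_i (t i)%:C * x i a)]] ->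
  simplex K.
Proof.
move=> I0 indep KE; have hn : #|I|.-1.+1 = #|I| by rewrite prednK.
pose f (i : 'I_#|I|.-1.+1) : I := enum_val (cast_ord hn i).
pose g (i : I) : 'I_#|I|.-1.+1 := cast_ord (esym hn) (enum_rank i).
have fK : cancel f g by move=> i; rewrite /g /f enum_valK cast_ordK.
have gK : cancel g f by move=> i; rewrite /g /f cast_ordKV enum_rankK.
have fB : {on [pred i | xpredT i], bijective f} by apply: onW_bij; exists g.
exists #|I|.-1, (x \o f); split.
  move=> t _ t0 i; rewrite -(fK i); apply: (indep (t \o g)) => a.
  by rewrite (reindex f)//= -[RHS](t0 a); apply: eq_bigr => j _; rewrite fK.
rewrite KE; apply/seteqP; split=> phi [t [t0 t1 ->]].
  exists (t \o f); split=> //; first by move=> i; exact: t0.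
    by rewrite -t1 [RHS](reindex f).
  by apply/funext => a; rewrite (reindex f).
exists (t \o g); split; first by move=> i; exact: t0.
  by rewrite -t1 (reindex f)//=; apply: eq_bigr => j _; rewrite fK.
by apply/funext => a; rewrite [RHS](reindex f)//=; apply: eq_bigr => j _; rewrite fK.
Qed.

Theorem theorem3p1 (R : realType) (E : fin_digraph) (T : cstarAlgType R)
  (p : vertex E -> T) (s : edge E -> T) (gamma : R[i] -> T -> T) (beta : R)
  (hT : toeplitz_algebra p s) (hgamma : gauge_action p s gamma)
  (hbeta : (lne (spectral_radius (adjacency R E))%:E < beta%:E)%E) :
  let M := @kms_mx R E beta in
  let KMS := kms_state (gauge_dynamics gamma) beta in
  let formula (m : 'cV[R]_#|vertex E|) (phi : T -> R[i]) :=
    forall mu nu : gpath E,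
      phi (path_elt p s mu ** adj (path_elt p s nu)) =
      if mu == nu
      then (expR (- beta * (path_len mu)%:R) * coef m (path_src mu))%:C
      else 0 in
  [/\ (* (a) *)
      [/\ forall v : vertex E, path_series beta v \is a fin_num,
          forall v : vertex E, 1 <= path_sum beta v,
          M \in unitmx
        & forall eps : 'cV[R]_#|vertex E|, (forall v, 0 <= coef eps v) ->
            (prob_measure (invmx M *m eps) <->
             \sum_(v : vertex E) coef eps v * path_sum beta v = 1)],
      (* (b) *)
      forall eps : 'cV[R]_#|vertex E|, Sigma beta eps ->
        exists phi : T -> R[i], KMS phi /\ formula (invmx M *m eps) phi
    & (* (c) *)
      forall Phi : 'cV[R]_#|vertex E| -> T -> R[i],
        (forall eps, Sigma beta eps ->
           KMS (Phi eps) /\ formula (invmx M *m eps) (Phi eps)) ->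
        [/\ affine_on (Sigma beta) Phi,
            set_bij (Sigma beta) [set phi | KMS phi] Phi,
            simplex [set phi | KMS phi]
          & forall phi, KMS phi ->
              exists m : 'cV[R]_#|vertex E|,
                [/\ forall v, phi (p v) = (coef m v)%:C,
                    Sigma beta (M *m m) & Phi (M *m m) = phi]]].
Proof.
case: hT => tck gen universal; move=> M KMS formula.
have Mu : M \in unitmx by exact: kms_mx_unit.
have wt_formula m phi : formula m phi -> vertex_weights p phi = m.
  exact: formula_weights.
have coefD (x y : 'cV[R]_#|vertex E|) v : coef (x + y) v = coef x v + coef y v.
  by rewrite /coef mxE.
have coefZ k (x : 'cV[R]_#|vertex E|) v : coef (k *: x) v = k * coef x v.
  by rewrite /coef mxE.
split.
- split; [exact: path_series_fin | exact: path_sum_ge1 | exact: Mu|].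
  move=> eps e0; rewrite -(sum_resolvent hbeta); split=> [[]//|m1].
  split=> //; exact: kms_resolvent_ge0.
- move=> eps /(kms_exists tck gen hgamma hbeta universal)[phi [K phiE]].
  exists phi; split=> // mu nu; rewrite -phiE; exact: (kms_weights tck hgamma).
move=> Phi PhiP.
have K eps : Sigma beta eps -> KMS (Phi eps) by move=> /PhiP[].
have W eps : Sigma beta eps -> vertex_weights p (Phi eps) = invmx M *m eps.
  by move=> /PhiP[_ /wt_formula].
(* [Phi] is known only through values on spanning elements; uniqueness of positive functionals turns
   equal weights into equal states. *)
have PhiM phi : KMS phi -> Phi (M *m vertex_weights p phi) = phi.
  move=> Kphi; have S := kms_Sigma tck gen hgamma hbeta Kphi.
  by apply: (kms_eq tck gen hgamma (K _ S) Kphi); rewrite W// mulKmx.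
have Phi_comb (I : finType) (t : I -> R) (x : I -> 'cV[R]_#|vertex E|) :
    (forall i, 0 <= t i) -> (forall i, Sigma beta (x i)) ->
    Sigma beta (\sum_i t i *: x i) ->
    Phi (\sum_i t i *: x i) = (fun a => \sum_i (t i)%:C * Phi (x i) a).
  move=> t0 xS S; apply: (kms_convex tck gen hgamma t0 _ (K _ S)).
    by move=> i; exact: K.
  by rewrite W// mulmx_sumr; apply: eq_bigr => i _; rewrite W// scalemxAr.
have d0 v : 0 < @path_sum R E beta v by apply: lt_le_trans ltr01 _; exact: path_sum_ge1.
(* The extreme points of [Sigma]: basis vectors scaled by 1 / y_v, so that eps . y = 1. *)
pose d (v : vertex E) : 'cV[R]_#|vertex E| := (path_sum beta v)^-1 *: delta_mx (enum_rank v) 0.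
have dE v w : coef (d v) w = if w == v then (path_sum beta v)^-1 else 0.
  rewrite coefZ /coef mxE eqxx andbT (inj_eq enum_rank_inj).
  by case: ifP; rewrite ?mulr1 ?mulr0.
have sum_dE (t : vertex E -> R) v : coef (\sum_u t u *: d u) v = t v / path_sum beta v.
  rewrite /coef summxE (bigD1 v)//= mxE -/(coef (d v) v) dE eqxx big1 ?addr0// => u uv.
  by rewrite mxE -/(coef (d u) v) dE eq_sym (negbTE uv) mulr0.
have dS v : Sigma beta (d v).
  split=> [w|]; first by rewrite dE; case: ifP => // _; rewrite invr_ge0 ltW.
  rewrite (bigD1 v)//= dE eqxx mulVf ?gt_eqF// big1 ?addr0// => w wv.
  by rewrite dE (negbTE wv) mul0r.
have sum_dS (t : vertex E -> R) : (forall v, 0 <= t v) -> \sum_v t v = 1 ->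
    Sigma beta (\sum_v t v *: d v).
  move=> t0 t1; split=> [v|]; first by rewrite sum_dE divr_ge0// ltW.
  by rewrite -t1; apply: eq_bigr => v _; rewrite sum_dE divfK ?gt_eqF.
split.
- move=> x y t Sx Sy /andP[t0 t1].
  (* The two-point combination is written as a sum over [bool], to fit [Phi_comb]. *)
  pose z (b : bool) := if b then x else y; pose c (b : bool) := if b then t else 1 - t.
  have E1 : t *: x + (1 - t) *: y = \sum_b c b *: z b by rewrite big_bool.
  rewrite E1 Phi_comb ?big_bool//.
  + by apply/funext => a; rewrite big_bool.
  + by case; rewrite /c ?subr_ge0.
  + by case.
  case: Sx Sy => [x0 x1] [y0 y1]; split=> [v|].
    by rewrite coefD !coefZ addr_ge0// mulr_ge0// subr_ge0.
  under eq_bigr do rewrite coefD !coefZ mulrDl -!mulrA.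
  by rewrite big_split/= -!mulr_sumr x1 y1 !mulr1 addrC subrK.
- split; first exact: K.
    move=> x y; rewrite !inE => Sx Sy xy.
    by rewrite -(mulKVmx Mu x) -(mulKVmx Mu y) -!W// xy.
  move=> phi Kphi; exists (M *m vertex_weights p phi); last exact: PhiM.
  exact: (kms_Sigma tck gen hgamma hbeta Kphi).
- apply: (@simplex_finType _ _ _ _ (Phi \o d) (vertex_gt0 E)).
    (* Evaluating the relation at the vertex projections gives a relation of weight vectors;
       multiplying by [M] leaves the combination of the [d u], whose coordinates are t_v / y_v. *)
    move=> t t0 v; have : invmx M *m (\sum_u t u *: d u) = 0.
      apply/colP => i; rewrite [RHS]mxE mulmx_sumr summxE.
      have := t0 (p (enum_val i)) => /=.
      under eq_bigr do rewrite (state_p tck _ (K _ (dS _)).1) W// -rmorphM.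
      rewrite -rmorph_sum => -[] H; rewrite -[RHS]H; apply: eq_bigr => u _.
      by rewrite -scalemxAr mxE /coef enum_valK.
    move/(congr1 (mulmx M)); rewrite mulKVmx// mulmx0 => H.
    have := sum_dE t v; rewrite H /coef mxE => /esym /eqP.
    by rewrite mulf_eq0 invr_eq0 [path_sum _ _ == 0]gt_eqF// orbF => /eqP.
  apply/seteqP; split=> [phi Kphi|phi [t [t0 t1 ->]]].
    have [e0 e1] := kms_Sigma tck gen hgamma hbeta Kphi.
    set eps := M *m _ in e0 e1.
    (* The barycentric coordinates eps_v y_v, whose sum is eps . y = 1. *)
    exists (fun v => coef eps v * path_sum beta v); split=> //.
      by move=> v; rewrite mulr_ge0// ltW.
    have epsE : \sum_v (coef eps v * path_sum beta v) *: d v = eps.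
      apply/colP => i; have := sum_dE (fun v => coef eps v * path_sum beta v) (enum_val i).
      by rewrite mulfK ?gt_eqF// /coef enum_valK.
    rewrite -[LHS](PhiM _ Kphi) -/eps -{1}epsE; apply: Phi_comb => //.
      by move=> v; rewrite mulr_ge0// ltW.
    by rewrite epsE.
  rewrite /= -Phi_comb//; last exact: sum_dS.
  exact/K/sum_dS.
- move=> phi Kphi; exists (vertex_weights p phi); split.
  + by move=> v; exact: (state_p tck _ Kphi.1).
  + exact: (kms_Sigma tck gen hgamma hbeta Kphi).
  + exact: PhiM.
Qed.
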